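(* Using the order $<_2$ on $\mathcal A$, \[ C_\lambda[X(q-1);q,t]=\sum_{\sigma\ \Phi\text{-trivial}}(-1)^{m(\sigma)}q^{p(\sigma)+\mathrm{maj}(\sigma)}t^{\mathrm{quinv}(\sigma)}x^{|\sigma|} =\sum_{\mu\le\lambda'}d_{\mu\lambda}(q,t)\,m_\mu(X) \] for some $d_{\mu\lambda}(q,t)\in\mathbb Q(q,t)$, where $\lambda'$ is the conjugate partition, $\le$ is dominance order, $m_\mu$ are monomial symmetric functions, and the first sum is over all $\Phi$-trivial super fillings of $\mathrm{dg}(\lambda)$.
   Context: Let $\lambda=(\lambda_1\ge\dots\ge\lambda_k>0)$ be a partition; $\mathrm{dg}(\lambda)=\{(r,i):1\le i\le k,1\le r\le\lambda_i\}$, $(r,i)$ being row $r$ from the bottom and column $i$ from the left (columns bottom-justified of heights $\lambda_i$); $\mathrm{leg}((r,i))=\lambda_i-r$. $C_\lambda(X;q,t)=\sum_\sigma q^{\mathrm{maj}(\sigma)}t^{\mathrm{quinv}(\sigma)}x^\sigma$ over fillings $\sigma:\mathrm{dg}(\lambda)\to\mathbb Z_{>0}$ (the special case of the statistics below with all entries positive); it is a symmetric function, and $f[X(q-1)]$ is the plethysm sending power sums $p_m(X)\mapsto(q^m-1)p_m(X)$. $\mathcal A=\{1,\bar1,2,\bar2,\dots\}$ consists of positive letters $i$ and negative letters $\bar i$, $|i|=|\bar i|=i$, totally ordered by $<_2$: $0<1<2<3<\cdots<\bar3<\bar2<\bar1$. $I(a,b)=1$ if $a>b$ or $a=b$ is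 negative, and $I(a,b)=0$ if $a<b$ or $a=b$ is positive. A super filling is $\sigma:\mathrm{dg}(\lambda)\to\mathcal A$; a cell $u=(r,i)$, $r>1$, is a descent if $I(\sigma(u),\sigma((r-1,i)))=1$, and $\mathrm{maj}(\sigma)=\sum_{\text{descents }u}(\mathrm{leg}(u)+1)$. A triple is either three cells $(r+1,i),(r,i),(r,j)$ with $i<j$, or (degenerate) two cells $(r,i),(r,j)$ with $i<j$ and $\lambda_i=r$; with $a=\sigma((r+1,i))$ ($a=0$ if degenerate), $b=\sigma((r,i))$, $c=\sigma((r,j))$, it is a quinv triple iff exactly one of $I(a,b)=1$, $I(c,b)=0$, $I(a,c)=0$ holds; $\mathrm{quinv}(\sigma)$ is the number of quinv triples. $|\sigma|$ is $u\mapsto|\sigma(u)|$, $x^{|\sigma|}=\prod_u x_{|\sigma(u)|}$; $p(\sigma),m(\sigma)$ are the numbers of positive, resp. negative, entries. A super filling $\sigma$ is $\Phi$-trivial if there is no cell $(r,j)$ with $|\sigma((r,j))|<r$, i.e. every entry in row $r$ has absolute value at least $r$. *)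

(* Defs.v *)
From HB Require Import structures.
From mathcomp Require Import all_boot all_order all_algebra fraction.
From mathcomp Require Import mpoly.
Set Implicit Arguments.
Unset Strict Implicit.
Unset Printing Implicit Defensive.
Import GRing.Theory.
Local Open Scope ring_scope.

Definition Kqt : fieldType := {fraction {poly {poly rat}}}.
Definition qq : Kqt := tofrac (('X : {poly rat})%:P).
Definition tt : Kqt := tofrac ('X : {poly {poly rat}}).

Definition is_partition (la : seq nat) : bool :=
  sorted geq la && all (fun x => 0 < x)%N la.

Definition conj_part (la : seq nat) : seq nat :=
  [seq count (fun x => j < x)%N la | j <- iota 0 (head 0%N la)].

Definition dominated (mu nu : seq nat) : bool :=
  (sumn mu == sumn nu) &&
  all (fun k => sumn (take k mu) <= sumn (take k nu))%N
      (iota 0 (size mu + size nu).+1).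

(* Diagram.  We use 0-based coordinates internally: the cell (r, i) of the  *)
(* paper (row r from the bottom, column i from the left, 1-based)           *)
(* corresponds to the pair (i-1, r-1); a cell is a pair (column, row) with  *)
(* row < la_column.                                                         *)
Definition dg (la : seq nat) :=
  {p : 'I_(size la) * 'I_(foldr maxn 0%N la) | (p.2 < nth 0%N la p.1)%N}.

Definition cell_col (la : seq nat) (c : dg la) : nat := (val c).1.
Definition cell_row (la : seq nat) (c : dg la) : nat := (val c).2.

(* Super alphabet.  A letter is (neg, v) : bool * nat, standing for the     *)
(* letter of absolute value v (v >= 1) which is negative iff neg = true.    *)
(* The extra value 0 (used in degenerate triples) is encoded by None.       *)
(* Order <_2 :  0 < 1 < 2 < 3 < ... < bar3 < bar2 < bar1.                  *)
Definition sletter := (bool * nat)%type.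

Definition lt2 (a b : option sletter) : bool :=
  match a, b with
  | None, None => false
  | None, Some _ => true
  | Some _, None => false
  | Some (false, i), Some (false, j) => (i < j)%N
  | Some (false, _), Some (true, _) => true
  | Some (true, _), Some (false, _) => false
  | Some (true, i), Some (true, j) => (j < i)%N
  end.

Definition is_neg (a : option sletter) : bool :=
  if a is Some (true, _) then true else false.

Definition Ist (a b : option sletter) : bool :=
  lt2 b a || ((a == b) && is_neg a).

(* Super fillings with entries of absolute value in {1..n}: an entry        *)
(* (s, k) : bool * 'I_n stands for the letter of absolute value k+1,        *)
(* negative iff s = true.  (Restricting to x_1..x_n, i.e. x_i = 0 for i > n,*)
(* kills exactly the fillings using larger absolute values.)                *)
Definition sfilling (la : seq nat) (n : nat) := {ffun dg la -> bool * 'I_n}.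

Definition letter_of n (e : bool * 'I_n) : sletter := (e.1, (e.2 : nat).+1).

Definition entry (la : seq nat) n (s : sfilling la n) (r i : nat)
  : option sletter :=
  match [pick c : dg la | (cell_col c == i) && (cell_row c == r)] with
  | Some c => Some (letter_of (s c))
  | None => None
  end.

Definition is_cell (la : seq nat) (r i : nat) : bool :=
  (i < size la)%N && (r < nth 0%N la i)%N.

(* maj: sum over descents u (u not in the bottom row) of leg(u)+1;          *)
(* for u = (r,i) 0-based, leg(u) + 1 = la_i - r.                            *)
Definition maj (la : seq nat) n (s : sfilling la n) : nat :=
  \sum_(c : dg la | (0 < cell_row c)%N &&
        Ist (entry s (cell_row c) (cell_col c))
            (entry s (cell_row c).-1 (cell_col c)))
     (nth 0%N la (cell_col c) - cell_row c)%N.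

(* quinv triples: columns i < j, row r with (r,i), (r,j) cells;  a is the  *)
(* entry just above (r,i), or 0 (None) if (r,i) is the top of its column    *)
(* (degenerate triple).                                                     *)
Definition quinv_triple (a b c : option sletter) : bool :=
  (Ist a b + ~~ Ist c b + ~~ Ist a c == 1)%N.

Definition quinv (la : seq nat) n (s : sfilling la n) : nat :=
  #|[set x : 'I_(foldr maxn 0%N la) * 'I_(size la) * 'I_(size la) |
     let: (r, i, j) := x in
     [&& (i < j)%N, is_cell la r i, is_cell la r j &
         quinv_triple (entry s r.+1 i) (entry s r i) (entry s r j)]]|.

Definition npos (la : seq nat) n (s : sfilling la n) : nat :=
  #|[set c : dg la | ~~ (s c).1]|.
Definition nneg (la : seq nat) n (s : sfilling la n) : nat :=
  #|[set c : dg la | (s c).1]|.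

(* Phi-trivial: every entry in (1-based) row r has absolute value >= r,     *)
(* i.e. in 0-based terms  k+1 >= row+1.                                     *)
Definition phi_trivial (la : seq nat) n (s : sfilling la n) : bool :=
  [forall c : dg la, (cell_row c <= (s c).2)%N].

Definition xmon (la : seq nat) n (s : sfilling la n) : {mpoly Kqt[n]} :=
  \prod_(c : dg la) 'X_((s c).2).

Definition Cla (la : seq nat) (n : nat) : {mpoly Kqt[n]} :=
  \sum_(s : sfilling la n | [forall c, ~~ (s c).1])
     (qq ^+ maj s * tt ^+ quinv s) *: xmon s.

Definition superSum (la : seq nat) (n : nat) : {mpoly Kqt[n]} :=
  \sum_(s : sfilling la n | phi_trivial s)
     ((-1) ^+ nneg s * qq ^+ (npos s + maj s) * tt ^+ quinv s) *: xmon s.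

Definition psum (n m : nat) : {mpoly Kqt[n]} := \sum_(i < n) 'X_i ^+ m.

Definition mono_shape n (m : 'X_{1..n}) : seq nat :=
  sort geq [seq x <- (m : n.-tuple nat) | (0 < x)%N].

Definition msym_mono (n : nat) (mu : seq nat) : {mpoly Kqt[n]} :=
  \sum_(m : 'X_{1..n < (sumn mu).+1} | mono_shape m == mu) 'X_[m].

(* Main.v *)
Require Import Defs.
From HB Require Import structures.
From mathcomp Require Import all_boot all_order all_algebra fraction.
From mathcomp Require Import fingroup perm mpoly ring zify.
Set Implicit Arguments.
Unset Strict Implicit.
Unset Printing Implicit Defensive.
Import GRing.Theory.
Local Open Scope ring_scope.

(** Both statistics are written through the comparisons [I x y] of the letters in
    cells [x], [y].  For a triple (a, b, c) being a quinv triple amounts to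
    [I c b + I a c - I a b = 1], so [q ^ maj * t ^ quinv] is a product over pairs of
    cells of factors [G x y ^ I x y], where [G] is [t] for attacking pairs,
    [q ^ (leg + 1) / t ^ arm] for vertically adjacent ones and 1 otherwise.  In the
    reading order (rows bottom to top, left to right) these pairs form intervals:
    every cell between two interacting cells interacts with both, with weight [t].

    Symmetry in two consecutive letters: dropping the longest interacting pair
    changes the two-letter sum by a multiple of the sum over the remaining cells.

    Superization: the sum over super words loses the letters [x] and [y] when
    [y = - x] (flip the first cell containing them), so the difference with the
    plethystic substitution, as a polynomial in [y], vanishes at [- x] for more
    positive letters [x] than its degree allows.

    Phi-triviality: the value [a] is removed from all the rows above the [a]-th one.
    Consider the highest such row [R] that contains it.  Flipping the sign of the
    rightmost entry of absolute value [a] reverses the sign of the term unless it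
    lies in a column whose top cell is in row [R].  Columns of equal height can be
    exchanged at the cost of a power of [t] read off their top cells, and then the
    terms cancel by the q-binomial theorem.

    Triangularity: in a Phi-trivial filling the letters of absolute value at most
    [k] lie in the first [k] rows. *)

(** * Symmetry in two letters *)

(** One polynomial [P] in power sums must serve every number of variables. It comes from symmetry
    alone: a symmetric sum over words is unchanged when weights are averaged over the words of equal
    content, and the words with a given pattern of equal letters sum to a polynomial in power sums
    by inclusion and exclusion. Positive values [x] and negative values [y] enter through the sums
    of [x ^ k - (- y) ^ k]. The values [q x_i] and [- x_i] give [(q ^ k - 1) p_k], and they account
    for the signs and for the power of [q] counting positive entries.

    The given ring need not supply enough positive letters to serve as roots. They are adjoined as
    powers of an indeterminate that is finally set to 0; hence superization is stated over all
    integral domains.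

    For a top cell the two signs of an entry are not balanced: they differ by a power of [t]
    depending on its place among the top cells of its row. The interactions among these cells are
    therefore set aside. The remaining weight does change sign under a flip, and what was set aside
    returns as the coinversion number of the word of top entries. *)

Section TwoLetters.
Variables (R : comNzRingType) (V : finType) (rk : V -> nat).
Hypothesis rk_inj : injective rk.
Variable tau : R.
Implicit Types (S X : {set V}) (g : V -> V -> R).

(** [g] stands for pair factors minus 1, so that the value 0 means no interaction and [tau] plays
    the role of [t - 1]. The condition is relative to [S] in order to survive the deletion of
    positions. *)
Definition interval_weight S g :=
  {in S &, forall x y, g x y != 0 -> (rk y < rk x)%N /\
    {in S, forall z, (rk y < rk z < rk x)%N -> g x z = tau /\ g z y = tau}}.

(** [X] holds the positions of the larger letter; the factor [1 + g x y] appears exactly where the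
    letter at [x] exceeds the one at [y]. *)
Definition two_letter_sum S g (a b : R) : R :=
  \sum_(X : {set V} | X \subset S)
    a ^+ #|S :\: X| * b ^+ #|X| *
    \prod_(x in X) \prod_(y in S :\: X) (1 + g x y).

Lemma interval_weightS S S' g :
  S' \subset S -> interval_weight S g -> interval_weight S' g.
Proof.
move=> /subsetP sS gP x y /sS xS /sS yS nz; have [lt btw] := gP x y xS yS nz.
by split=> // z /sS; apply: btw.
Qed.

Lemma two_letter_sum0 S g a b : {in S &, forall x y, g x y = 0} ->
  two_letter_sum S g a b = two_letter_sum S g b a.
Proof.
move=> g0; rewrite /two_letter_sum.
have E c d : \sum_(X : {set V} | X \subset S)
    c ^+ #|S :\: X| * d ^+ #|X| *
    \prod_(x in X) \prod_(y in S :\: X) (1 + g x y) =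
  \sum_(X : {set V} | X \subset S) c ^+ #|S :\: X| * d ^+ #|X|.
  apply: eq_bigr => X /subsetP sXS; rewrite [X in _ * X]big1 ?mulr1 // => x xX.
  rewrite big1 // => y; rewrite inE => /andP[_ yS].
  by rewrite g0 ?addr0 // sXS.
rewrite !E (reindex_onto (fun X => S :\: X) (fun X => S :\: X)) /=; last first.
  by move=> X sXS; rewrite setDDr setDv set0U; apply/setIidPr.
apply: eq_big => [X|X /andP[_ /eqP e]]; last by rewrite e mulrC.
rewrite subsetDl setDDr setDv set0U /=.
by apply/eqP/idP => [<-|/setIidPr //]; rewrite subsetIl.
Qed.

(** Only the sets [X] with [x] inside and [y] outside see [g x y]. For these, another position [z]
    meets one of the two, as [(x, z)] or as [(z, y)]. Either factor is [1 + tau] if [z] lies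
    between, and 1 otherwise, by the maximal gap or by the direction of [g]. Hence the product over
    [z] does not depend on [X]. *)
Lemma two_letter_sum_split S g x y a b :
    x \in S -> y \in S -> g x y != 0 -> interval_weight S g ->
    {in S &, forall u v, g u v != 0 -> (rk u - rk v <= rk x - rk y)%N} ->
  two_letter_sum S g a b =
  two_letter_sum S (fun u v => if (u == x) && (v == y) then 0 else g u v) a b
  + g x y * (a * b) *
    (\prod_(z in S :\ x :\ y) (if (rk y < rk z < rk x)%N then 1 + tau else 1)) *
    two_letter_sum (S :\ x :\ y) g a b.
Proof.
move=> xS yS gxy gP gmax; have [ltyx btw] := gP x y xS yS gxy.
have nxy : x != y by apply: contraTneq ltyx => ->; rewrite ltnn.
have far u v : u \in S -> v \in S -> (rk x - rk y < rk u - rk v)%N -> g u v = 0.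
  move=> uS vS lt; apply/eqP; apply: contraTT lt => nz.
  by rewrite -leqNgt gmax.
have up u v : u \in S -> v \in S -> (rk u < rk v)%N -> g u v = 0.
  move=> uS vS lt; apply/eqP; apply: contraTT lt => nz.
  by rewrite -leqNgt ltnW //; have [] := gP u v uS vS nz.
apply/eqP; rewrite addrC -subr_eq; apply/eqP.
rewrite /two_letter_sum -sumrB (bigID (fun X => (x \in X) && (y \notin X))) /=.
rewrite [X in _ + X]big1 ?addr0; last first.
  move=> X /andP[sX nX]; apply/eqP; rewrite subr_eq0; apply/eqP; congr (_ * _).
  apply: eq_bigr => u uX; apply: eq_bigr => v; rewrite inE => /andP[vX _].
  case: ifP => // /andP[/eqP e1 /eqP e2]; move: nX; rewrite -e1 -e2 uX.
  by rewrite vX.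
rewrite (reindex_onto (fun X => x |: X) (fun X => X :\ x)) /=; last first.
  by move=> X /and3P[_ xX _]; rewrite setD1K.
rewrite big_distrr /=; apply: eq_big => [X|X].
  rewrite !inE eqxx /= (eq_sym y) (negbTE nxy) /=.
  apply/idP/idP.
    move=> /andP[/andP[/subsetP s ny] /eqP e]; apply/subsetP => z zX.
    rewrite !inE s ?inE ?zX ?orbT // andbT; apply/andP; split.
      by apply: contraNneq ny => <-.
    by apply: contraTneq zX => ->; rewrite -e !inE eqxx.
  move=> /subsetP s; have xX : x \notin X by apply/negP => /s; rewrite !inE eqxx andbF.
  rewrite setU1K // eqxx andbT; apply/andP; split; last first.
    by apply/negP => /s; rewrite !inE eqxx.
  by apply/subsetP => z /setU1P[-> //|/s]; rewrite !inE => /and3P[].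
rewrite !inE eqxx /= (eq_sym y) (negbTE nxy) /= => /andP[/andP[/subsetP sX nyX] /eqP eX].
have nxX : x \notin X by rewrite -eX !inE eqxx.
set S' := S :\ x :\ y.
have SX : S :\: (x |: X) = y |: (S' :\: X).
  apply/setP=> z; rewrite !inE; case: (altP (z =P y)) => [->|] /=.
    by rewrite eq_sym (negbTE nxy) (negbTE nyX) yS.
  by move=> nzy; rewrite negb_or andbCA andbA.
have nyS' : y \notin S' :\: X by rewrite !inE eqxx andbF.
have XS' : {subset X <= S'}.
  move=> z zX; rewrite !inE sX ?inE ?zX ?orbT // andbT; apply/andP; split.
    by apply: contraNneq nyX => <-.
  by apply: contraNneq nxX => <-.
have sS' z : z \in S' -> z \in S by rewrite !inE => /and3P[].
rewrite SX !cardsU1 nxX nyS' !add1n !exprS.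
rewrite !big_setU1 //= !eqxx /= addr0 mul1r.
have E1 h : {in X, forall u, h u =1 g u} ->
    \prod_(u in X) \prod_(v in y |: S' :\: X) (1 + h u v) =
    \prod_(u in X) ((1 + g u y) * \prod_(v in S' :\: X) (1 + g u v)).
  move=> hE; apply: eq_bigr => u uX; rewrite big_setU1 //= hE //.
  by congr (_ * _); apply: eq_bigr => v _; rewrite hE.
rewrite (E1 g) // (E1 (fun u v => if (u == x) && (v == y) then 0 else g u v)); last first.
  by move=> u uX v; rewrite (_ : u == x = false) //; apply: contraNF nxX => /eqP <-.
rewrite [X in _ - _ * (X * _)](eq_bigr (fun v => 1 + g x v)); last first.
  by move=> v; rewrite !inE => /and3P[_ vy _]; rewrite (negbTE vy).
rewrite big_split /=.
have -> : \prod_(z in S') (if (rk y < rk z < rk x)%N then 1 + tau else 1) =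
   \prod_(v in S' :\: X) (1 + g x v) * \prod_(u in X) (1 + g u y).
  rewrite (bigID (mem X)) /= mulrC; congr (_ * _).
    apply: eq_big => [z|z]; first by rewrite in_setD andbC.
    move=> /andP[zS' zX]; have zS := sS' _ zS'.
    move: zS'; rewrite !inE => /and3P[zy zx _].
    case: ifP => [bt|bt]; first by have [->] := btw z zS bt.
    have [lt|lt|/rk_inj e] := ltngtP (rk z) (rk x); last by rewrite e eqxx in zx.
      rewrite far ?addr0 // ltn_sub2l //.
      have : rk z != rk y by rewrite (inj_eq rk_inj).
      by move: bt; rewrite lt andbT => /negbT; rewrite -leqNgt leq_eqVlt => /orP[->|->].
    by rewrite up ?addr0.
  apply: eq_big => [z|z].
    by apply: andb_idl; apply: XS'.
  move=> /andP[zS' zX]; have zS := sS' _ zS'.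
  move: zS'; rewrite !inE => /and3P[zy zx _].
  case: ifP => [bt|bt]; first by have [_ ->] := btw z zS bt.
  have [lt|lt|/rk_inj e] := ltngtP (rk z) (rk y); last by rewrite e eqxx in zy.
    by rewrite up ?addr0.
  rewrite far ?addr0 // ltn_sub2r //.
  move: bt; rewrite lt /= => /negbT; rewrite -leqNgt leq_eqVlt => /orP[/eqP /rk_inj e|//].
  by rewrite e eqxx in zx.
ring.
Qed.

(** Induction on the number of positions plus the number of interacting pairs. Deleting a pair of
    largest gap keeps [interval_weight], since a pair whose interval required it would have a larger
    gap. The correction term is symmetric by induction on [S]. *)
Lemma two_letter_sumC S g a b : interval_weight S g ->
  two_letter_sum S g a b = two_letter_sum S g b a.
Proof.
pose supp S g := [set p : V * V | [&& p.1 \in S, p.2 \in S & g p.1 p.2 != 0]].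
have [n] := ubnP (#|S| + #|supp S g|)%N; elim: n S g => // n IH S g lt gP.
case: (set_0Vmem (supp S g)) => [e|[p0 p0S]].
  apply: two_letter_sum0 => x y xS yS; apply/eqP; apply/negPn/negP => nz.
  by have := in_set0 (x, y); rewrite -e inE /= xS yS nz.
case: (arg_maxnP (fun p : V * V => rk p.1 - rk p.2)%N p0S) => -[x y] xyS /= gmax.
have : (x, y) \in supp S g by []; rewrite inE /= => /and3P[xS yS gxy].
have [ltyx btw] := gP x y xS yS gxy.
have gm : {in S &, forall u v, g u v != 0 -> (rk u - rk v <= rk x - rk y)%N}.
  move=> u v uS vS nz; apply: (gmax (u, v)).
  by suff : (u, v) \in supp S g by []; rewrite inE /= uS vS.
rewrite !(two_letter_sum_split _ _ xS yS gxy gP gm).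
have sub : S :\ x :\ y \subset S by apply/subsetP => z; rewrite !inE => /and3P[].
congr (_ + _); last first.
  rewrite (mulrC b); congr (_ * _); apply: IH; last exact: interval_weightS gP.
  rewrite -ltnS; apply: leq_trans lt; rewrite ltnS -addSn leq_add //.
    apply: proper_card; apply/properP; split=> //; exists x => //.
    by rewrite !inE eqxx andbF.
  apply: subset_leq_card; apply/subsetP => -[u v]; rewrite !inE /=.
  by case/and3P => /and3P[_ _ ->] /and3P[_ _ ->] ->.
apply: IH.
  rewrite -ltnS; apply: leq_trans lt; rewrite ltnS -addnS leq_add //.
  apply: proper_card; apply/properP; split.
    by apply/subsetP => -[u v]; rewrite !inE /=; case: ifP; rewrite ?eqxx ?andbF.
  by exists (x, y); rewrite !inE /= ?xS ?yS ?gxy // !eqxx /= ?eqxx ?andbF.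
move=> u v uS vS; case: ifP; rewrite ?eqxx // => nuv nz.
have [ltvu bt] := gP u v uS vS nz; split=> // z zS lz.
have [h1 h2] := bt z zS lz; case/andP: lz => l1 l2; split.
  case: ifP => // /andP[/eqP ux /eqP zy]; have := gm u v uS vS nz.
  by rewrite leqNgt -ux -zy ltn_sub2l.
case: ifP => // /andP[/eqP ux /eqP zy]; have := gm u v uS vS nz.
by rewrite leqNgt -ux -zy ltn_sub2r.
Qed.

End TwoLetters.

(** * Weighted sums over words *)

Definition pair_weight (R : comNzRingType) (V L : finType) (I : rel L)
    (g : V -> V -> R) (w : {ffun V -> L}) : R :=
  \prod_x \prod_y (1 + g x y *+ I (w x) (w y)).

Definition word_sum (R : comNzRingType) (V L : finType) (I : rel L)
    (g : V -> V -> R) (val : L -> R) : R :=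
  \sum_(w : {ffun V -> L}) pair_weight I g w * \prod_v val (w v).

Section WordSum.
Variables (R : comNzRingType) (V : finType) (rk : V -> nat).
Hypothesis rk_inj : injective rk.
Variable tau : R.

Lemma eq_word_sum (L : finType) (I : rel L) (g : V -> V -> R) (val val' : L -> R) :
  val =1 val' -> word_sum I g val = word_sum I g val'.
Proof.
by move=> E; apply: eq_bigr => w _; congr (_ * _); apply: eq_bigr => v _.
Qed.

Lemma word_sum_morph (R' : comNzRingType) (phi : {rmorphism R -> R'})
    (L : finType) (I : rel L) (g : V -> V -> R) (val : L -> R) :
  phi (word_sum I g val) =
  word_sum I (fun x y => phi (g x y)) (fun c => phi (val c)).
Proof.
rewrite /word_sum rmorph_sum; apply: eq_bigr => w _; rewrite rmorphM !rmorph_prod.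
congr (_ * _); apply: eq_bigr => x _; rewrite rmorph_prod.
by apply: eq_bigr => y _; rewrite rmorphD rmorph1 rmorphMn.
Qed.

(** A word using a letter of value 0 contributes nothing. This serves to set extra variables to 0
    and to restrict super words to positive letters. *)
Lemma word_sum_embed (L L' : finType) (I : rel L) (I' : rel L') (f : L -> L')
    (g : V -> V -> R) (val : L' -> R) :
  injective f -> (forall a b, I' (f a) (f b) = I a b) ->
  (forall c, c \notin codom f -> val c = 0) ->
  word_sum I' g val = word_sum I g (val \o f).
Proof.
move=> f_inj fI val0; pose h (w : {ffun V -> L}) := [ffun v => f (w v)].
have h_inj : injective h.
  by move=> w w' /ffunP e; apply/ffunP => v; have := e v; rewrite !ffunE => /f_inj.
rewrite /word_sum (bigID (mem [set h w | w : {ffun V -> L}])) /=.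
rewrite [X in _ + X]big1 ?addr0; last first.
  move=> w nw; have [v fv] : exists v, w v \notin codom f.
    apply/existsP; rewrite -negb_forall; apply: contra nw => /forallP wf.
    apply/imsetP; exists [ffun v => iinv (wf v)] => //.
    by apply/ffunP => v; rewrite !ffunE f_iinv.
  by rewrite (bigD1 v) //= (val0 _ fv) mul0r mulr0.
rewrite big_imset /=; last by move=> ? ? _ _ /h_inj.
apply: eq_bigr => w _; congr (_ * _).
  by apply: eq_bigr => x _; apply: eq_bigr => y _; rewrite !ffunE fI.
by apply: eq_bigr => v _; rewrite ffunE.
Qed.

(** * Exchange and cancellation of two letters in a sum over words *)

Section Letters.
Variables (L : finType) (I : rel L) (g : V -> V -> R) (a b : L).
Hypothesis nab : a != b.

(** Words are grouped by the word [u] obtained on replacing every [b] by [a]. The two letters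
    compare alike with all others, so each group contributes a common factor times a two-letter sum
    over the positions of [a] in [u]. *)
Lemma word_sum_swap (val : L -> R) :
  interval_weight rk tau setT g ->
  I a a = false -> I b b = false -> I a b = false -> I b a = true ->
  (forall c, c != a -> c != b -> I a c = I b c /\ I c a = I c b) ->
  word_sum I g (val \o tperm a b) = word_sum I g val.
Proof.
move=> gP Iaa Ibb Iab Iba Iext.
pose p (w : {ffun V -> L}) := [ffun v => if w v == b then a else w v].
rewrite /word_sum (partition_big p predT) //= [RHS](partition_big p predT) //=.
apply: eq_bigr => u _.
pose S := [set v | u v == a].
(* A word [u] still containing [b] is the image of no word. *)
have [bu|] := boolP [exists v, u v == b]; last rewrite negb_exists => /forallP nbu.
  have {bu}[v /eqP uv] := existsP bu.
  rewrite !big1 // => w /eqP e; move/ffunP/(_ v): e; rewrite ffunE uv.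
    by case: eqP => [_ e|//]; move: nab; rewrite e eqxx.
  by case: eqP => [_ e|//]; move: nab; rewrite e eqxx.
pose ins (X : {set V}) := [ffun v => if v \in X then b else u v].
pose K := \prod_x \prod_(y | ~~ ((x \in S) && (y \in S))) (1 + g x y *+ I (u x) (u y)).
have key (vl : L -> R) : \sum_(w | p w == u) pair_weight I g w * \prod_v vl (w v) =
   K * (\prod_(v | v \notin S) vl (u v)) * two_letter_sum S g (vl a) (vl b).
  rewrite (reindex_onto ins (fun w => [set v | w v == b])) /=; last first.
    move=> w /eqP e; apply/ffunP => v; rewrite ffunE inE; case: eqP => [//|n].
    by rewrite -e ffunE; case: eqP.
  rewrite big_distrr /=; apply: eq_big => [X|X].
    apply/andP/idP => [[/eqP /ffunP e _]|/subsetP sX].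
      by apply/subsetP => v vX; rewrite inE; have := e v; rewrite !ffunE vX eqxx => <-.
    split; [apply/eqP/ffunP => v|apply/eqP/setP => v; rewrite inE]; rewrite !ffunE.
      have [/sX|vX] := boolP (v \in X); first by rewrite inE eqxx => /eqP.
      by have := nbu v; case: eqP.
    by case: ifP => [_|vX]; [rewrite eqxx | have := nbu v; case: eqP].
  move=> /andP[/eqP /ffunP e _].
  have sX v : v \in X -> u v = a by move=> vX; have := e v; rewrite !ffunE vX eqxx => <-.
  have W : pair_weight I g (ins X) = K * \prod_(x in X) \prod_(y in S :\: X) (1 + g x y).
    rewrite /pair_weight /K.
    transitivity (\prod_x ((\prod_(y | ~~ ((x \in S) && (y \in S)))
        (1 + g x y *+ I (u x) (u y))) *
        (if x \in X then \prod_(y in S :\: X) (1 + g x y) else 1))).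
      apply: eq_bigr => x _; rewrite (bigID (fun y => (x \in S) && (y \in S))) /= mulrC.
      congr (_ * _).
        apply: eq_bigr => y nxy; congr (1 + _ *+ _); congr nat_of_bool; rewrite !ffunE.
        have ext v : u v != a -> I b (u v) = I a (u v) /\ I (u v) b = I (u v) a.
          by move=> ca; have [-> ->] := Iext _ ca (nbu v).
        case: ifP => xX; case: ifP => yX //.
        - by move: nxy; rewrite !inE !sX // eqxx.
        - rewrite (sX _ xX); apply: (ext _ _).1; apply: contraNneq nxy => uy.
          by rewrite !inE uy (sX _ xX) eqxx.
        - rewrite (sX _ yX); apply: (ext _ _).2; apply: contraNneq nxy => uy.
          by rewrite !inE uy (sX _ yX) eqxx.
      case: (boolP (x \in S)) => /= xS; last first.
        rewrite big_pred0 //; case: ifP => // /sX ux.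
        by move: xS; rewrite inE ux eqxx.
      rewrite (bigID (mem X)) /= big1 ?mul1r.
        case: ifP => xX.
          apply: eq_big => [y|y /andP[yS yX]]; first by rewrite in_setD andbC.
          rewrite !ffunE xX (negbTE yX); move: yS; rewrite inE => /eqP ->.
          by rewrite Iba.
        apply: big1 => y /andP[yS yX]; rewrite !ffunE xX (negbTE yX).
        by move: yS xS; rewrite !inE => /eqP-> /eqP->; rewrite Iaa addr0.
      move=> y /andP[yS yX]; rewrite !ffunE yX; case: ifP => _; first by rewrite Ibb addr0.
      by move: xS; rewrite !inE => /eqP->; rewrite Iab addr0.
    by rewrite big_split /= -big_mkcond.
  rewrite W.
  have -> : \prod_v vl (ins X v) = \prod_(v | v \notin S) vl (u v) *
     (vl a ^+ #|S :\: X| * vl b ^+ #|X|).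
    rewrite (bigID (mem S)) /= mulrC; congr (_ * _).
      apply: eq_bigr => v vS; rewrite ffunE; case: ifP => // /sX uv.
      by move: vS; rewrite inE uv eqxx.
    rewrite (bigID (mem X)) /= mulrC -!prodr_const; congr (_ * _).
      apply: eq_big => [v|v /andP[vS vX]]; first by rewrite in_setD andbC.
      by rewrite ffunE (negbTE vX); move: vS; rewrite inE => /eqP ->.
    apply: eq_big => [v|v /andP[vS vX]]; last by rewrite ffunE vX.
    by apply: andb_idl => /sX; rewrite inE => ->.
  ring.
rewrite (key (val \o tperm a b)) (key val) /= tpermL tpermR (two_letter_sumC rk_inj _ _ (interval_weightS (subsetT _) gP)).
congr (_ * _ * _); apply: eq_bigr => v; rewrite inE => uva.
by rewrite tpermD // eq_sym // nbu.
Qed.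

(* Changing [a] into [b] in the first cell containing one of them leaves the weight
   unchanged, because among [a] and [b] the relation [I] only reads its first argument. *)
Lemma word_sum_cancel (val : L -> R) :
  GRing.lreg (2%:R : R) ->
  (forall x y, g x y != 0 -> (rk y < rk x)%N) ->
  I a a = false -> I a b = false -> I b a = true -> I b b = true ->
  (forall c, c != a -> c != b -> val c != 0 -> I a c = I b c /\ I c a = I c b) ->
  val b = - val a ->
  word_sum I g val =
  word_sum I g (fun c => if (c == a) || (c == b) then 0 else val c).
Proof.
move=> reg2 gP Iaa Iab Iba Ibb Iext valN.
pose hit (w : {ffun V -> L}) v := (w v == a) || (w v == b).
pose F w := pair_weight I g w * \prod_v val (w v).
have h0 (w : {ffun V -> L}) v : hit w v ->
    \prod_v (if (w v == a) || (w v == b) then 0 else val (w v)) = 0.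
  by move=> hv; rewrite (bigD1 v) //= -/(hit w v) hv mul0r.
have -> : word_sum I g (fun c => if (c == a) || (c == b) then 0 else val c) =
   \sum_(w | ~~ [exists v, hit w v]) F w.
  rewrite [RHS]big_mkcond /=; apply: eq_bigr => w _; case: ifPn => [|/negPn/existsP[v hv]].
    rewrite negb_exists => /forallP nh; congr (_ * _); apply: eq_bigr => v _.
    by rewrite -/(hit w v) (negbTE (nh v)).
  by rewrite (h0 w v hv) mulr0.
rewrite /word_sum (bigID (fun w => [exists v, hit w v])) /= -/F.
suff -> : \sum_(w | [exists v, hit w v]) F w = 0 by rewrite add0r.
pose fl c := if c == a then b else a.
pose phi (w : {ffun V -> L}) := if [pick v | hit w v] is Some v0 then
   let u := [arg min_(v < v0 | hit w v) rk v] in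
   [ffun v => if v == u then fl (w v) else w v] else w.
have phiP w : [exists v, hit w v] -> exists2 u, hit w u /\
    (forall v, hit w v -> (rk u <= rk v)%N) &
    phi w = [ffun v => if v == u then fl (w v) else w v].
  move=> /existsP[v hv]; rewrite /phi; case: pickP => [v0 h|/(_ v)]; last by rewrite hv.
  by case: arg_minnP => // u hu mu; exists u.
have flP c : ((c == a) || (c == b)) -> ((fl c == a) || (fl c == b)) /\ fl (fl c) = c.
  rewrite /fl; have [->|_] := eqVneq c a; first by rewrite ![b == a]eq_sym (negbTE nab) eqxx.
  by move=> /= /eqP->; rewrite !eqxx.
have hit_phi w u : phi w = [ffun v => if v == u then fl (w v) else w v] ->
    hit w u -> hit (phi w) =1 hit w.
  move=> e hu v; rewrite /hit e ffunE; have [->|//] := eqVneq v u.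
  by have [-> _] := flP _ hu; rewrite -/(hit w u) hu.
have phiK w : [exists v, hit w v] -> phi (phi w) = w.
  move=> hw; have [u [hu mu] e] := phiP w hw; have eh := hit_phi w u e hu.
  have hw' : [exists v, hit (phi w) v] by apply/existsP; exists u; rewrite eh.
  have [u' [hu' mu'] ->] := phiP _ hw'.
  have uu' : u = u'.
    by apply: rk_inj; apply/eqP; rewrite eqn_leq mu ?mu' -?eh // eh.
  apply/ffunP => v; rewrite !ffunE -uu' e ffunE; have [->|//] := eqVneq v u.
  by have [_ ->] := flP _ hu.
have phiN w : [exists v, hit w v] -> F (phi w) = - F w.
  move=> hw; have [u [hu mu] e] := phiP w hw.
  (* A word with a letter of value 0 elsewhere contributes 0 before and after the change, so
     comparisons matter only for letters of nonzero value. *)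
  have [/existsP[v /andP[hv /eqP vv]]|] := boolP [exists v, ~~ hit w v && (val (w v) == 0)].
    have vu : v != u by apply: contraNneq hv => ->.
    rewrite /F (bigD1 v) //= e ffunE (negbTE vu) vv mul0r mulr0.
    by rewrite (bigD1 v) //= vv mul0r mulr0 oppr0.
  rewrite negb_exists => /forallP nz.
  have ext v : ~~ hit w v -> I a (w v) = I b (w v) /\ I (w v) a = I (w v) b.
    move=> hv; have := nz v; rewrite hv /= => vv; move: hv; rewrite /hit negb_or.
    by case/andP => n1 n2; apply: Iext.
  have flE c : (c == a) || (c == b) ->
      (forall d, I a d = I b d -> I (fl c) d = I c d) /\
      (forall d, I d a = I d b -> I d (fl c) = I d c) /\ val (fl c) = - val c.
    rewrite /fl; have [->|_ /= /eqP->] := eqVneq c a.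
      by rewrite valN; split=> [d ->|] //; split=> // d ->.
    by rewrite valN opprK; split=> // d ->.
  have Inext v : hit w v -> I (w v) a = I (w v) b.
    by rewrite /hit => /orP[] /eqP->; rewrite ?Iaa ?Iab ?Iba ?Ibb.
  rewrite /F -mulrN; congr (_ * _).
    apply: eq_bigr => x _; apply: eq_bigr => y _.
    have [->|gxy] := eqVneq (g x y) 0; first by rewrite !mul0rn.
    have lt := gP _ _ gxy; congr (1 + _ *+ _); congr nat_of_bool; rewrite e !ffunE.
    have [E1 [E2 _]] := flE _ hu.
    have [xu|_] := eqVneq x u; have [yu|_] := eqVneq y u => //.
    - by rewrite xu yu ltnn in lt.
    - rewrite xu; apply: E1; have [] // := ext y.
      by apply: contraL lt => /mu; rewrite -leqNgt xu.
    rewrite yu; apply: E2; have [hx|hx] := boolP (hit w x); first exact: Inext.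
    by have [] := ext x hx.
  rewrite (bigD1 u) //= [in RHS](bigD1 u) //= -mulNr; congr (_ * _).
    by rewrite e ffunE eqxx; have [_ [_ ->]] := flE _ hu.
  by apply: eq_bigr => v vu; rewrite e ffunE (negbTE vu).
set Z := \sum_(w | _) _.
have ZN : Z = - Z.
  rewrite {1}/Z (reindex_onto phi phi) /=; last by move=> w /phiK.
  rewrite -sumrN; apply: eq_big => [w|w /andP[hw /eqP e]].
    apply/idP/idP => [/andP[hw /eqP e]|hw].
      have [u [hu _] eu] := phiP _ hw; rewrite -e; apply/existsP; exists u.
      by rewrite (hit_phi _ _ eu hu).
    have [u [hu _] eu] := phiP _ hw; rewrite (phiK _ hw) eqxx andbT.
    by apply/existsP; exists u; rewrite (hit_phi _ _ eu hu).
  by rewrite phiN // -e; have [u [hu _] eu] := phiP _ hw; apply/existsP; exists u; rewrite (hit_phi _ _ eu hu).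
apply: reg2; rewrite mulr0 mulr_natl mulr2n {1}ZN addNr //.
Qed.

End Letters.
End WordSum.

(** * Superization *)

Definition superI n : rel (bool * 'I_n) :=
  fun e f => Ist (Some (letter_of e)) (Some (letter_of f)).

Lemma superIE n (e f : bool * 'I_n) :
  superI e f = if e.1 then (~~ f.1) || (e.2 <= f.2)%N else ~~ f.1 && (f.2 < e.2)%N.
Proof.
case: e f => [[] i] [[] j]; rewrite /superI /Ist /letter_of /= ?andbF ?orbF ?andbT //.
rewrite ltnS [RHS]leq_eqVlt orbC; congr (_ || _).
Qed.

(** * Symmetry of super word sums in the positive letters *)

Section PermutePositive.
Variables (R : comNzRingType) (V : finType) (rk : V -> nat).
Hypothesis rk_inj : injective rk.
Variables (tau : R) (g : V -> V -> R).
Hypothesis gP : interval_weight rk tau setT g.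
Variable n : nat.

Definition permute_pos (s : 'S_n) (val : bool * 'I_n -> R) (e : bool * 'I_n) :=
  if e.1 then val e else val (false, s e.2).

Let inv s := forall val, word_sum (@superI n) g (permute_pos s val) = word_sum (@superI n) g val.

Let inv_mul s t : inv s -> inv t -> inv (s * t)%g.
Proof.
move=> hs ht val; rewrite -[RHS]ht -[RHS]hs; apply: eq_word_sum => -[[] i] //.
by rewrite /permute_pos /= permM.
Qed.

Let inv_adj (i j : 'I_n) : j = i.+1 :> nat -> inv (tperm i j).
Proof.
move=> ij val.
have nij : i != j by apply: contra_eqN ij => /eqP->; rewrite neq_ltn ltnSn.
rewrite -[RHS](@word_sum_swap R V rk rk_inj tau _ (@superI n) g (false, i) (false, j)) //.
- apply: eq_word_sum => -[[] k]; rewrite /permute_pos /=.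
    by rewrite tpermD.
  have [->|ki] := eqVneq k i; first by rewrite !tpermL.
  have [->|kj] := eqVneq k j; first by rewrite !tpermR.
  by rewrite !tpermD // ?xpair_eqE eq_sym.
- by rewrite superIE /= ltnn.
- by rewrite superIE /= ltnn.
- by rewrite superIE /= ij; lia.
- by rewrite superIE /= ij; lia.
move=> [[] k]; rewrite !superIE //= !xpair_eqE /= => ki kj.
have : k != i :> nat by []. have : k != j :> nat by []. rewrite ij; lia.
Qed.

Let inv_tperm (i j : 'I_n) : inv (tperm i j).
Proof.
wlog ij : i j / (i <= j)%N.
  by move=> h; case: (leqP i j) => [/h//|/ltnW /h]; rewrite tpermC.
have [m] := ubnP (j - i)%N; elim: m j ij => // m IH j ij lt.
have [e|nij] := eqVneq i j.
  by rewrite e tperm1 => val; apply: eq_word_sum => -[[] k] //; rewrite /permute_pos /= perm1.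
have lij : (i < j)%N by rewrite ltn_neqAle nij.
have k_lt : (j.-1 < n)%N by apply: leq_ltn_trans (leq_pred j) (ltn_ord j).
pose k := Ordinal k_lt.
have kj : j = k.+1 :> nat by rewrite /= prednK //; lia.
have [ik|nik] := eqVneq i k; first by apply: inv_adj; rewrite ik.
have e : tperm i j = (tperm k j * (tperm i k * tperm k j))%g.
  have -> : tperm i j = (tperm i k ^ tperm k j)%g.
    by rewrite tpermJ tpermL tpermD // eq_sym // -val_eqE /=; lia.
  by rewrite /conjg tpermV.
rewrite e; apply: inv_mul; first exact: inv_adj.
apply: inv_mul; last exact: inv_adj.
by apply: IH => /=; lia.
Qed.

Lemma word_sum_permute_pos s val :
  word_sum (@superI n) g (permute_pos s val) = word_sum (@superI n) g val.
Proof.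
have [ts -> _] := prod_tpermP s; elim: ts val => [|t ts IH] val.
  by rewrite big_nil; apply: eq_word_sum => -[[] k] //; rewrite /permute_pos /= perm1.
by rewrite big_cons; apply: inv_mul => //; apply: inv_tperm.
Qed.

End PermutePositive.

(** The power sum of the plethystic difference between the positive letters and the opposites of the
    negative ones: a negative letter of value [- x] cancels a positive letter of value [x]. *)
Definition super_psum (R : pzRingType) n (val : bool * 'I_n -> R) (k : nat) : R :=
  \sum_i val (false, i) ^+ k - \sum_i (- val (true, i)) ^+ k.

(** * Degree bounds for products and substitutions *)

Section DegreeBounds.
Variable R : idomainType.
Implicit Types p q : {poly R}.

Lemma size_mul_bound p q a b :
  (size p <= a.+1)%N -> (size q <= b.+1)%N -> (size (p * q)%R <= (a + b).+1)%N.
Proof. by move=> hp hq; apply: leq_trans (size_polyMleq _ _) _; lia. Qed.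

Lemma size_prod_bound (J : Type) (r : seq J) (F : J -> {poly R}) (b : J -> nat) :
  (forall j, size (F j) <= (b j).+1)%N ->
  (size (\prod_(j <- r) F j)%R <= (\sum_(j <- r) b j).+1)%N.
Proof.
move=> h; elim: r => [|j r IH]; first by rewrite !big_nil size_poly1.
by rewrite !big_cons size_mul_bound.
Qed.

Lemma size_exp_bound p a k : (size p <= a.+1)%N -> (size (p ^+ k)%R <= (a * k).+1)%N.
Proof.
move=> h; elim: k => [|k IH]; first by rewrite expr0 size_poly1 muln0.
by rewrite exprS mulnS size_mul_bound.
Qed.

Lemma size_sum_bound (J : Type) (r : seq J) (P : pred J) (F : J -> {poly R}) b :
  (forall j, P j -> size (F j) <= b)%N -> (size (\sum_(j <- r | P j) F j)%R <= b)%N.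
Proof.
move=> h; elim/big_rec: _ => [|j p Pj IH]; first by rewrite size_poly0.
by apply: leq_trans (size_polyD _ _) _; rewrite geq_max h.
Qed.

Lemma size_mmap_bound (K : nzRingType) (phi : {rmorphism K -> R}) D (h : 'I_D -> {poly R})
    (P : {mpoly K[D]}) b :
  (forall i, size (h i) <= b.+1)%N ->
  (size (mmap (polyC \o phi) h P) <= (b * msize P).+1)%N.
Proof.
move=> hb; rewrite /mmap; apply: leq_trans (_ : _ <= (b * msize P).+1)%N _ => //.
rewrite big_seq; apply: size_sum_bound => m mP /=.
rewrite -[(_ * _).+1]/(0 + b * msize P).+1 size_mul_bound ?size_polyC ?leq_b1 //.
rewrite /mmap1; apply: leq_trans (size_prod_bound _ (fun i => size_exp_bound (m i) (hb i))) _.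
rewrite ltnS -big_distrr /= leq_mul2l -mdegE; apply/orP; right.
by apply: ltnW; apply: msize_mdeg_lt.
Qed.

End DegreeBounds.

Lemma mmap_morph (K : nzRingType) (R R' : comNzRingType) D (phi : K -> R)
    (th : {rmorphism R -> R'}) (h : 'I_D -> R) (P : {mpoly K[D]}) :
  th (mmap phi h P) = mmap (th \o phi) (th \o h) P.
Proof.
rewrite /mmap rmorph_sum; apply: eq_bigr => m _; rewrite rmorphM; congr (_ * _).
by rewrite /mmap1 rmorph_prod; apply: eq_bigr => i _; rewrite rmorphXn.
Qed.

Lemma eq_mmap (K : nzRingType) (R : comNzRingType) D (phi phi' : K -> R)
    (h h' : 'I_D -> R) (P : {mpoly K[D]}) :
  phi =1 phi' -> h =1 h' -> mmap phi h P = mmap phi' h' P.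
Proof.
move=> e1 e2; apply: eq_bigr => m _; rewrite e1; congr (_ * _).
by apply: eq_bigr => i _; rewrite e2.
Qed.

Lemma super_psum_morph (R R' : comNzRingType) (th : {rmorphism R -> R'}) n
    (val : bool * 'I_n -> R) k :
  th (super_psum val k) = super_psum (fun c => th (val c)) k.
Proof.
rewrite /super_psum rmorphB !rmorph_sum; congr (_ - _).
  by apply: eq_bigr => i _; rewrite rmorphXn.
by apply: eq_bigr => i _; rewrite rmorphXn rmorphN.
Qed.

(** * Induction on the number of negative letters *)

Section Superization.
Variables (K : fieldType) (V : finType) (rk : V -> nat).
Hypothesis rk_inj : injective rk.
Hypothesis K2 : (2%:R : K) != 0.
Variables (tau : K) (g : V -> V -> K) (D : nat) (P : {mpoly K[D]}).
Hypothesis gP : interval_weight rk tau setT g.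

(** The ring and [phi] are parameters because the induction passes to polynomial rings over [R]. *)
Definition superized (R : idomainType) (phi : {rmorphism K -> R}) n
    (val : bool * 'I_n -> R) :=
  word_sum (@superI n) (fun x y => phi (g x y)) val =
  mmap phi (fun i => super_psum val i.+1) P.

Hypothesis base : forall (R : idomainType) (phi : {rmorphism K -> R}) n
    (val : bool * 'I_n -> R),
  (forall j, val (true, j) = 0) -> superized phi val.

Let phi_weight (R : idomainType) (phi : {rmorphism K -> R}) :
  interval_weight rk (phi tau) setT (fun x y => phi (g x y)).
Proof.
move=> x y xT yT; rewrite fmorph_eq0 => nz; have [lt bt] := gP xT yT nz.
by split=> // z zT lz; have [-> ->] := bt z zT lz.
Qed.

Section Step.
Variables (R : idomainType) (phi : {rmorphism K -> R}) (n k : nat).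
Hypothesis IH : forall (N : nat) (v : bool * 'I_N -> R),
  (forall j : 'I_N, (k <= j)%N -> v (true, j) = 0) -> superized phi v.

(** Symmetry moves the positive letter [j] to the last index [l]. The negative letters of index
    above [k] have value 0, so no letter of nonzero value separates [l] from the negative letter
    [ny]. The two then cancel from the word sum, as they do from every power sum, and one negative
    letter fewer remains. *)
Lemma superized_cancel (val : bool * 'I_n -> R) (j l ny : 'I_n) :
  ny = k :> nat -> (forall i : 'I_n, (i <= l)%N) ->
  (forall i : 'I_n, (k < i)%N -> val (true, i) = 0) ->
  val (true, ny) = - val (false, j) -> superized phi val.
Proof.
move=> nyk lmax val0 valN.
pose v1 := permute_pos (tperm j l) val.
have v1l : v1 (false, l) = val (false, j) by rewrite /v1 /permute_pos /= tpermR.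
pose v2 e := if (e == (false, l)) || (e == (true, ny)) then 0 else v1 e.
have E1 : word_sum (@superI n) (fun x y => phi (g x y)) val =
          word_sum (@superI n) (fun x y => phi (g x y)) v2.
  rewrite -(word_sum_permute_pos rk_inj (@phi_weight _ phi) (tperm j l)).
  apply: (@word_sum_cancel _ _ rk); rewrite ?superIE //= ?ltnn ?leqnn //.
  - by apply/lregP; rewrite -(rmorph_nat phi) fmorph_eq0.
  - by move=> x y nz; have [] := @phi_weight _ phi x y (in_setT x) (in_setT y) nz.
  - move=> [[] i]; rewrite !superIE /= !xpair_eqE /= => i1 i2.
      have : i != ny :> nat by []. rewrite nyk => ik vi.
      have lik : (i < k)%N.
        rewrite ltn_neqAle ik leqNgt; apply: contra vi => ki.
        by rewrite /permute_pos /= val0.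
      by split; lia.
    move=> vi; have : i != l :> nat by [].
    by have := lmax i; lia.
  by rewrite /permute_pos /= tpermR valN.
rewrite /superized E1 (IH (v := v2)); last first.
  move=> i ki; rewrite /v2 xpair_eqE /=.
  case: ifP => // /negbT; rewrite xpair_eqE /= => ni; rewrite /v1 /permute_pos /=.
  by apply: val0; rewrite ltn_neqAle ki andbT -nyk eq_sym.
apply: eq_mmap => // i; rewrite /super_psum.
rewrite (bigD1 l) //= [in X in _ - X](bigD1 ny) //=.
rewrite /v2 !eqxx orbT oppr0 !expr0n /= !add0r.
rewrite [\sum_(_ < n) val (false, _) ^+ _](reindex_inj (@perm_inj _ (tperm j l))) /=.
rewrite [in RHS](bigD1 l) //= [in X in _ = _ - X](bigD1 ny) //=.
rewrite tpermR valN opprK opprD addrACA subrr add0r; congr (_ - _).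
  apply: eq_bigr => i' ni; rewrite !xpair_eqE /= (negbTE ni) /=.
  by rewrite /v1 /permute_pos.
by apply: eq_bigr => i' ni; rewrite !xpair_eqE /= (negbTE ni).
Qed.

End Step.

(** The value of the negative letter of index [k] is replaced by an indeterminate, and [Z] is the
    difference of both sides as a polynomial in it. The adjoined positive letters [X, ..., X ^ B]
    yield [B] distinct roots [- X ^ j], while [Z] has size at most [B]. *)
Lemma superize (R : idomainType) (phi : {rmorphism K -> R}) n
    (val : bool * 'I_n -> R) : superized phi val.
Proof.
suff key k : forall (R : idomainType) (phi : {rmorphism K -> R}) n
    (val : bool * 'I_n -> R),
    (forall j : 'I_n, (k <= j)%N -> val (true, j) = 0) -> superized phi val.
  by apply: (key n) => j; rewrite leqNgt ltn_ord.
elim: k => [|k IH] {}R {}phi {}n {}val val0.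
  by apply: base => j; apply: val0.
have [kn|nk] := ltnP k n; last by apply: IH => j kj; apply: val0; have := ltn_ord j; lia.
(* In the new indeterminate the word sum has degree at most [#|V|]. Each power sum has degree at
   most [D], so the substituted [P] has degree at most [D * msize P]. *)
pose B := (#|V| + D * msize P).+1.
pose N := (n + B)%N.
pose R1 : idomainType := {poly R}.
pose R2 : idomainType := {poly R1}.
pose phi1 : {rmorphism K -> R1} := (@polyC R) \o phi.
pose phi2 : {rmorphism K -> R2} := (@polyC R1) \o phi1.
pose ny : 'I_N := lshift B (Ordinal kn).
pose l : 'I_N := rshift n ord_max.
have lmax (i : 'I_N) : (i <= l)%N.
  rewrite /l; case: (split_ordP i) => j -> /=.
    by apply: leq_trans (leq_addr _ _); rewrite ltnW.
  by rewrite leq_add2l -ltnS.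
pose v1 (e : bool * 'I_N) : R1 :=
  match fintype.split e.2 with
  | inl i => (val (e.1, i))%:P
  | inr j => if e.1 then 0 else 'X ^+ j.+1 end.
pose v1y (y : R1) (e : bool * 'I_N) : R1 := if e == (true, ny) then y else v1 e.
pose v2 (e : bool * 'I_N) : R2 := if e == (true, ny) then 'X else (v1 e)%:P.
pose Z : R2 := word_sum (@superI N) (fun x y => phi2 (g x y)) v2 -
               mmap phi2 (fun i => super_psum v2 i.+1) P.
have v2y y e : (v2 e).[y] = v1y y e.
  by rewrite /v2 /v1y; case: ifP; rewrite ?hornerX ?hornerC.
have Zy y : Z.[y] = word_sum (@superI N) (fun x y => phi1 (g x y)) (v1y y) -
               mmap phi1 (fun i => super_psum (v1y y) i.+1) P.
  rewrite -horner_evalE rmorphB word_sum_morph mmap_morph; congr (_ - _).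
    rewrite -(eq_word_sum _ _ (v2y y)).
    apply: eq_bigr => w _; congr (_ * _); apply: eq_bigr => a _; apply: eq_bigr => b _.
    by rewrite /= /horner_eval hornerC.
  apply: eq_mmap => [c|i] /=; first by rewrite /= /horner_eval hornerC.
  rewrite super_psum_morph /super_psum; congr (_ - _); apply: eq_bigr => j _.
    by rewrite /= /horner_eval v2y.
  by rewrite /= /horner_eval v2y.
have Z0 : Z = 0.
  apply/eqP/negPn/negP => nZ.
  pose rs : seq R1 := [seq - 'X ^+ j.+1 | j <- iota 0 B].
  have rsu : uniq rs.
    rewrite map_inj_uniq ?iota_uniq // => a b /oppr_inj.
    by move=> /(congr1 (fun p : {poly R} => size p)); rewrite !size_polyXn => -[].
  have rsr : all (root Z) rs.
    apply/allP => y /mapP[j]; rewrite mem_iota add0n => /andP[_ jB] ->.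
    rewrite /root Zy subr_eq0; apply/eqP.
    apply: (@superized_cancel R1 phi1 N k _ _ (rshift n (Ordinal jB)) l ny) => //.
    - by move=> N' v hv; apply: IH.
    - move=> i ki; rewrite /v1y xpair_eqE /= ifF.
        rewrite /v1 /=; case: split_ordP => j' e //.
        by rewrite val0 ?polyC0 //; move: ki; rewrite e.
      by apply/negbTE; rewrite -val_eqE /=; lia.
    rewrite /v1y eqxx xpair_eqE /= /v1 /=; congr (- _).
    by case: split_ordP => j' /eqP; rewrite -val_eqE /= => /eqP e;
      [have := ltn_ord j' | congr ('X ^+ _)]; lia.
  have := max_poly_roots nZ rsr rsu; rewrite size_map size_iota ltnNge => /negP[].
  apply: leq_trans (size_polyD _ _) _; rewrite geq_max size_polyN; apply/andP; split.
    apply: (@leq_trans #|V|.+1); last by rewrite /B; lia.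
    apply: size_sum_bound => w _.
    rewrite -[#|V|.+1]/(0 + #|V|).+1 size_mul_bound //.
      rewrite (_ : pair_weight _ _ _ = (pair_weight (@superI N) (fun x y => phi1 (g x y)) w)%:P).
        by rewrite size_polyC leq_b1.
      rewrite /pair_weight rmorph_prod; apply: eq_bigr => a _; rewrite rmorph_prod.
      by apply: eq_bigr => b _; rewrite rmorphD rmorph1 rmorphMn.
    have h v : (size (v2 (w v)) <= 1.+1)%N.
      by rewrite /v2; case: ifP; rewrite ?size_polyX // size_polyC; case: (_ != 0).
    by have := size_prod_bound (index_enum V) h; rewrite sum1_card.
  apply: (@leq_trans (D * msize P).+1); last by rewrite /B; lia.
  apply: size_mmap_bound => i.
  have h (b : bool) j : (size (v2 (b, j)) <= 1.+1)%N.
    by rewrite /v2; case: ifP; rewrite ?size_polyX // size_polyC; case: (_ != 0).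
  apply: leq_trans (size_polyD _ _) _; rewrite geq_max size_polyN; apply/andP; split.
    apply: size_sum_bound => j _; apply: leq_trans (size_exp_bound _ (h _ _)) _.
    by rewrite mul1n ltnS.
  apply: size_sum_bound => j _; apply: leq_trans (size_exp_bound (a := 1) _ _) _.
    by rewrite size_polyN.
  by rewrite mul1n ltnS.
pose y1 : R1 := (val (true, Ordinal kn))%:P.
have := Zy y1; rewrite Z0 horner0 => /esym/eqP; rewrite subr_eq0 => /eqP.
(* At [X = 0] all adjoined letters vanish and the values [val] come back. *)
move=> /(congr1 (horner_eval (0 : R))); rewrite word_sum_morph mmap_morph => E.
pose emb (e : bool * 'I_n) : bool * 'I_N := (e.1, lshift B e.2).
have emb_inj : injective emb by move=> [a b] [a' b'] [-> /val_inj ->].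
have v1E e : (v1y y1 (emb e)).[0] = val e.
  case: e => b i; rewrite /v1y /emb xpair_eqE /=.
  rewrite [_ == ny](inj_eq (@lshift_inj _ _)).
  case: ifP => [/andP[/eqP-> /eqP->]|_]; first by rewrite hornerC.
  rewrite /v1 /=; case: split_ordP => j /eqP; rewrite -val_eqE /= => /eqP e.
    by rewrite hornerC; congr (val (_, _)); apply: val_inj.
  by have := ltn_ord i; lia.
have v1E0 e : e \notin codom emb -> (v1y y1 e).[0] = 0.
  case: e => b i; rewrite /v1y /v1 /=; case: ifP => [/eqP-> /negP[]|_].
    by apply/codomP; exists (true, Ordinal kn).
  case: split_ordP => j ej; first by case/negP; apply/codomP; exists (b, j); rewrite ej.
  by move=> _; case: b; rewrite ?hornerC // hornerXn expr0n.
have embI a b : superI (emb a) (emb b) = superI a b by rewrite !superIE.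
move: E; rewrite (word_sum_embed _ emb_inj embI v1E0) /superized => E.
transitivity (word_sum (@superI n) (fun x y => horner_eval 0 (phi1 (g x y)))
   ((fun c => horner_eval 0 (v1y y1 c)) \o emb)).
  apply: eq_bigr => w _; congr (_ * _); last first.
    by apply: eq_bigr => v _; rewrite /= /horner_eval v1E.
  apply: eq_bigr => a _; apply: eq_bigr => b _.
  by rewrite /= /horner_eval hornerC.
rewrite E; apply: eq_mmap => [c|i] /=; first by rewrite /= /horner_eval hornerC.
have sumE (b : bool) (F : R -> R) : F 0 = 0 ->
    \sum_j F (v1y y1 (b, j)).[0] = \sum_j F (val (b, j)).
  move=> F0; rewrite big_split_ord /= [X in _ + X]big1 ?addr0.
    by apply: eq_bigr => j _; rewrite -v1E.
  move=> j _; rewrite v1E0 //; apply/negP => /codomP[[b' j']] [_ e].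
  by have := ltn_ord j'; lia.
rewrite super_psum_morph /super_psum; congr (_ - _).
  rewrite -(sumE _ (fun x => x ^+ i.+1)) ?expr0n //.
rewrite -(sumE _ (fun x => (- x) ^+ i.+1)) ?oppr0 ?expr0n //.
Qed.

End Superization.

(** * Symmetric families of polynomials *)

Section Shapes.
Variable n : nat.
Implicit Types m : 'X_{1..n}.

Let geq_total : total geq. Proof. by move=> x y; apply: leq_total. Qed.
Let geq_trans : transitive geq. Proof. by move=> y x z /= h1 h2; apply: leq_trans h2 h1. Qed.
Let geq_anti : antisymmetric geq.
Proof. by move=> x y /=; rewrite andbC -eqn_leq => /eqP. Qed.

Lemma perm_sort_geq (s1 s2 : seq nat) : perm_eq s1 s2 -> sort geq s1 = sort geq s2.
Proof. by move=> h; apply/perm_sortP. Qed.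

Lemma mono_shape_partition m : is_partition (mono_shape m).
Proof.
rewrite /is_partition sort_sorted //= (perm_all _ (permEl (perm_sort _ _))).
exact: filter_all.
Qed.

Lemma sumn_mono_shape m : sumn (mono_shape m) = mdeg m.
Proof.
rewrite (perm_sumn (permEl (perm_sort _ _))) /mdeg sumnE big_filter big_mkcond /=.
by apply: eq_bigr => -[].
Qed.

Lemma size_mono_shape m : (size (mono_shape m) <= n)%N.
Proof. by rewrite size_sort -[X in (_ <= X)%N](size_tuple m) size_filter count_size. Qed.

Lemma perm_mono_shape m :
  perm_eq m (mono_shape m ++ nseq (n - size (mono_shape m)) 0%N).
Proof.
pose pos x := (0 < x)%N.
rewrite -(permPl (permEl (perm_filterC pos _))); apply: perm_cat.
  by rewrite perm_sym; apply/permEl/perm_sort.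
have /all_pred1P e : all (pred1 0%N) [seq x <- (m : seq nat) | predC pos x].
  by rewrite all_filter; apply/allP => -[].
rewrite e; suff -> : size [seq x <- (m : seq nat) | predC pos x] = (n - size (mono_shape m))%N by [].
by rewrite size_sort !size_filter -[X in (X - _)%N](size_tuple m) -(count_predC pos) addKn.
Qed.

End Shapes.

(** Compatibility with setting the last variables to 0. Together with symmetry it makes the family a
    single symmetric function in infinitely many variables. *)
Definition stable_family (K : comNzRingType) (f : forall n, {mpoly K[n]}) :=
  forall l k, comp_mpoly
    [tuple (match fintype.split i with inl j => 'X_j | inr _ => 0 end) | i < l + k] (f (l + k)%N)
    = f l :> {mpoly K[l]}.

Section StableFamily.
Variables (K : comNzRingType) (f : forall n, {mpoly K[n]}).
Hypothesis f_sym : forall n, f n \is symmetric.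
Hypothesis f_stable : stable_family f.

(** The coefficient of [m_mu], read in the least number of variables where [m_mu] is nonzero. *)
Definition shape_coef (mu : seq nat) : K :=
  (f (size mu))@_[multinom nth 0%N mu i | i < size mu].

Lemma mcoeff_pad l k (mu : 'X_{1..l}) (m : 'X_{1..(l + k)}) :
  (forall j, m (lshift k j) = mu j) -> (forall j, m (rshift l j) = 0%N) ->
  (f (l + k)%N)@_m = (f l)@_mu.
Proof.
move=> ml mr; rewrite -(f_stable l k) comp_mpolyEX raddf_sum /=.
have E (m' : 'X_{1..(l + k)}) :
   (\prod_(i < l + k) tnth [tuple (match fintype.split i with inl j => 'X_j | inr _ => 0 end)
       | i < l + k] i ^+ m' i : {mpoly K[l]})@_mu = (m' == m)%:R.
  rewrite big_split_ord /=.
  have -> : \prod_(i < l) tnth [tuple (match fintype.split i with inl j => 'X_j | inr _ => 0 end)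
       | i < l + k] (lshift k i) ^+ m' (lshift k i) =
     'X_[[multinom m' (lshift k i) | i < l]] :> {mpoly K[l]}.
    rewrite mpolyXE_id; apply: eq_bigr => i _; rewrite tnth_mktuple mnmE.
    by case: split_ordP => j /eqP; rewrite ?eq_lrshift // (inj_eq (@lshift_inj _ _)) => /eqP ->.
  have rE (i : 'I_k) : tnth [tuple (match fintype.split i with inl j => 'X_j | inr _ => 0 end)
       | i < l + k] (rshift l i) = 0 :> {mpoly K[l]}.
    by rewrite tnth_mktuple; case: split_ordP => j /eqP; rewrite ?eq_rlshift.
  have [/forallP z|] := boolP [forall i, m' (rshift l i) == 0%N]; last first.
    rewrite negb_forall => /existsP[i nz]; rewrite (bigD1 i) //= rE expr0n (negbTE nz).
    rewrite mul0r mulr0 mcoeff0; case: eqP => // e; by move: nz; rewrite e mr eqxx.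
  rewrite [X in _ * X]big1 ?mulr1; last by move=> i _; rewrite (eqP (z i)) expr0.
  rewrite mcoeffX; congr (_%:R); congr nat_of_bool; apply/eqP/eqP => [e|->].
    apply/mnmP => i; case: (split_ordP i) => j ->; last by rewrite mr (eqP (z j)).
    by rewrite ml -e mnmE.
  by apply/mnmP => i; rewrite mnmE ml.
under eq_bigr do rewrite mcoeffZ comp_mpolyX E.
have [mf|mf] := boolP (m \in msupp (f (l + k)%N)).
  rewrite (bigD1_seq m) ?msupp_uniq //= eqxx mulr1 big1 ?addr0 // => m' /negbTE->.
  by rewrite mulr0.
rewrite (memN_msupp_eq0 mf) big_seq big1 // => m' m'f.
by case: eqP => [e|_]; rewrite ?mulr0 //; move: mf; rewrite -e m'f.
Qed.

(** Symmetry sorts the exponents, and stability removes the zeros that end up last. *)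
Lemma mcoeff_shape n (m : 'X_{1..n}) : (f n)@_m = shape_coef (mono_shape m).
Proof.
suff key l k n' (e : n' = (l + k)%N) (m' : 'X_{1..n'}) : size (mono_shape m') = l ->
    (f n')@_m' = shape_coef (mono_shape m').
  by apply: (key (size (mono_shape m)) (n - size (mono_shape m))%N); rewrite ?subnKC ?size_mono_shape.
subst n' => sz.
have := perm_mono_shape m'; rewrite perm_sym sz addKn => pm.
have szt : size (mono_shape m' ++ nseq k 0%N) == (l + k)%N.
  by rewrite size_cat size_nseq sz.
have /tuple_permP[s es] : perm_eq (Tuple szt) m' by [].
have sE (i : 'I_(l + k)) : m' (s i) = nth 0%N (mono_shape m' ++ nseq k 0%N) i.
  rewrite [_ ++ _]es -tnth_nth tnth_mktuple //.
have := f_sym (l + k)%N => /issymP /(_ s) sy.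
rewrite -{1}sy mcoeff_sym /shape_coef.
rewrite (@mcoeff_pad l k [multinom nth 0%N (mono_shape m') i | i < l]).
- by move: (mono_shape m') sz => mu <-.
- by move=> j; rewrite !mnmE sE nth_cat sz /= ltn_ord.
by move=> j; rewrite !mnmE sE nth_cat sz /= ltnNge leq_addr /= nth_nseq if_same.
Qed.

End StableFamily.

(** * Power sum expansions *)

Lemma Kqt_natr_neq0 k : (k.+1%:R : Kqt) != 0.
Proof.
rewrite -(rmorph_nat (@tofrac _)) tofrac_eq0 -(rmorph_nat (@polyC _)) polyC_eq0.
by rewrite -(rmorph_nat (@polyC _)) polyC_eq0 Num.Theory.pnatr_eq0.
Qed.

Lemma mcoeff_msym_mono n mu (m : 'X_{1..n}) :
  (msym_mono n mu)@_m = (mono_shape m == mu)%:R.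
Proof.
rewrite /msym_mono raddf_sum /=; under eq_bigr do rewrite mcoeffX.
have [e|ne] := eqVneq (mono_shape m) mu; last first.
  rewrite big1 => [//|i /eqP ei]; rewrite (_ : _ == m = false) //.
  by apply: contraNF ne => /eqP e; rewrite -e ei.
have lt : (mdeg m < (sumn mu).+1)%N by rewrite -e sumn_mono_shape.
rewrite (bigD1 (BMultinom lt)) /=; last by rewrite e.
rewrite eqxx big1 ?addr0 => [//|i /andP[_ ni]]; rewrite (_ : _ == m = false) //.
by apply: contraNF ni => /eqP ei; apply/eqP/val_inj.
Qed.

Lemma msym_mono_expansion (f : forall n, {mpoly Kqt[n]}) (c : seq nat -> Kqt)
    (S : seq (seq nat)) :
  uniq S ->
  (forall n m, (f n)@_m = c (mono_shape m)) ->
  (forall n m, (f n)@_m != 0 -> mono_shape m \in S) ->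
  forall n, f n = \sum_(mu <- S) c mu *: msym_mono n mu.
Proof.
move=> uS fc fS n; apply/mpolyP => m; rewrite raddf_sum /=.
under eq_bigr do rewrite mcoeffZ mcoeff_msym_mono.
have [mS|mS] := boolP (mono_shape m \in S).
  rewrite (bigD1_seq (mono_shape m)) //= eqxx mulr1 big1 ?addr0 // => mu.
  by rewrite eq_sym => /negbTE->; rewrite mulr0.
rewrite big_seq big1 => [|mu muS].
  by apply/eqP; apply: contraNT mS => /fS.
rewrite (_ : _ == mu = false) ?mulr0 //.
by apply: contraNF mS => /eqP ->.
Qed.

(** * Words grouped by their pattern of equal letters *)

Section Kernel.
Variable V : finType.

(** Encodes the set partition of [V] into level sets of [w] as an idempotent map to representatives.
    The representative depends on the level set alone, so words with the same pattern have equal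
    kernels. *)
Definition kernel (T : eqType) (w : V -> T) : {ffun V -> V} :=
  [ffun x => odflt x [pick y | w y == w x]].

Section One.
Variables (T : eqType) (w : V -> T).

Lemma kernel_val x : w (kernel w x) = w x.
Proof. by rewrite ffunE; case: pickP => [y /eqP|]. Qed.

Lemma kernel_eq x y : (kernel w x == kernel w y) = (w x == w y).
Proof.
apply/eqP/eqP => [e|e]; first by rewrite -kernel_val e kernel_val.
rewrite !ffunE e; case: pickP => //= /(_ y); by rewrite eqxx.
Qed.

Lemma kernel_idem x : kernel w (kernel w x) = kernel w x.
Proof. by apply/eqP; rewrite kernel_eq kernel_val. Qed.
End One.

Lemma eq_kernel (T T' : eqType) (w : V -> T) (w' : V -> T') :
  (forall x y, (w x == w y) = (w' x == w' y)) -> kernel w = kernel w'.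
Proof.
move=> e; apply/ffunP => x; rewrite !ffunE.
by rewrite (eq_pick (Q := fun y => w' y == w' x)).
Qed.

Lemma kernel_kernel (T : eqType) (w : V -> T) : kernel (kernel w) = kernel w.
Proof. by apply: eq_kernel => x y; rewrite kernel_eq. Qed.

Variable D : nat.
Hypothesis VD : (#|V| <= D)%N.

Definition psums n : D.-tuple {mpoly Kqt[n]} := [tuple psum n i.+1 | i < D].

(** Such a word chooses one letter per class independently, so the sum is the product of the power
    sums [p_m] over the class sizes [m]. The index of a variable of [P] is [m - 1]. *)
Lemma sum_constant_on_classes (rho : V -> V) :
  (forall x, rho (rho x) = rho x) ->
  exists P : {mpoly Kqt[D]}, forall n,
   \sum_(w : {ffun V -> 'I_n} | [forall x, w (rho x) == w x]) \prod_v 'X_(w v)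
   = comp_mpoly (psums n) P.
Proof.
move=> rhoK; pose J := {x : V | rho x == x}.
pose cl (r : J) := #|[set v | rho v == val r]|.
have cl_gt0 r : (0 < cl r)%N by apply/card_gt0P; exists (val r); rewrite inE (valP r).
have cl_lt r : ((cl r).-1 < D)%N.
  by rewrite prednK // (leq_trans _ VD) // max_card.
exists (\prod_(r : J) 'X_(Ordinal (cl_lt r))) => n.
rewrite rmorph_prod /=.
under [RHS]eq_bigr => r _.
  rewrite comp_mpolyXU -tnth_nth tnth_mktuple /= prednK // /psum; over.
rewrite bigA_distr_bigA /=.
have rP x : rho (rho x) == rho x by rewrite rhoK.
pose pr x : J := exist _ (rho x) (rP x).
have prE (r : J) : pr (val r) = r by apply: val_inj; rewrite /= (eqP (valP r)).
pose ex (f : {ffun J -> 'I_n}) : {ffun V -> 'I_n} := [ffun x => f (pr x)].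
rewrite (reindex_onto ex (fun w => [ffun r : J => w (val r)])) /=; last first.
  by move=> w /forallP wP; apply/ffunP => x; rewrite !ffunE /=; apply/eqP.
apply: eq_big => [f|f _].
  apply/andP; split; last by apply/eqP/ffunP => r; rewrite !ffunE prE.
  apply/forallP => x; rewrite !ffunE; apply/eqP; congr (f _).
  by apply: val_inj; rewrite /= rhoK.
rewrite (partition_big pr predT) //=; apply: eq_bigr => r _.
rewrite -(prodr_const (mem [set v | rho v == val r]) ('X_(f r) : {mpoly Kqt[n]})).
apply: eq_big => [v|v /eqP e]; last by rewrite ffunE e.
by rewrite inE -val_eqE.
Qed.

(** Deletion and contraction: the words with [w u != w v] are all words minus those with
    [w u = w v], and the latter are the words constant on the classes of [rho'], where the classes
    of [u] and [v] are merged. *)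
Lemma sum_class_conditions (F : seq (V * V)) (rho : V -> V) :
  (forall x, rho (rho x) = rho x) ->
  exists P : {mpoly Kqt[D]}, forall n,
   \sum_(w : {ffun V -> 'I_n} |
      [forall x, w (rho x) == w x] && all (fun p => w p.1 != w p.2) F)
      \prod_v 'X_(w v)
   = comp_mpoly (psums n) P.
Proof.
elim: F rho => [|[u v] F IH] rho rhoK.
  have [P PE] := sum_constant_on_classes rhoK; exists P => n; rewrite -PE.
  by apply: eq_bigl => w; rewrite andbT.
pose rho' x := if rho x == rho v then rho u else rho x.
have rhoK' x : rho' (rho' x) = rho' x.
  by rewrite /rho'; case: (altP (rho x =P rho v)) => [|h]; rewrite rhoK ?if_same ?(negbTE h).
have [P1 E1] := IH rho rhoK; have [P2 E2] := IH rho' rhoK'.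
exists (P1 - P2) => n; rewrite rmorphB /= -E1 -E2.
apply/eqP; rewrite eq_sym subr_eq; apply/eqP.
rewrite (bigID (fun w : {ffun V -> 'I_n} => w u == w v)) /= addrC; congr (_ + _).
  by apply: eq_bigl => w; rewrite -andbA; congr (_ && _); rewrite andbC.
apply: eq_bigl => w; rewrite andbAC; congr (_ && _); apply/andP/forallP.
  move=> [/forallP h /eqP uv] x; rewrite /rho'; have [e|_] := eqVneq (rho x) (rho v); last exact: h.
  by rewrite (eqP (h u)) uv -(eqP (h v)) -e (eqP (h x)).
move=> h; have hu : w (rho u) = w u.
  by have := h u; rewrite /rho'; case: ifP => _ /eqP.
have hv : w (rho u) = w v by have := h v; rewrite /rho' eqxx => /eqP.
split; last by rewrite -hu hv.
apply/forallP => x; have := h x; rewrite /rho'; have [e /eqP <-|//] := eqVneq (rho x) (rho v).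
have := h (rho v); by rewrite /rho' rhoK eqxx e => /eqP ->.
Qed.

Lemma sum_kernel (rho : {ffun V -> V}) :
  exists P : {mpoly Kqt[D]}, forall n,
   \sum_(w : {ffun V -> 'I_n} | kernel w == rho) \prod_v 'X_(w v)
   = comp_mpoly (psums n) P.
Proof.
have [kr|nk] := eqVneq (kernel rho) rho; last first.
  exists 0 => n; rewrite rmorph0 big_pred0 // => w; apply/negbTE.
  by apply: contra nk => /eqP <-; rewrite kernel_kernel.
have rhoK x : rho (rho x) = rho x by have := kernel_idem rho x; rewrite kr.
pose F := [seq p <- enum [set: V * V] | rho p.1 != rho p.2].
have [P PE] := sum_class_conditions F rhoK; exists P => n; rewrite -PE.
apply: eq_bigl => w; apply/eqP/andP => [e|[/forallP h1 /allP h2]].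
  split; first by apply/forallP => x; rewrite -e kernel_val.
  by apply/allP => p; rewrite mem_filter -e kernel_eq => /andP[].
rewrite -kr; apply: eq_kernel => x y; apply/eqP/eqP => [e|e]; last first.
  by rewrite -(eqP (h1 x)) e (eqP (h1 y)).
apply/eqP/negPn/negP => ne; have := h2 (x, y); rewrite mem_filter /= ne mem_enum inE /= e eqxx.
by move=> /(_ isT).
Qed.

Definition content n (w : {ffun V -> 'I_n}) : 'X_{1..n} := (\sum_v U_(w v))%MM.

Lemma contentE n (w : {ffun V -> 'I_n}) i : content w i = #|[set v | w v == i]|.
Proof.
rewrite mnm_sumE -sum1_card [RHS]big_mkcond /=; apply: eq_bigr => v _.
by rewrite mnm1E inE.
Qed.

Lemma prod_content (K : comNzRingType) n (w : {ffun V -> 'I_n}) :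
  \prod_v 'X_(w v) = 'X_[content w] :> {mpoly K[n]}.
Proof. by rewrite /content; elim/big_rec2: _ => [|v m p _ ->]; rewrite ?mpolyX0 // mpolyXD. Qed.

Definition kernel_shape (rho : V -> V) : seq nat :=
  sort geq [seq #|[set y | rho y == x]| | x <- enum V & rho x == x].

Lemma mono_shape_content n (w : {ffun V -> 'I_n}) :
  mono_shape (content w) = kernel_shape (kernel w).
Proof.
apply: perm_sort_geq.
have -> : [seq x <- (content w : n.-tuple nat) | (0 < x)%N] =
   [seq content w i | i <- enum 'I_n & (0 < content w i)%N].
  rewrite -filter_map; congr filter.
  by rewrite -[LHS]map_tnth_enum; apply: eq_map => i; rewrite mnm_tnth.
set B := [seq w x | x <- enum V & kernel w x == x].
have pAB : perm_eq [seq i <- enum 'I_n | (0 < content w i)%N] B.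
  apply: uniq_perm; first exact: filter_uniq (enum_uniq _).
    rewrite map_inj_in_uniq; first exact: filter_uniq (enum_uniq _).
    move=> x y.
    rewrite !mem_filter => /andP[/eqP ex _] /andP[/eqP ey _] e.
    by rewrite -ex -ey; apply/eqP; rewrite kernel_eq e.
  move=> i; rewrite mem_filter mem_enum andbT contentE; apply/card_gt0P/mapP => [[v]|[x _ ->]].
    rewrite inE => /eqP <-; exists (kernel w v); last by rewrite kernel_val.
    by rewrite mem_filter mem_enum kernel_idem eqxx.
  by exists x; rewrite inE.
rewrite (permPl (perm_map _ pAB)) -map_comp.
suff -> : [seq (content w \o w) x | x <- enum V & kernel w x == x] =
  [seq #|[set y | kernel w y == x]| | x <- enum V & kernel w x == x] by [].
apply/eq_in_map => x; rewrite mem_filter => /andP[/eqP ex _] /=; rewrite contentE.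
by apply: eq_card => y; rewrite !inE -{2}ex kernel_eq.
Qed.

(** [ce mu] counts the words of a fixed content of shape [mu], so [A mu] is their average weight.
    After averaging, the weight of a word depends only on its kernel, and not on [n]. *)
Lemma power_sum_expansion (f e : forall n, {mpoly Kqt[n]})
    (W : forall n, {ffun V -> 'I_n} -> Kqt) (c ce : seq nat -> Kqt) :
  (forall n, f n = \sum_w W n w *: \prod_v 'X_(w v)) ->
  (forall n, e n = \sum_(w : {ffun V -> 'I_n}) \prod_v 'X_(w v)) ->
  (forall n m, (f n)@_m = c (mono_shape m)) ->
  (forall n m, (e n)@_m = ce (mono_shape m)) ->
  exists P : {mpoly Kqt[D]}, forall n, f n = comp_mpoly (psums n) P.
Proof.
move=> fE eE fc ec; pose A mu := c mu / ce mu.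
have fA n : f n = \sum_(w : {ffun V -> 'I_n}) A (kernel_shape (kernel w)) *: \prod_v 'X_(w v).
  apply/mpolyP => m; rewrite raddf_sum /=.
  under eq_bigr => w _ do rewrite mcoeffZ prod_content mcoeffX -mono_shape_content.
  have -> : \sum_(w : {ffun V -> 'I_n}) A (mono_shape (content w)) * (content w == m)%:R =
     A (mono_shape m) * (e n)@_m.
    rewrite eE raddf_sum /= big_distrr /=; apply: eq_bigr => w _.
    by rewrite prod_content mcoeffX; case: eqP => [->|_] //; rewrite !mulr0.
  (* A content that occurs has a nonzero count, by characteristic 0, so the division is legitimate;
     for one that does not occur both coefficients vanish. *)
  have [/existsP[w0 /eqP w0m]|] := boolP [exists w : {ffun V -> 'I_n}, content w == m].
    have e0 : (e n)@_m != 0.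
      rewrite eE raddf_sum /= (_ : \sum_w _ = #|[set w : {ffun V -> 'I_n} | content w == m]|%:R).
        have /card_gt0P : exists w, w \in [set w : {ffun V -> 'I_n} | content w == m].
          by exists w0; rewrite inE w0m.
        by case: #|_| => // k _; apply: Kqt_natr_neq0.
      rewrite -sum1_card natr_sum [RHS]big_mkcond; apply: eq_bigr => w _.
      by rewrite prod_content mcoeffX inE; case: eqP.
    by rewrite /A -ec divfK // fc.
  rewrite negb_exists => /forallP nw.
  have -> : (f n)@_m = 0.
    rewrite fE raddf_sum; apply: big1 => w _.
    by rewrite /= mcoeffZ prod_content mcoeffX (negbTE (nw w)) mulr0.
  have -> : (e n)@_m = 0; last by rewrite mulr0.
  rewrite eE raddf_sum; apply: big1 => w _.
  by rewrite /= prod_content mcoeffX (negbTE (nw w)).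
have [Q QE] := fin_all_exists sum_kernel.
exists (\sum_(rho : {ffun V -> V}) A (kernel_shape rho) *: Q rho) => n.
rewrite fA (partition_big (fun w : {ffun V -> 'I_n} => kernel w) predT) //= raddf_sum /=.
apply: eq_bigr => rho _; rewrite linearZ /= -QE scaler_sumr.
by apply: eq_bigr => w /eqP ->.
Qed.

End Kernel.

(** * Word sums as symmetric functions *)

Section WordFamily.
Variables (V : finType) (rk : V -> nat).
Hypothesis rk_inj : injective rk.

(** Ordinary words, written over the super alphabet with negative letters of value 0, so that the
    symmetry in positive letters applies directly. *)
Definition word_poly (g : V -> V -> Kqt) n : {mpoly Kqt[n]} :=
  word_sum (@superI n) (fun x y => (g x y)%:MP)
    (fun e => if e.1 then 0 else 'X_(e.2)).

Lemma mmap_word_poly (R : comNzRingType) (phi : {rmorphism Kqt -> R}) n g (h : 'I_n -> R) :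
  mmap phi h (word_poly g n) =
  word_sum (@superI n) (fun x y => phi (g x y)) (fun e => if e.1 then 0 else h e.2).
Proof.
rewrite /word_poly word_sum_morph.
transitivity (word_sum (@superI n) (fun x y => mmap phi h (g x y)%:MP)
  (fun e => if e.1 then 0 else h e.2)).
  by apply: eq_word_sum => -[[] i] /=; rewrite ?mmap0 ?mmapX ?mmap1U.
apply: eq_bigr => w _; congr (_ * _); apply: eq_bigr => x _; apply: eq_bigr => y _.
by rewrite mmapC.
Qed.

Section Good.
Variables (tau : Kqt) (g : V -> V -> Kqt).
Hypothesis gP : interval_weight rk tau setT g.

Let mp_weight n :
  interval_weight rk (tau%:MP_[n]) setT (fun x y => (g x y)%:MP_[n]).
Proof.
move=> x y xT yT; rewrite mpolyC_eq0 => nz; have [lt bt] := gP xT yT nz.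
by split=> // z zT lz; have [-> ->] := bt z zT lz.
Qed.

Lemma word_poly_sym n : word_poly g n \is symmetric.
Proof.
apply/issymP => s; rewrite /msym mmap_word_poly.
rewrite -[RHS](word_sum_permute_pos rk_inj (@mp_weight n) s).
by apply: eq_word_sum => -[[] i].
Qed.

Lemma word_poly_stable : stable_family (word_poly g).
Proof.
move=> l k; rewrite /comp_mpoly mmap_word_poly.
pose emb (e : bool * 'I_l) : bool * 'I_(l + k) := (e.1, lshift k e.2).
have emb_inj : injective emb by move=> [a b] [a' b'] [-> /val_inj ->].
have embI a b : superI (emb a) (emb b) = superI a b by rewrite !superIE.
rewrite (word_sum_embed _ emb_inj embI).
  apply: eq_word_sum => -[[] i] //=; rewrite tnth_mktuple.
  by case: split_ordP => j /eqP; rewrite ?eq_lrshift // (inj_eq (@lshift_inj _ _)) => /eqP ->.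
move=> [[] i] //=; rewrite tnth_mktuple; case: split_ordP => j // ->.
by case/negP; apply/codomP; exists (false, j).
Qed.

Lemma word_polyE n : word_poly g n =
  \sum_(w : {ffun V -> 'I_n}) pair_weight (fun a b : 'I_n => (b < a)%N) g w *:
    \prod_v 'X_(w v).
Proof.
pose emb (i : 'I_n) := (false, i).
have emb_inj : injective emb by move=> a b [].
have embI a b : superI (emb a) (emb b) = (b < a)%N by rewrite superIE.
rewrite /word_poly (word_sum_embed _ emb_inj embI); last first.
  by move=> [[] i] //= /negP[]; apply/codomP; exists i.
apply: eq_bigr => w _; rewrite -mul_mpolyC; congr (_ * _).
rewrite /pair_weight rmorph_prod; apply: eq_bigr => x _; rewrite rmorph_prod.
by apply: eq_bigr => y _; rewrite rmorphD rmorph1 rmorphMn.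
Qed.

End Good.

(** The zero weight [g0] provides the unweighted word sums that count contents. Without negative
    letters the claim is the power sum expansion evaluated at the positive values, which is the base
    of the induction. *)
Lemma superization (tau : Kqt) (g : V -> V -> Kqt) D :
  interval_weight rk tau setT g -> (#|V| <= D)%N ->
  exists P : {mpoly Kqt[D]}, forall (R : idomainType) (phi : {rmorphism Kqt -> R}) n
    (val : bool * 'I_n -> R), superized g P phi val.
Proof.
move=> gP VD; pose g0 (x y : V) : Kqt := 0.
have g0P : interval_weight rk tau setT g0 by move=> x y _ _; rewrite /g0 eqxx.
have g0E n : word_poly g0 n = \sum_(w : {ffun V -> 'I_n}) \prod_v 'X_(w v).
  rewrite word_polyE; apply: eq_bigr => w _; rewrite /pair_weight big1 ?scale1r // => x _.
  by apply: big1 => y _; rewrite mul0rn addr0.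
have [P PE] := power_sum_expansion VD (word_polyE g) g0E
  (mcoeff_shape (word_poly_sym gP) (word_poly_stable g))
  (mcoeff_shape (word_poly_sym g0P) (word_poly_stable g0)).
exists P => R phi n val.
apply: (superize rk_inj (Kqt_natr_neq0 1) gP) => {}R {}phi {}n {}val val0.
rewrite /superized.
transitivity (mmap phi (fun i => val (false, i)) (word_poly g n)).
  by rewrite mmap_word_poly; apply: eq_word_sum => -[[] i].
rewrite PE /comp_mpoly mmap_morph; apply: eq_mmap => [c|i] /=; first by rewrite mmapC.
rewrite tnth_mktuple /psum rmorph_sum /super_psum [X in _ - X]big1 ?subr0.
  by apply: eq_bigr => j _; rewrite rmorphXn /= mmapX mmap1U.
by move=> j _; rewrite val0 oppr0 expr0n.
Qed.

End WordFamily.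

(** * Cell weights of a diagram *)

Lemma tt_neq0 : tt != 0. Proof. by rewrite tofrac_eq0 polyX_eq0. Qed.

Lemma IstE (e f : sletter) : Ist (Some e) (Some f) =
  if e.1 then (~~ f.1) || (e.2 <= f.2)%N else ~~ f.1 && (f.2 < e.2)%N.
Proof.
case: e f => [[] i] [[] j]; rewrite /Ist /= ?andbF ?orbF ?andbT //.
by rewrite [RHS]leq_eqVlt orbC; congr (_ || _); apply/eqP/eqP => [[->]|->].
Qed.

(* The three comparisons of a triple never fail all together nor all hold, so
   being a quinv triple is a linear condition on them. *)
Lemma quinv_tripleE (a : option sletter) (b c : sletter) :
  (quinv_triple a (Some b) (Some c) + Ist a (Some b) =
   Ist (Some c) (Some b) + Ist a (Some c))%N.
Proof.
rewrite /quinv_triple; case: a => [a|].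
  rewrite !IstE.
  case: a b c => [[] i] [[] j] [[] k] /=; rewrite ?addn0 ?add0n //;
  do ?[case: leqP => ?] => //=; lia.
have IN (f : sletter) : Ist None (Some f) = false by case: f => [[] ?].
by rewrite !IN; case: (Ist _ _).
Qed.

Section Diagram.
Variable la : seq nat.
Local Notation V := (dg la).
Local Notation row := (@cell_row la).
Local Notation col := (@cell_col la).
Local Notation ht := (nth 0%N la).
Implicit Types x y z c : V.

Lemma row_lt c : (row c < ht (col c))%N. Proof. exact: (valP c). Qed.
Lemma col_lt c : (col c < size la)%N. Proof. exact: ltn_ord. Qed.

Lemma cell_inj x y : row x = row y -> col x = col y -> x = y.
Proof.
move=> e1 e2; apply: val_inj; rewrite [LHS]surjective_pairing [RHS]surjective_pairing.
by congr (_, _); apply: val_inj.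
Qed.

Lemma ht_max j : (ht j <= foldr maxn 0 la)%N.
Proof.
elim: (la) j => [|h l IH] [|j] //=; first exact: leq_maxl.
exact: leq_trans (IH j) (leq_maxr _ _).
Qed.

Lemma cell_exists r j : is_cell la r j -> {c | row c = r & col c = j}.
Proof.
move=> /andP[hj hr]; have hr' := leq_trans hr (ht_max j).
by exists (Sub (Ordinal hj, Ordinal hr') hr).
Qed.

Lemma is_cellP c : is_cell la (row c) (col c).
Proof. by rewrite /is_cell col_lt row_lt. Qed.

Section Entry.
Variables (n : nat) (s : sfilling la n).

Lemma entry_cell r j c : row c = r -> col c = j -> entry s r j = Some (letter_of (s c)).
Proof.
move=> er ec; rewrite /entry; case: pickP => [c' /andP[/eqP e1 /eqP e2]|/(_ c)].
  by rewrite (@cell_inj c' c) // ?e1 ?e2.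
by rewrite er ec !eqxx.
Qed.

Lemma entry_none r j : ~~ is_cell la r j -> entry s r j = None.
Proof.
move=> nc; rewrite /entry; case: pickP => // c /andP[/eqP e1 /eqP e2].
by move: nc; rewrite -e1 -e2 is_cellP.
Qed.
End Entry.

Definition reading_rank c := (row c * size la + col c)%N.

Lemma reading_rank_lt x y : (reading_rank x < reading_rank y)%N =
  (row x < row y)%N || (row x == row y) && (col x < col y)%N.
Proof.
have := col_lt x; have := col_lt y; rewrite /reading_rank.
have [lt|lt|->] := ltngtP (row x) (row y) => /= hy hx; last by rewrite ltn_add2l.
  have : ((row x).+1 * size la <= row y * size la)%N by rewrite leq_mul2r lt orbT.
  by rewrite mulSn; lia.
have : ((row y).+1 * size la <= row x * size la)%N by rewrite leq_mul2r lt orbT.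
by rewrite mulSn; lia.
Qed.

Lemma reading_rank_inj : injective reading_rank.
Proof.
move=> x y e; have := reading_rank_lt x y; have := reading_rank_lt y x.
by rewrite e ltnn => h1 h2; apply: cell_inj; lia.
Qed.

(** The two cases are the pairs [(c, b)] and [(a, c)] of a triple, in the order in which [I] reads
    them. *)
Definition attacks x y :=
  (row x == row y) && (col y < col x)%N || (row x == (row y).+1) && (col x < col y)%N.
Definition above x y := (row x == (row y).+1) && (col x == col y).
Definition arm y := #|[set z | (row z == row y) && (col y < col z)%N]|.
Definition leg1 x := (ht (col x) - row x)%N.

(** The comparison [I a b] counts with coefficient -1 in each triple, one for every [c] to the right
    of [b]; this is the power of [tt] in the denominator. *)
Definition cell_weight x y : Kqt :=
  if attacks x y then tt else if above x y then qq ^+ leg1 x / tt ^+ arm y else 1.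
Definition cell_weight1 x y : Kqt := cell_weight x y - 1.

(** As first argument, a cell interacts with the window of the reading order that runs from the cell
    below it (or the start of the bottom row) up to its predecessor. Only the cell below, at the end
    of the window, can have a weight other than [tt]. *)
Lemma cell_weight1P : interval_weight reading_rank (tt - 1) setT cell_weight1.
Proof.
have att x y : attacks x y -> cell_weight1 x y = tt - 1.
  by rewrite /cell_weight1 /cell_weight => ->.
move=> x y _ _ nz.
have xy : attacks x y || above x y.
  apply: contraNT nz; rewrite negb_or => /andP[h1 h2].
  by rewrite /cell_weight1 /cell_weight (negbTE h1) (negbTE h2) subrr.
split=> [|z _].
  by move: xy; rewrite reading_rank_lt /attacks /above; lia.
move: xy; rewrite !reading_rank_lt => xy lz.
by split; apply: att; move: xy lz; rewrite /attacks /above; lia.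
Qed.

Lemma below_exists x : (0 < row x)%N -> exists y, above x y.
Proof.
move=> h; have [|y e1 e2] := @cell_exists (row x).-1 (col x).
  by rewrite /is_cell col_lt; apply: leq_ltn_trans (leq_pred _) (row_lt x).
by exists y; rewrite /above e1 e2 prednK // !eqxx.
Qed.

Lemma above_injr x y y' : above x y -> above x y' -> y = y'.
Proof.
move=> /andP[/eqP a1 /eqP a2] /andP[/eqP b1 /eqP b2]; apply: cell_inj; last by rewrite -a2.
by move: b1; rewrite a1 => -[].
Qed.

Lemma above_injl x x' y : above x y -> above x' y -> x = x'.
Proof.
move=> /andP[/eqP a1 /eqP a2] /andP[/eqP b1 /eqP b2].
by apply: cell_inj; [rewrite a1 b1 | rewrite a2 b2].
Qed.

Lemma card_dg : #|{: dg la}| = sumn la.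
Proof.
rewrite card_sig -sum1_card /=.
rewrite (eq_bigl (fun p : 'I_(size la) * 'I_(foldr maxn 0%N la) => (p.2 < ht p.1)%N)) //.
rewrite -(pair_big_dep predT (fun (i : 'I_(size la)) (r : 'I_(foldr maxn 0%N la)) => (r < ht i)%N) (fun _ _ => 1%N)) /=.
rewrite sumnE (big_nth 0%N) big_mkord; apply: eq_bigr => i _.
by rewrite -(big_ord_widen _ (fun=> 1%N) (ht_max i)) sum1_card card_ord.
Qed.

(** * The statistics as products over pairs of cells *)

Section Weight.
Variables (n : nat) (s : sfilling la n).
Local Notation I x y := (superI (s x) (s y)).

Lemma majE : maj s = (\sum_x \sum_y above x y * I x y * leg1 x)%N.
Proof.
rewrite /maj big_mkcond /=; apply: eq_bigr => x _.
have [r0|] := posnP (row x).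
  rewrite [RHS]big1 // => y _; suff -> : above x y = false by [].
  by rewrite /above r0.
move=> /below_exists[y xy]; rewrite /= (bigD1 y) //= xy mul1n [in RHS]big1 ?addn0.
  have /andP[/eqP e1 /eqP e2] := xy.
  rewrite (entry_cell s (erefl (row x)) (erefl (col x))).
  rewrite (@entry_cell _ s _ _ y) ?e1 ?e2 //.
  by rewrite -e1 -e2 /superI; case: (Ist _ _); rewrite ?mul1n ?mul0n.
move=> y' ny; suff -> : above x y' = false by [].
by apply/negbTE; apply: contra ny => h; rewrite (above_injr xy h).
Qed.

Definition right_of y c := (row c == row y) && (col y < col c)%N.

(** A triple is determined by its cells [b] and [c]. The entry above [b] is read by [entry], which
    returns the extra value 0 at the top of a column, so degenerate triples are included. *)
Lemma quinvE0 : quinv s = (\sum_y \sum_(c | right_of y c)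
   quinv_triple (entry s (row y).+1 (col y)) (Some (letter_of (s y))) (Some (letter_of (s c))))%N.
Proof.
pose Q (p : V * V) := right_of p.1 p.2 && quinv_triple (entry s (row p.1).+1 (col p.1))
   (Some (letter_of (s p.1))) (Some (letter_of (s p.2))).
pose h (p : V * V) := ((val p.1).2, (val p.1).1, (val p.2).1).
transitivity #|[set p | Q p]|.
  rewrite -[RHS](card_in_imset (f := h)).
    apply: eq_card => -[[r i] j]; rewrite inE; apply/and4P/imsetP.
      move=> [ij ci cj qt]; have [y y1 y2] := cell_exists ci; have [c c1 c2] := cell_exists cj.
      exists (y, c); last by congr (_, _, _); apply: val_inj.
      rewrite inE /Q /right_of /= y1 y2 c1 c2 eqxx ij /=.
      by rewrite -(entry_cell s y1 y2) -(entry_cell s c1 c2).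
    move=> [[y c]]; rewrite inE /Q => /andP[/andP[/eqP /= e lt] qt] [-> -> ->].
    split=> //; first exact: is_cellP.
      by rewrite -/(row y) -/(col c) -e is_cellP.
    rewrite -/(row y) -/(col y) -/(col c) (entry_cell s (erefl (row y)) (erefl (col y))).
    by rewrite (entry_cell s e (erefl (col c))).
  move=> [y c] [y' c']; rewrite !inE /Q => /andP[/andP[/eqP /= e _] _] /andP[/andP[/eqP /= e' _] _].
  move=> [/(congr1 val) /= h1 /(congr1 val) /= h2 /(congr1 val) /= h3].
  by congr (_, _); apply: cell_inj => //; rewrite e e'.
rewrite -sum1_card pair_big_dep /= big_mkcond /= [RHS]big_mkcond /=; apply: eq_bigr => p _.
by rewrite inE /Q; case: (right_of _ _) => //=; case: (quinv_triple _ _ _).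
Qed.

(** The extra value 0 exceeds no letter, so an empty sum is correct in the degenerate case. *)
Lemma Ist_above y (f : sletter) :
  (Ist (entry s (row y).+1 (col y)) (Some f) =
   \sum_x above x y * Ist (Some (letter_of (s x))) (Some f) :> nat)%N.
Proof.
have [|nc] := boolP (is_cell la (row y).+1 (col y)).
  move=> /cell_exists[x x1 x2]; rewrite (entry_cell s x1 x2).
  have xy : above x y by rewrite /above x1 x2 !eqxx.
  rewrite (bigD1 x) //= xy mul1n big1 ?addn0 // => x' nx.
  suff -> : above x' y = false by [].
  by apply/negbTE; apply: contra nx => h; rewrite (above_injl xy h).
rewrite entry_none // big1; first by case: f => [[] ?].
move=> x _; suff -> : above x y = false by [].
apply/negbTE; apply: contra nc => /andP[/eqP e1 /eqP e2].
by rewrite -e1 -e2 is_cellP.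
Qed.

(** Sum of [quinv_tripleE] over all triples. An attacking pair in consecutive rows lies in exactly
    one triple, because the cell below its upper cell is in the diagram. *)
Lemma quinvE : (quinv s + \sum_x \sum_y above x y * I x y * arm y =
   \sum_x \sum_y attacks x y * I x y)%N.
Proof.
have -> : (\sum_x \sum_y above x y * I x y * arm y =
  \sum_y \sum_(c | right_of y c) Ist (entry s (row y).+1 (col y)) (Some (letter_of (s y))))%N.
  rewrite exchange_big /=; apply: eq_bigr => y _.
  rewrite sum_nat_const mulnC -big_distrl /= -Ist_above; congr (_ * _)%N.
  by rewrite /arm; apply: eq_card => c; rewrite inE.
rewrite quinvE0 -big_split /=.
under eq_bigr => y _.
  rewrite -big_split /=.
  under eq_bigr => c _ do rewrite quinv_tripleE Ist_above.
  rewrite big_split /=; over.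
rewrite big_split /=.
have -> : (\sum_x \sum_y attacks x y * I x y =
  \sum_x \sum_y ((row x == row y) && (col y < col x)) * I x y +
  \sum_x \sum_y ((row x == (row y).+1) && (col x < col y)) * I x y)%N.
  rewrite -big_split /=; apply: eq_bigr => x _; rewrite -big_split /=; apply: eq_bigr => y _.
  by rewrite -mulnDl; congr (_ * _)%N; rewrite /attacks; lia.
congr (_ + _)%N.
  rewrite exchange_big /=; apply: eq_bigr => c _; rewrite big_mkcond /=.
  apply: eq_bigr => y _; rewrite /right_of; case: (_ && _) => //.
  by rewrite mul1n.
transitivity (\sum_y \sum_c \sum_x (right_of y c && above x y) * I x c)%N.
  apply: eq_bigr => y _; rewrite big_mkcond /=; apply: eq_bigr => c _.
  case: (right_of y c) => /=; first by [].
  by rewrite big1.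
rewrite exchange_big /= [RHS]exchange_big /=; apply: eq_bigr => c _.
rewrite exchange_big /=; apply: eq_bigr => x _.
have [r0|/below_exists[y xy]] := posnP (row x).
  by rewrite r0 /= big1 // => y _; rewrite /above r0 andbF.
rewrite (bigD1 y) //= xy andbT big1 ?addn0.
  by move: xy => /andP[/eqP-> /eqP->]; rewrite eqSS eq_sym.
move=> y' ny; suff -> : above x y' = false by rewrite andbF.
by apply/negbTE; apply: contra ny => h; rewrite (above_injr xy h).
Qed.

Lemma weight_pair_weight :
  qq ^+ maj s * tt ^+ quinv s = pair_weight (@superI n) cell_weight1 s.
Proof.
have -> : pair_weight (@superI n) cell_weight1 s =
  tt ^+ (\sum_x \sum_y attacks x y * I x y) * qq ^+ (\sum_x \sum_y above x y * I x y * leg1 x) /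
  tt ^+ (\sum_x \sum_y above x y * I x y * arm y).
  rewrite /pair_weight !expr_sum -prodfV -!big_split /=; apply: eq_bigr => x _.
  rewrite !expr_sum -prodfV -!big_split /=; apply: eq_bigr => y _.
  rewrite /cell_weight1 /cell_weight; case: (I x y) => /=; last first.
    by rewrite !muln0 !mul0n !expr0 addr0 invr1 !mulr1.
  rewrite !muln1 addrC subrK; case: ifP => [att|_].
    have -> : above x y = false by apply/negbTE; move: att; rewrite /attacks /above; lia.
    by rewrite !mul0n !expr0 expr1 invr1 !mulr1.
  by case: ifP => _; rewrite ?mul1n ?mul0n ?expr0 ?invr1 ?mulr1 ?mul1r.
rewrite -majE -quinvE exprD [in RHS]mulrAC mulfK; first by rewrite mulrC.
by rewrite expf_neq0 // tt_neq0.
Qed.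

End Weight.
End Diagram.

(** * Words with extremal letters *)

Section Gauss.
Variables (K : comNzRingType) (t : K).

(** The [t]-binomial coefficient, by one of its Pascal recurrences; [gaussS'] is the other one. *)
Fixpoint gauss n k : K :=
  match n, k with
  | _, 0 => 1
  | 0, _.+1 => 0
  | n'.+1, k'.+1 => t ^+ k * gauss n' k + gauss n' k'
  end.

Lemma gaussn0 n : gauss n 0 = 1. Proof. by case: n. Qed.

Lemma gauss_small n k : (n < k)%N -> gauss n k = 0.
Proof.
elim: n k => [|n IH] [|k] //= lt; rewrite !IH ?mulr0 ?addr0 //; lia.
Qed.

Arguments gauss : simpl never.

Lemma gaussS n k : gauss n.+1 k.+1 = t ^+ k.+1 * gauss n k.+1 + gauss n k.
Proof. by []. Qed.

Lemma gaussS' n k : (k <= n)%N -> gauss n.+1 k.+1 = gauss n k.+1 + t ^+ (n - k) * gauss n k.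
Proof.
elim: n k => [|n IH] [|k] // lekn.
- by rewrite gaussS gaussn0 gauss_small // mulr0 !add0r expr0 mul1r.
- have h := IH 0%N isT; rewrite gaussS {1}h gaussS !gaussn0 !subn0 !exprS; ring.
rewrite ltnS in lekn; rewrite subSS.
have h1 := gaussS n k.+1; have h2 := gaussS n k; have h3 := IH k lekn.
have h4 : t * gauss n.+1 k.+2 = t * gauss n k.+2 + t ^+ (n - k) * gauss n k.+1.
  have [ltkn|lenk] := ltnP k n.
    rewrite (IH _ ltkn); have -> : (n - k = (n - k.+1).+1)%N by lia.
    by rewrite exprS; ring.
  by rewrite !gauss_small ?mulr0 ?addr0 //; lia.
rewrite gaussS exprSr -mulrA h4 [X in _ + X = _]h3 h1 h2 !exprS; ring.
Qed.

(** The factor produced by [k] extremal letters placed with all signs in words of length [n], when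
    changing [a] into [A] costs [- z]. The product is the Pochhammer symbol [(z; t)_k]. *)
Definition sign_sum n k z : K := gauss n k * \prod_(j < k) (1 - z * t ^+ j).

(** Mirrors the removal of the last letter: an ordinary one gives [t ^ k.+1] and turns [z] into
    [z / t], an extremal one gives 1 or [- z * t ^ n]. *)
Lemma sign_sumS n k z z' : z = t * z' ->
  sign_sum n.+1 k.+1 z =
  t ^+ k.+1 * sign_sum n k.+1 z' + (1 - z * t ^+ n) * sign_sum n k z.
Proof.
move=> ->; rewrite /sign_sum.
have E : t ^+ k.+1 * \prod_(j < k.+1) (1 - z' * t ^+ j) =
   (t ^+ k.+1 - z' * t ^+ k.+1) * \prod_(j < k) (1 - t * z' * t ^+ j).
  rewrite big_ord_recl expr0 mulr1 mulrA mulrBr mulr1 [z' * _]mulrC; congr (_ * _).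
  by apply: eq_bigr => j _; rewrite /= exprS; ring.
rewrite mulrCA E big_ord_recr /=.
have [lekn|ltnk] := leqP k n; last first.
  by rewrite !gauss_small ?mul0r ?mulr0 ?addr0 //; lia.
have h1 := gaussS n k; have h2 := gaussS' lekn.
have -> : t ^+ n = t ^+ k * t ^+ (n - k) by rewrite -exprD subnKC.
set p := \prod_(j < k) _.
transitivity ((gauss n.+1 k.+1 - t * z' * t ^+ k * gauss n.+1 k.+1) * p); first by ring.
by rewrite {1}h1 h2 !exprS; ring.
Qed.

Lemma sign_sum1 n k : (0 < k)%N -> sign_sum n k 1 = 0.
Proof. by case: k => // k _; rewrite /sign_sum big_ord_recl expr0 mulr1 subrr mul0r mulr0. Qed.

End Gauss.

Arguments gauss : simpl never.

(** * Sums over words with a smallest letter [a] and a largest letter [A] *)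

Section WordLemma.
Variables (L : eqType) (I : rel L) (R : comNzRingType) (t t' : R).
Hypothesis tt' : t * t' = 1.
Variables (a A : L) (os : seq L).
Hypothesis aA : a != A.
Hypothesis os_a : {in os, forall x, [/\ x != a, x != A, I x a = true & I x A = false]}.
Hypothesis Ia : {in a :: A :: os, forall x, I a x = false}.
Hypothesis IA : {in a :: A :: os, forall x, I A x = true}.

(** The recursion appends the last letter, which is the letter split off in the inductions below. *)
Fixpoint sum_words (ls : seq L) n (f : seq L -> R) : R :=
  if n is n'.+1 then \sum_(c <- ls) sum_words ls n' (fun w => f (rcons w c)) else f [::].

Lemma eq_sum_words ls n f f' :
  (forall w, size w = n -> {subset w <= ls} -> f w = f' w) ->
  sum_words ls n f = sum_words ls n f'.
Proof.
elim: n f f' => [|n IH] f f' E /=; first by apply: E.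
rewrite !big_seq; apply: eq_bigr => c cls; apply: IH => w sw wls; apply: E.
  by rewrite size_rcons sw.
by move=> x; rewrite mem_rcons inE => /orP[/eqP->|/wls].
Qed.

Lemma sum_words_distrr ls n f r : r * sum_words ls n f = sum_words ls n (fun w => r * f w).
Proof.
elim: n f => //= n IH f; rewrite big_distrr /=; apply: eq_bigr => c _; exact: IH.
Qed.

Lemma sum_words0 ls n : sum_words ls n (fun=> 0) = 0.
Proof. by elim: n => //= n IH; rewrite big1. Qed.

Lemma sum_words_sum ls n (J : Type) (r : seq J) (f : J -> seq L -> R) :
  \sum_(j <- r) sum_words ls n (f j) = sum_words ls n (fun w => \sum_(j <- r) f j w).
Proof.
elim: n f => //= n IH f; rewrite exchange_big /=; apply: eq_bigr => c _.
by rewrite IH.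
Qed.

Fixpoint coinv (w : seq L) : nat :=
  if w is x :: w' then (count (fun y => I y x) w' + coinv w')%N else 0%N.

Lemma coinv_rcons w c : coinv (rcons w c) = (coinv w + count (fun x => I c x) w)%N.
Proof. by elim: w => //= x w ->; rewrite -cats1 count_cat /=; lia. Qed.

Definition extremal c := (c == a) || (c == A).
Definition exchangeable (nu : seq L -> R) :=
  forall u x y v, nu (u ++ x :: y :: v) = nu (u ++ y :: x :: v).

Lemma exchangeable_move nu u k v : exchangeable nu ->
  nu (rcons (u ++ nseq k a) v) = nu (rcons u v ++ nseq k a).
Proof.
move=> ex; elim: k u => [|k IH] u; first by rewrite !cats0.
rewrite /= -cat_rcons IH -!cats1 -!catA /=; exact: ex.
Qed.

(** Induction on the last letter. An ordinary [c] exceeds every earlier [a] and no earlier [A]: it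
    contributes [t ^ k] and divides [z] by [t], which is why [z] is arbitrary. A final [a]
    contributes no factor, a final [A] contributes [- z * t ^ n]. Exchangeability collects the
    letters [a] at the end. *)
Lemma sum_words_extremal n k nu z : exchangeable nu ->
  (forall u v, nu (u ++ A :: v) = - z * nu (u ++ a :: v)) ->
  sum_words (a :: A :: os) n
    (fun w => if count extremal w == k then t ^+ coinv w * nu w else 0) =
  sign_sum t n k z *
  sum_words os (n - k) (fun v => t ^+ coinv v * nu (v ++ nseq k a)).
Proof.
elim: n k nu z => [|n IH] k nu z ex flip.
  rewrite /= /sign_sum; case: k => [|k] /=; last by rewrite gauss_small ?mul0r.
  by rewrite gaussn0 big_ord0 !mul1r.
rewrite /= !big_cons.
have Ea w : count extremal (rcons w a) = (count extremal w).+1.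
  by rewrite -cats1 count_cat /= /extremal eqxx /= !addn0 addn1.
have EA w : count extremal (rcons w A) = (count extremal w).+1.
  by rewrite -cats1 count_cat /= /extremal eqxx orbT /= !addn0 addn1.
have Ev : \sum_(c <- os) sum_words (a :: A :: os) n (fun w =>
     if count extremal (rcons w c) == k
     then t ^+ coinv (rcons w c) * nu (rcons w c) else 0) =
   t ^+ k * sign_sum t n k (z * t') *
   \sum_(c <- os) sum_words os (n - k) (fun w => t ^+ coinv (rcons w c) * nu (rcons w c ++ nseq k a)).
  rewrite big_distrr /= !big_seq; apply: eq_bigr => c cos.
  have [ca cA Ica IcA] := os_a cos.
  pose nuc w := t ^+ count (fun x => I c x) w * nu (rcons w c).
  have exc : exchangeable nuc.
    move=> u x y v; rewrite /nuc -!cats1 -!catA /= ex; congr (t ^+ _ * _).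
    by rewrite !count_cat /= [(I c x + _)%N]addnCA.
  transitivity (sum_words (a :: A :: os) n (fun w =>
     if count extremal w == k then t ^+ coinv w * nuc w else 0)).
    apply: eq_sum_words => w _ _; rewrite -cats1 count_cat /= /extremal (negbTE ca) (negbTE cA) /= !addn0.
    by rewrite cats1 coinv_rcons exprD -mulrA.
  rewrite (IH k nuc (z * t') exc).
    rewrite -mulrA mulrCA; congr (_ * _); rewrite sum_words_distrr; apply: eq_sum_words => w _ _.
    rewrite /nuc exchangeable_move // count_cat count_nseq Ica mul1n coinv_rcons !exprD.
    ring.
  move=> u v; rewrite /nuc -!cats1 -!catA /= flip !count_cat /= Ica IcA add0n !exprD expr1.
  have -> : - z = t * (- (z * t')) by rewrite mulrN mulrCA tt' mulr1.
  ring.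
rewrite Ev; clear Ev; case: k => [|k].
  have Z c : (forall w, count extremal (rcons w c) = (count extremal w).+1) ->
      sum_words (a :: A :: os) n (fun w => if count extremal (rcons w c) == 0%N
        then t ^+ coinv (rcons w c) * nu (rcons w c) else 0) = 0.
    by move=> E; rewrite -[RHS](sum_words0 (a :: A :: os) n);
      apply: eq_sum_words => w _ _; rewrite E.
  rewrite (Z _ Ea) (Z _ EA) !add0r /sign_sum !gaussn0 !big_ord0 expr0 !mul1r.
  by rewrite !subn0.
have Fa : sum_words (a :: A :: os) n (fun w => if count extremal (rcons w a) == k.+1
     then t ^+ coinv (rcons w a) * nu (rcons w a) else 0) =
   sign_sum t n k z * sum_words os (n - k) (fun v => t ^+ coinv v * nu (v ++ nseq k.+1 a)).
  pose nua w := nu (rcons w a).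
  have exa : exchangeable nua by move=> u x y v; rewrite /nua -!cats1 -!catA; apply: ex.
  transitivity (sum_words (a :: A :: os) n (fun w =>
     if count extremal w == k then t ^+ coinv w * nua w else 0)).
    apply: eq_sum_words => w _ wls; rewrite Ea eqSS coinv_rcons.
    rewrite (_ : count (fun x => I a x) w = 0%N) ?addn0 //; apply/eqP; rewrite -leqn0 leqNgt -has_count.
    by apply/hasPn => x /wls xls; rewrite Ia.
  rewrite (IH k nua z exa); last by move=> u v; rewrite /nua -!cats1 -!catA; apply: flip.
  congr (_ * _); apply: eq_sum_words => w _ _; rewrite /nua.
  by rewrite exchangeable_move // -cat_rcons.
have FA : sum_words (a :: A :: os) n (fun w => if count extremal (rcons w A) == k.+1
     then t ^+ coinv (rcons w A) * nu (rcons w A) else 0) =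
   - z * t ^+ n * sum_words (a :: A :: os) n (fun w => if count extremal (rcons w a) == k.+1
     then t ^+ coinv (rcons w a) * nu (rcons w a) else 0).
  rewrite sum_words_distrr; apply: eq_sum_words => w sw wls; rewrite EA Ea.
  case: ifP => _; last by rewrite mulr0.
  rewrite !coinv_rcons (_ : count (fun x => I A x) w = n); last first.
    by rewrite -sw; apply/eqP; rewrite -all_count; apply/allP => x /wls xls; rewrite IA.
  rewrite (_ : count (fun x => I a x) w = 0%N); last first.
    apply/eqP; rewrite -leqn0 leqNgt -has_count.
    by apply/hasPn => x /wls xls; rewrite Ia.
  rewrite -!cats1 flip exprD addn0; ring.
rewrite FA Fa (sign_sumS n k (z' := z * t')); last by rewrite mulrCA tt' mulr1.
rewrite subSS mulrDl.
have [lekn|ltnk] := leqP k.+1 n.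
  have -> : (n - k = (n - k.+1).+1)%N by lia.
  rewrite /=; ring.
rewrite (_ : sign_sum t n k.+1 (z * t') = 0); last by rewrite /sign_sum gauss_small ?mul0r.
ring.
Qed.

Lemma sum_words_cancel n nu : exchangeable nu ->
  (forall u v, nu (u ++ A :: v) = - nu (u ++ a :: v)) ->
  sum_words (a :: A :: os) n
    (fun w => if has extremal w then t ^+ coinv w * nu w else 0) = 0.
Proof.
move=> ex flip.
transitivity (\sum_(k <- iota 1 n) sum_words (a :: A :: os) n
    (fun w => if count extremal w == k then t ^+ coinv w * nu w else 0)).
  rewrite sum_words_sum; apply: eq_sum_words => w sw _; rewrite has_count.
  case: ifP => [c0|/negbT].
    rewrite (bigD1_seq (count extremal w)) ?iota_uniq //= ?eqxx.
      by rewrite big1 ?addr0 // => k; rewrite eq_sym => /negbTE ->.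
    by rewrite mem_iota c0 add1n ltnS -sw count_size.
  rewrite -eqn0Ngt => /eqP ->; rewrite big_seq big1 // => k.
  by rewrite mem_iota; case: k.
rewrite big_seq big1 // => k; rewrite mem_iota => /andP[k0 _].
rewrite (sum_words_extremal n k (z := 1) ex); last by move=> u v; rewrite mulN1r.
by rewrite sign_sum1 // mul0r.
Qed.

End WordLemma.

(** * Exchange of two columns of equal height *)

(** Leaves three patterns for comparing a letter with two distinct ones, which reduces the exchange
    of columns to a finite check. *)
Lemma superI_cases n (u v : bool * 'I_n) :
  [\/ u = v,
      [/\ superI v u, superI u v = false & forall p, superI p v -> superI p u] |
      [/\ superI u v, superI v u = false & forall p, superI p u -> superI p v]].
Proof.
have [->|nuv] := eqVneq u v; first by constructor 1.
have h : (u.1 == v.1) ==> (u.2 != v.2 :> nat).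
  apply/implyP => /eqP e1; apply: contraNneq nuv => e2.
  by case: u v e1 e2 => ? ? [? ?] /= -> /val_inj ->.
case E : (superI v u); [constructor 2 | constructor 3];
  move: E h; rewrite !superIE;
  case: u v nuv => [[] i] [[] j] /= _ E h; split; try lia;
  move=> [[] p]; rewrite !superIE /=; lia.
Qed.

Section Exchange.
Variables (la : seq nat) (n j R : nat).
Hypothesis jsize : (j.+1 < size la)%N.
Hypothesis htj : nth 0%N la j = R.+1.
Hypothesis htj1 : nth 0%N la j.+1 = R.+1.
Local Notation V := (dg la).
Local Notation row := (@cell_row la).
Local Notation col := (@cell_col la).
Local Notation ht := (nth 0%N la).
Implicit Types (x y c : V) (s : sfilling la n).

Definition in_pair c := (col c == j) || (col c == j.+1).
Definition swap_col k := if k == j then j.+1 else if k == j.+1 then j else k.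
Definition mirror c := odflt c [pick d | (row d == row c) && (col d == swap_col (col c))].

Lemma mirrorP c : row (mirror c) = row c /\ col (mirror c) = swap_col (col c).
Proof.
rewrite /mirror; case: pickP => [d /andP[/eqP-> /eqP->] //|nd].
have [|d e1 e2] := @cell_exists la (row c) (swap_col (col c)).
  have := is_cellP c; rewrite /is_cell /swap_col.
  have [->|_] := eqVneq (col c) j; first by rewrite htj htj1 jsize => /andP[].
  by have [->|_ //] := eqVneq (col c) j.+1; rewrite htj htj1 (ltnW jsize) => /andP[].
by have := nd d; rewrite e1 e2 !eqxx.
Qed.

Lemma swap_colK : involutive swap_col.
Proof. by move=> k; rewrite /swap_col; do ![case: eqP => //]; lia. Qed.

Lemma mirrorK : involutive mirror.
Proof.
move=> c; have [r1 c1] := mirrorP c; have [r2 c2] := mirrorP (mirror c).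
by apply: cell_inj; rewrite ?r2 ?c2 ?r1 ?c1 ?swap_colK.
Qed.

Definition tau r c := if row c == r then mirror c else c.

Lemma row_tau r c : row (tau r c) = row c.
Proof. by rewrite /tau; case: ifP => // _; have [] := mirrorP c. Qed.

Lemma tauK r : involutive (tau r).
Proof.
by move=> c; rewrite {1}/tau row_tau /tau; case: ifP => h; rewrite ?h // mirrorK.
Qed.

Lemma in_pair_mirror c : in_pair (mirror c) = in_pair c.
Proof.
have [_ e] := mirrorP c; rewrite /in_pair e /swap_col.
by do ![case: eqP => //]; lia.
Qed.

Lemma mirror_id c : ~~ in_pair c -> mirror c = c.
Proof.
move=> h; have [e1 e2] := mirrorP c; apply: cell_inj => //; rewrite e2 /swap_col.
by move: h; rewrite /in_pair; do ![case: eqP => //].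
Qed.

Lemma in_pair_tau r c : in_pair (tau r c) = in_pair c.
Proof. by rewrite /tau; case: ifP => // _; apply: in_pair_mirror. Qed.

Lemma tau_id r c : ~~ in_pair c -> tau r c = c.
Proof. by move=> h; rewrite /tau; case: ifP => // _; apply: mirror_id. Qed.

Definition swap_row r s : sfilling la n := [ffun c => s (tau r c)].

Lemma swap_rowK r : involutive (swap_row r).
Proof. by move=> s; apply/ffunP => c; rewrite !ffunE tauK. Qed.

Lemma swap_rowC r r' s : swap_row r (swap_row r' s) = swap_row r' (swap_row r s).
Proof.
apply/ffunP => c; rewrite !ffunE; congr (s _).
by rewrite /tau !(fun_if row) !(mirrorP _).1 !if_same; do 2?case: ifP.
Qed.

Definition pair_factor s x y := 1 + cell_weight1 x y *+ superI (s x) (s y).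

(** The interactions inside the two columns whose second cell lies in row [k]; those within row
    [k.+1] belong to the next transfer. *)
Definition transfer k s :=
  \prod_(x | in_pair x && ((row x == k) || (row x == k.+1)))
  \prod_(y | in_pair y && (row y == k)) pair_factor s x y.

Lemma transfer_swap_far r k s : r != k -> r != k.+1 -> transfer k (swap_row r s) = transfer k s.
Proof.
move=> rk rk1; apply: eq_bigr => x /andP[_ xr]; apply: eq_bigr => y /andP[_ /eqP yr].
rewrite /pair_factor !ffunE /tau yr [k == r]eq_sym (negbTE rk).
by case/orP: xr => /eqP->; rewrite ![_ == r]eq_sym ?(negbTE rk) ?(negbTE rk1).
Qed.

Lemma transferE k s x1 x2 y1 y2 : row x1 = k.+1 -> row x2 = k.+1 -> row y1 = k -> row y2 = k ->
  col x1 = j -> col x2 = j.+1 -> col y1 = j -> col y2 = j.+1 ->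
  transfer k s = pair_factor s y2 y1 * pair_factor s x1 y2 *
    (pair_factor s x1 y1 * pair_factor s x2 y2).
Proof.
move=> rx1 rx2 ry1 ry2 cx1 cx2 cy1 cy2.
have pair x k' c1 c2 : row c1 = k' -> row c2 = k' -> col c1 = j -> col c2 = j.+1 ->
    (in_pair x && (row x == k')) = (x \in [:: c1; c2]).
  move=> r1 r2 e1 e2; rewrite !inE /in_pair; apply/andP/orP.
    by move=> [/orP[] /eqP e /eqP r]; [left|right]; apply/eqP/cell_inj; rewrite ?r1 ?r2 ?e1 ?e2.
  by move=> [] /eqP->; rewrite ?r1 ?r2 ?e1 ?e2 !eqxx ?orbT.
have ne c d : (row c != row d) || (col c != col d) -> (c == d) = false.
  by apply: contraTF => /eqP->; rewrite !eqxx.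
rewrite /transfer (eq_bigl (fun x => x \in [:: y1; y2; x1; x2])); last first.
  move=> x; rewrite andb_orr (pair x _ y1 y2) // (pair x _ x1 x2) //.
  by rewrite !inE !orbA.
rewrite -big_uniq; last first.
  by rewrite /= !inE !ne ?rx1 ?rx2 ?ry1 ?ry2 ?cx1 ?cx2 ?cy1 ?cy2 //; lia.
have inner x : \prod_(y | in_pair y && (row y == k)) pair_factor s x y =
   pair_factor s x y1 * pair_factor s x y2.
  rewrite (eq_bigl (fun y => y \in [:: y1; y2])); last by move=> y; apply: pair.
  rewrite -big_uniq; last by rewrite /= !inE !ne // cy1 cy2; lia.
  by rewrite !big_cons big_nil /= mulr1.
rewrite !big_cons big_nil !inner /=.
have triv x y : ~~ attacks x y -> ~~ above x y -> pair_factor s x y = 1.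
  move=> h1 h2; rewrite /pair_factor /cell_weight1 /cell_weight (negbTE h1) (negbTE h2).
  by rewrite subrr mul0rn addr0.
rewrite (triv y1 y1) ?(triv y1 y2) ?(triv y2 y2) ?(triv x2 y1);
  try by rewrite /attacks /above ?rx1 ?rx2 ?ry1 ?ry2 ?cx1 ?cx2 ?cy1 ?cy2; lia.
ring.
Qed.

(** Summed over both orders of row [k], the transfer is symmetric in the entries of row [k.+1]. The
    legs agree and the left arm is larger by 1, so the right vertical pair weighs [tt] times the
    left one. With this ratio the identity holds in every pattern of comparisons, for any left
    weight [kap]. *)
Lemma transfer_sym k s : (k < R)%N ->
  transfer k (swap_row k.+1 s) + transfer k (swap_row k (swap_row k.+1 s)) =
  transfer k s + transfer k (swap_row k s).
Proof.
move=> kR.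
have ex r i : (r <= R)%N -> (i == j) || (i == j.+1) -> {c | row c = r & col c = i}.
  move=> rR ij; apply: cell_exists; rewrite /is_cell.
  by case/orP: ij => /eqP->; rewrite ?htj ?htj1 ltnS rR andbT // ltnW.
have [x1 rx1 cx1] := ex k.+1 j kR (introT orP (or_introl (eqxx j))).
have [x2 rx2 cx2] := ex k.+1 j.+1 kR (introT orP (or_intror (eqxx j.+1))).
have [y1 ry1 cy1] := ex k j (ltnW kR) (introT orP (or_introl (eqxx j))).
have [y2 ry2 cy2] := ex k j.+1 (ltnW kR) (introT orP (or_intror (eqxx j.+1))).
have mx1 : mirror x1 = x2.
  have [e1 e2] := mirrorP x1; apply: cell_inj; first by rewrite e1 rx1 rx2.
  by rewrite e2 cx1 cx2 /swap_col eqxx.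
have mx2 : mirror x2 = x1 by rewrite -mx1 mirrorK.
have my1 : mirror y1 = y2.
  have [e1 e2] := mirrorP y1; apply: cell_inj; first by rewrite e1 ry1 ry2.
  by rewrite e2 cy1 cy2 /swap_col eqxx.
have my2 : mirror y2 = y1 by rewrite -my1 mirrorK.
have kk : (k == k.+1) = false by lia.
have kk' : (k.+1 == k) = false by lia.
have tE s' := @transferE k s' x1 x2 y1 y2 rx1 rx2 ry1 ry2 cx1 cx2 cy1 cy2.
rewrite !tE /pair_factor !ffunE /tau ?(rx1, rx2, ry1, ry2, kk, kk', eqxx, mx1, mx2, my1, my2).
set p := s x1; set q := s x2; set u := s y1; set v := s y2.
have W c d : 1 + cell_weight1 c d = cell_weight c d by rewrite addrC subrK.
have w1 : cell_weight y2 y1 = tt.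
  by rewrite /cell_weight /attacks ry1 ry2 cy1 cy2 eqxx ltnSn.
have w2 : cell_weight x1 y2 = tt.
  by rewrite /cell_weight /attacks rx1 ry2 cx1 cy2 eqxx ltnSn orbT.
have w34 : cell_weight x2 y2 = tt * cell_weight x1 y1.
  rewrite /cell_weight /attacks /above rx1 rx2 ry1 ry2 cx1 cx2 cy1 cy2 !eqxx !ltnn kk' /=.
  have -> : arm y1 = (arm y2).+1.
    rewrite /arm (_ : [set z | _] = y2 |: [set z | (row z == row y2) && (col y2 < col z)%N]).
      by rewrite cardsU1 !inE ltnn andbF.
    apply/setP => z; rewrite !inE ry1 ry2 cy1 cy2.
    have [->|nz] := eqVneq z y2; first by rewrite ry2 cy2 eqxx ltnSn.
    have : (row z != k) || (col z != j.+1).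
      by rewrite -negb_and; apply: contra nz => /andP[/eqP e1 /eqP e2]; apply/eqP/cell_inj; rewrite ?e1 ?e2.
    by rewrite /=; lia.
  rewrite /leg1 rx1 rx2 cx1 cx2 htj htj1 exprS invfM mulrCA mulVKf //.
  exact: tt_neq0.
have F c d (b : bool) : 1 + cell_weight1 c d *+ b = if b then cell_weight c d else 1.
  by case: b; rewrite ?W // mulr0n addr0.
rewrite !F w1 w2 w34; move: (cell_weight x1 y1) => kap.
have [->|[-> -> h]|[-> -> h]] := superI_cases u v.
- by case: (superI v v); case: (superI p v); case: (superI q v); ring.
- move: (h p) (h q); case: (superI p v); case: (superI p u); case: (superI q v);
    case: (superI q u) => hp hq; first [by have := hp isT | by have := hq isT | ring].
move: (h p) (h q); case: (superI p v); case: (superI p u); case: (superI q v);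
  case: (superI q u) => hp hq; first [by have := hp isT | by have := hq isT | ring].
Qed.

(** The exchange propagates upwards: once row [r] can be symmetrized by induction, [transfer_sym]
    exchanges the entries of row [r.+1]. *)
Lemma row_exchange r (Psi : sfilling la n -> Kqt) : (r <= R)%N ->
  (forall k s, (k < r)%N -> Psi (swap_row k s) = Psi s) ->
  \sum_s Psi s * \prod_(k < r) transfer k s =
  \sum_s Psi (swap_row r s) * \prod_(k < r) transfer k s.
Proof.
elim: r Psi => [|r IH] Psi rR PsiP.
  rewrite (reindex_inj (inv_inj (swap_rowK 0))) /=.
  by apply: eq_bigr => s _; rewrite !big_ord0.
(* Symmetrization in row [r]: the sum is added to its image under the induction hypothesis. *)
have dbl (Phi : sfilling la n -> Kqt) : (forall k s, (k <= r)%N -> Phi (swap_row k s) = Phi s) ->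
   2%:R * (\sum_s Phi s * \prod_(k < r.+1) transfer k s) =
   \sum_s Phi s * (transfer r s + transfer r (swap_row r s)) * \prod_(k < r) transfer k s.
  move=> PhiP; rewrite mulr_natl mulr2n.
  under eq_bigr => s _ do rewrite big_ord_recr /= mulrA mulrAC.
  rewrite [X in _ + X](IH (fun s => Phi s * transfer r s)).
  - rewrite -big_split /=; apply: eq_bigr => s _.
    by rewrite PhiP // -mulrDl -mulrDr.
  - exact: ltnW.
  move=> k s kr; rewrite PhiP; last exact: ltnW.
  by rewrite transfer_swap_far //; lia.
apply: (mulfI (Kqt_natr_neq0 1)); rewrite dbl; last by move=> k s kr; apply: PsiP.
rewrite (dbl (fun s => Psi (swap_row r.+1 s))); last first.
  by move=> k s kr; rewrite swap_rowC PsiP.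
rewrite (reindex_inj (inv_inj (swap_rowK r.+1))) /=; apply: eq_bigr => s _.
rewrite transfer_sym //; congr (_ * _).
apply: eq_bigr => k _; rewrite transfer_swap_far //; have := ltn_ord k; lia.
Qed.

End Exchange.

(** * Sign flips *)

Lemma nth_partition_gt (la : seq nat) h j :
  is_partition la -> (h < nth 0%N la j)%N = (j < count (fun x => h < x)%N la)%N.
Proof.
case/andP=> srt _; elim: la srt j => [|x l IH] srt j; first by rewrite nth_nil.
have sl : sorted geq l by apply: path_sorted srt.
have allx : all (fun y => y <= x)%N l.
  by apply: order_path_min srt => u v w /= h1 h2; apply: leq_trans h2 h1.
case: j => [|j] /=; rewrite ?IH //.
  case: ltnP => //= hx; suff -> : count (fun x => h < x)%N l = 0%N by [].
  apply/eqP; rewrite -leqn0 leqNgt -has_count; apply/hasPn => y /(allP allx) yx.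
  by rewrite -leqNgt (leq_trans yx).
case: (ltnP h x) => //= hx; suff -> : count (fun x => h < x)%N l = 0%N by [].
apply/eqP; rewrite -leqn0 leqNgt -has_count; apply/hasPn => y /(allP allx) yx.
by rewrite -leqNgt (leq_trans yx).
Qed.

Lemma nth_partition_mono (la : seq nat) i j :
  is_partition la -> (i <= j)%N -> (nth 0 la j <= nth 0 la i)%N.
Proof.
move=> laP ij; rewrite leqNgt nth_partition_gt //; apply/negP => lt.
have := leq_ltn_trans ij lt; by rewrite -nth_partition_gt // ltnn.
Qed.

Lemma card_row (la : seq nat) r (P : pred nat) :
  #|[set c : dg la | (cell_row c == r) && P (cell_col c)]| =
  #|[set i : 'I_(size la) | (r < nth 0%N la i)%N && P i]|.
Proof.
rewrite -(card_in_imset (f := fun c : dg la => (val c).1)).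
  apply: eq_card => i; rewrite [RHS]inE; apply/imsetP/andP.
    move=> [c]; rewrite inE => /andP[/eqP <- Pc] ->; split=> //; exact: row_lt.
  move=> [h Pi]; have [|c e1 e2] := @cell_exists la r i; first by rewrite /is_cell ltn_ord.
  by exists c; [rewrite inE e1 e2 eqxx | apply: val_inj].
move=> c d; rewrite !inE => /andP[/eqP e1 _] /andP[/eqP e2 _] e.
apply: cell_inj; first by rewrite e1 e2.
exact: (congr1 val e).
Qed.

Lemma mulKdiv (K : fieldType) (x y z : K) : y != 0 -> x * y * (z / y) = x * z.
Proof. by move=> y0; rewrite -mulrA [y * _]mulrCA mulfV // mulr1. Qed.

Section Flip.
Variables (la : seq nat) (n : nat).
Hypothesis laP : is_partition la.
Local Notation V := (dg la).
Local Notation row := (@cell_row la).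
Local Notation col := (@cell_col la).
Local Notation ht := (nth 0%N la).
Implicit Types (x y c u : V) (s : sfilling la n) (B : {set V}).

Definition letter_sign (e : bool * 'I_n) : Kqt := if e.1 then -1 else qq.

(** Pairs inside [B] are left out; [B = set0] gives the full weight. *)
Definition signed_weight B s : Kqt :=
  (\prod_c letter_sign (s c)) *
  \prod_x \prod_(y | ~~ ((x \in B) && (y \in B))) pair_factor s x y.

Definition flip u s : sfilling la n :=
  [ffun c => if c == u then (~~ (s c).1, (s c).2) else s c].

Lemma flipK u : involutive (flip u).
Proof.
move=> s; apply/ffunP => c; rewrite !ffunE; case: eqP => // _.
by rewrite negbK; case: (s c).
Qed.

Lemma flip_abs u s c : (flip u s c).2 = (s c).2.
Proof. by rewrite ffunE; case: eqP. Qed.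

Lemma pair_factorE s x y :
  pair_factor s x y = if superI (s x) (s y) then cell_weight x y else 1.
Proof.
rewrite /pair_factor; case: superI; last by rewrite addr0.
by rewrite mulr1n addrC subrK.
Qed.

Lemma cell_weight_trivial x y : ~~ attacks x y -> ~~ above x y -> cell_weight x y = 1.
Proof. by rewrite /cell_weight => /negbTE-> /negbTE->. Qed.

(** Among letters of absolute value at least [av], the positive one is least and the negative one
    greatest. With a positive entry, [u] collects [qq] and all [cell_weight x u]; with a negative
    one, -1 and all [cell_weight u y]. The strict bounds exclude ties in the pairs [(x, u)]. *)
Lemma signed_weight_flip B (av : 'I_n) R u s :
  row u = R -> (s u).2 = av ->
  (forall y, (R == row y) || (R == (row y).+1) -> (av <= (s y).2)%N) ->
  (forall x, row x = R.+1 -> (av < (s x).2)%N) ->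
  (forall x, row x = R -> (col u < col x)%N -> ~~ ((x \in B) && (u \in B)) ->
      (av < (s x).2)%N) ->
  \prod_(y | ~~ ((u \in B) && (y \in B))) cell_weight u y =
    qq * \prod_(x | ~~ ((x \in B) && (u \in B))) cell_weight x u ->
  signed_weight B (flip u s) = - signed_weight B s.
Proof.
move=> ru su ge_av gt_av1 gt_av bal.
wlog pos : s su ge_av gt_av1 gt_av / (s u).1 = false.
  move=> h; case E : (s u).1; last exact: h.
  rewrite -{2}(flipK u s) [in RHS]h ?opprK ?flip_abs // ?ffunE ?eqxx ?E //.
  - by move=> y hy; rewrite flip_abs ge_av.
  - by move=> y hy; rewrite flip_abs gt_av1.
  - by move=> y hy cy my; rewrite flip_abs gt_av.
pose mask x y := ~~ ((x \in B) && (y \in B)).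
pose O s' := \prod_(x | x != u) \prod_(y | mask x y && (y != u)) pair_factor s' x y.
have split s' : \prod_x \prod_(y | mask x y) pair_factor s' x y =
   (\prod_(y | mask u y) pair_factor s' u y) *
   (\prod_(x | mask x u && (x != u)) pair_factor s' x u) * O s'.
  rewrite (bigD1 u) //= -mulrA; congr (_ * _).
  transitivity (\prod_(x | x != u) ((if mask x u then pair_factor s' x u else 1) *
      \prod_(y | mask x y && (y != u)) pair_factor s' x y)).
    apply: eq_bigr => x xu; case: ifP => m; first by rewrite (bigD1 u).
    rewrite mul1r; apply: eq_bigl => y; case: eqP => [->|_]; rewrite ?m ?andbT //.
  rewrite big_split /=; congr (_ * _); rewrite -big_mkcondr; apply: eq_bigl => x.
  by rewrite andbC.
have uu : cell_weight u u = 1.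
  by apply: cell_weight_trivial; rewrite /attacks /above; lia.
have OE : O (flip u s) = O s.
  apply: eq_bigr => x xu; apply: eq_bigr => y /andP[_ yu].
  by rewrite !pair_factorE !ffunE (negbTE xu) (negbTE yu).
have lo y : (av <= (s y).2)%N -> superI (s u) (s y) = false /\ superI (flip u s u) (flip u s y).
  by move=> h; rewrite !superIE !flip_abs su pos ffunE eqxx pos /= h orbT; split=> //; lia.
have hi x : x != u -> (av < (s x).2)%N -> superI (s x) (s u) /\ superI (flip u s x) (flip u s u) = false.
  move=> xu h; rewrite !superIE !ffunE (negbTE xu) eqxx su pos /=.
  by case: (s x).1 => /=; split=> //; lia.
have left1 : \prod_(y | mask u y) pair_factor s u y = 1.
  apply: big1 => y _; rewrite pair_factorE; case: ifP => // h.
  apply: cell_weight_trivial; apply: contraTN h => h.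
    by have [|->] := lo y _; rewrite // ge_av // -ru; move: h; rewrite /attacks; lia.
  by have [|->] := lo y _; rewrite // ge_av // -ru; move: h; rewrite /above; lia.
have left2 : \prod_(y | mask u y) pair_factor (flip u s) u y = \prod_(y | mask u y) cell_weight u y.
  apply: eq_bigr => y _; rewrite pair_factorE; case: ifP => // /negbT h.
  apply/esym/cell_weight_trivial; apply: contraNN h => h.
    by have [|_ ->] := lo y _; rewrite // ge_av // -ru; move: h; rewrite /attacks; lia.
  by have [|_ ->] := lo y _; rewrite // ge_av // -ru; move: h; rewrite /above; lia.
have gt x : mask x u -> attacks x u || above x u -> (av < (s x).2)%N.
  move=> m h; have [e|e] : row x = R /\ (col u < col x)%N \/ row x = R.+1.
  - by rewrite -ru; move: h; rewrite /attacks /above; lia.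
  - by case: e => e1 e2; apply: gt_av.
  exact: gt_av1.
have right1 : \prod_(x | mask x u && (x != u)) pair_factor s x u =
    \prod_(x | mask x u) cell_weight x u.
  rewrite [RHS](bigID (fun x => x != u)) /= [X in _ * X]big1 ?mulr1.
    apply: eq_bigr => x /andP[m xu]; rewrite pair_factorE; case: ifP => // /negbT h.
    apply/esym/cell_weight_trivial; apply: contraNN h => h.
      by have [|->] := hi x xu _; rewrite // gt // h.
    by have [|->] := hi x xu _; rewrite // gt // h orbT.
  by move=> x /andP[_ /negPn/eqP->].
have right2 : \prod_(x | mask x u && (x != u)) pair_factor (flip u s) x u = 1.
  apply: big1 => x /andP[m xu]; rewrite pair_factorE; case: ifP => // h.
  apply: cell_weight_trivial; apply: contraTN h => h.
    by have [|_ ->] := hi x xu _; rewrite // gt // h.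
  by have [|_ ->] := hi x xu _; rewrite // gt // h orbT.
rewrite /signed_weight !split OE left1 left2 right1 right2 bal mulr1 mul1r.
rewrite (bigD1 u) //= [in RHS](bigD1 u) //= /letter_sign ffunE eqxx pos /=.
rewrite (_ : \prod_(i | i != u) _ = \prod_(i | i != u) (if (s i).1 then -1 else qq)); last first.
  by apply: eq_bigr => c cu; rewrite ffunE (negbTE cu).
ring.
Qed.

Lemma prod_cell_weight_left (m : pred V) u b : above u b -> m b ->
  \prod_(y | m y) cell_weight u y =
  tt ^+ #|[set y | m y && attacks u y]| * (qq ^+ leg1 u / tt ^+ arm b).
Proof.
move=> ub mb; rewrite (bigD1 b) //= mulrC; congr (_ * _); last first.
  rewrite /cell_weight ub ifF //; apply/negbTE; move: ub.
  by rewrite /attacks /above; lia.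
rewrite -prodr_const big_mkcond /= [RHS]big_mkcond /=; apply: eq_bigr => y _.
rewrite inE; case: (m y) => //=; rewrite /cell_weight.
have [->|yb] := eqVneq y b.
  by rewrite /= ifF //; apply/negbTE; move: ub; rewrite /attacks /above; lia.
case: ifP => //= _; rewrite ifF //; apply: contraNF yb => h.
by rewrite (above_injr h ub).
Qed.

Lemma prod_cell_weight_right (m : pred V) u b : above b u -> m b ->
  \prod_(x | m x) cell_weight x u =
  tt ^+ #|[set x | m x && attacks x u]| * (qq ^+ leg1 b / tt ^+ arm u).
Proof.
move=> ub mb; rewrite (bigD1 b) //= mulrC; congr (_ * _); last first.
  rewrite /cell_weight ub ifF //; apply/negbTE; move: ub.
  by rewrite /attacks /above; lia.
rewrite -prodr_const big_mkcond /= [RHS]big_mkcond /=; apply: eq_bigr => y _.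
rewrite inE; case: (m y) => //=; rewrite /cell_weight.
have [->|yb] := eqVneq y b.
  by rewrite /= ifF //; apply/negbTE; move: ub; rewrite /attacks /above; lia.
case: ifP => //= _; rewrite ifF //; apply: contraNF yb => h.
by rewrite (above_injl h ub).
Qed.

Lemma prod_cell_weight_top (m : pred V) u : (forall b, ~~ above b u) ->
  \prod_(x | m x) cell_weight x u = tt ^+ #|[set x | m x && attacks x u]|.
Proof.
move=> nu; rewrite -prodr_const big_mkcond /= [RHS]big_mkcond /=; apply: eq_bigr => y _.
by rewrite inE; case: (m y) => //=; rewrite /cell_weight (negbTE (nu y)).
Qed.

(** The cells attacked in the row below number [arm b], which cancels the denominator of the
    vertical weight. *)
Lemma card_attacks_below (m : pred V) u b : above u b ->
  (forall y, row y = row b -> m y) ->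
  #|[set y | m y && attacks u y]| =
  (#|[set y | m y && ((row y == row u) && (col y < col u)%N)]| + arm b)%N.
Proof.
move=> /andP[/eqP r1 /eqP c1] mb; rewrite /arm -[RHS]cardUI.
rewrite [X in (_ + X)%N](_ : _ = 0%N) ?addn0; last first.
  by apply: eq_card0 => y; rewrite !inE; lia.
apply: eq_card => y; rewrite !inE /attacks.
have : (row y == row b) ==> m y by apply/implyP => /eqP /mb.
by rewrite r1; lia.
Qed.

(** After the arms cancel, the cells to the left of [u] in its row stand against those to the left
    in the row above. Columns further left are at least as high, so the counts agree; the legs
    differ by 1, which gives [qq]. *)
Lemma balance_tall u : (0 < row u)%N -> ((row u).+1 < ht (col u))%N ->
  \prod_y cell_weight u y = qq * \prod_x cell_weight x u.
Proof.
move=> r0 hu; have [b ub] := below_exists r0.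
have [|d rd cd] := @cell_exists la (row u).+1 (col u); first by rewrite /is_cell col_lt.
have du : above d u by rewrite /above rd cd !eqxx.
rewrite (prod_cell_weight_left (m := predT) ub) // (prod_cell_weight_right (m := predT) du) //.
rewrite (card_attacks_below (m := predT) ub) //.
have -> : #|[set x | predT x && attacks x u]| =
    (#|[set x | (row x == (row u).+1) && (col x < col u)%N]| + arm u)%N.
  rewrite /arm -[RHS]cardUI [X in (_ + X)%N](_ : _ = 0%N) ?addn0; last first.
    by apply: eq_card0 => y; rewrite !inE; lia.
  by apply: eq_card => y; rewrite !inE /attacks /=; lia.
have -> : #|[set y | predT y && ((row y == row u) && (col y < col u)%N)]| =
    #|[set x | (row x == (row u).+1) && (col x < col u)%N]|.
  rewrite (card_row la (row u).+1 (fun k => k < col u)%N).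
  rewrite -[LHS]/#|[set y | (row y == row u) && (fun k => k < col u)%N (col y)]| card_row.
  apply: eq_card => i; rewrite !inE; case: (ltnP i (col u)); rewrite ?andbF //= => lt.
  by have := nth_partition_mono laP (ltnW lt); lia.
have -> : leg1 u = (leg1 d).+1 by rewrite /leg1 rd cd; lia.
by rewrite !exprD exprS !mulKdiv ?expf_neq0 ?tt_neq0 // mulrCA.
Qed.

(** All cells to the right of [u] in its row lie in [B]. To the left, only higher columns remain
    outside [B], and these are the columns with a cell attacking [u] from the row above. *)
Lemma balance_top u R : (0 < R)%N -> row u = R -> ht (col u) = R.+1 ->
  let B := [set c | (row c == R) && (ht (col c) == R.+1)] in
  \prod_(y | ~~ ((u \in B) && (y \in B))) cell_weight u y =
  qq * \prod_(x | ~~ ((x \in B) && (u \in B))) cell_weight x u.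
Proof.
move=> R0 ru hu B; have uB : u \in B by rewrite inE ru hu !eqxx.
have [b ub] : exists b, above u b by apply: below_exists; rewrite ru.
have rb : R = (row b).+1 by rewrite -ru; move: ub => /andP[/eqP].
rewrite (prod_cell_weight_left ub); last by rewrite uB inE; lia.
rewrite prod_cell_weight_top; last first.
  move=> d; apply/negP => /andP[/eqP rd /eqP cd]; have := row_lt d.
  by rewrite rd cd hu ru ltnn.
rewrite (card_attacks_below ub); last by move=> y ry; rewrite !inE; lia.
have -> : leg1 u = 1%N by rewrite /leg1 ru hu; lia.
rewrite (_ : #|[set y | _ && ((row y == row u) && _)]| = #|[set x | ~~ ((x \in B) && (u \in B)) && attacks x u]|).
  by rewrite exprD expr1 mulKdiv ?expf_neq0 ?tt_neq0 // mulrC.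
transitivity #|[set i : 'I_(size la) | (R.+1 < ht i)%N && (i < col u)%N]|.
  pose P k := (k < col u)%N && (ht k != R.+1).
  transitivity #|[set c : V | (row c == R) && P (col c)]|.
    by apply: eq_card => y; rewrite !inE ru hu !eqxx /P /=; lia.
  rewrite card_row; apply: eq_card => i; rewrite !inE /P.
  by rewrite andbA andbAC; congr (_ && _); rewrite [in RHS]ltn_neqAle andbC eq_sym.
rewrite -(card_row la R.+1 (fun k => k < col u)%N).
apply: eq_card => x; rewrite !inE ru /attacks hu !eqxx ru /=.
have := row_lt x; have [le|gt] := leqP (col u) (col x).
  by have := nth_partition_mono laP le; rewrite hu; lia.
lia.
Qed.

End Flip.

(** * Cancellation in one row *)

Lemma sum_words_indicator (L : eqType) (R : comNzRingType) (ls : seq L) n (w0 : seq L) :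
  uniq ls -> size w0 = n -> {subset w0 <= ls} ->
  sum_words ls n (fun w => (w0 == w)%:R) = 1 :> R.
Proof.
move=> uls; elim: n w0 => [|n IH] w0 sz sub /=; first by rewrite (size0nil sz) eqxx.
case/lastP: w0 sz sub => [//|w0 c0]; rewrite size_rcons => -[sz] sub.
have c0ls : c0 \in ls by apply: sub; rewrite mem_rcons mem_head.
have sub' : {subset w0 <= ls} by move=> x xw; apply: sub; rewrite mem_rcons inE xw orbT.
rewrite (bigD1_seq c0) //= -[RHS](IH w0 sz sub') -[RHS]addr0; congr (_ + _).
  by apply: eq_sum_words => w _ _; rewrite eqseq_rcons eqxx andbT.
rewrite big1 // => c cc0; rewrite -[RHS](sum_words0 R ls n); apply: eq_sum_words => w _ _.
by rewrite eqseq_rcons [c0 == c]eq_sym (negbTE cc0) andbF.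
Qed.

Lemma sum_by_word (L : eqType) (R : comNzRingType) (T : finType) (ls : seq L) n
    (word : T -> seq L) (phi : seq L -> R) (h : T -> R) :
  uniq ls -> (forall s, size (word s) = n) ->
  (forall s, h s != 0 -> {subset word s <= ls}) ->
  \sum_s phi (word s) * h s =
  sum_words ls n (fun w => phi w * \sum_(s | word s == w) h s).
Proof.
move=> uls sz sub.
transitivity (\sum_s sum_words ls n (fun w => (word s == w)%:R * (phi w * h s))).
  apply: eq_bigr => s _; have [->|hs] := eqVneq (h s) 0.
    rewrite mulr0 -[LHS](sum_words0 R ls n); apply: eq_sum_words => w _ _.
    by rewrite !mulr0.
  have h1 := @sum_words_indicator _ R ls n (word s) uls (sz s) (sub s hs).
  rewrite -[LHS]mulr1 -[X in _ * X = _]h1.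
  rewrite sum_words_distrr; apply: eq_sum_words => w _ _.
  by case: eqP => [->|_]; [rewrite mulrC | rewrite /= mulr0 mul0r].
rewrite sum_words_sum; apply: eq_sum_words => w _ _.
rewrite big_distrr [RHS]big_mkcond /=; apply: eq_bigr => s _.
by case: eqP => _; rewrite ?mul1r ?mul0r.
Qed.

Lemma prod_pair_factor_row (la : seq nat) n (s : sfilling la n) (l : seq (dg la)) :
  pairwise (fun b c => (cell_row b == cell_row c) && (cell_col b < cell_col c)%N) l ->
  \prod_(x <- l) \prod_(y <- l) pair_factor s x y = tt ^+ coinv (@superI n) (map s l).
Proof.
elim: l => [|b l IH] /=; first by rewrite big_nil.
case/andP => /allP hb /IH {}IH; rewrite !big_cons.
have triv x y : ~~ attacks x y -> ~~ above x y -> pair_factor s x y = 1.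
  by move=> h1 h2; rewrite pair_factorE cell_weight_trivial // if_same.
rewrite triv; try by rewrite /attacks /above; lia.
rewrite big_seq big1 ?mul1r => [|y /hb]; last first.
  by move=> h; apply: triv; move: h; rewrite /attacks /above; lia.
under eq_bigr do rewrite big_cons.
rewrite big_split /= IH exprD; congr (_ * _).
rewrite count_map -sum1_count expr_sum [RHS]big_mkcond /=; apply: eq_big_seq => x /hb h.
rewrite pair_factorE /=; case: ifP => // _; rewrite expr1 /cell_weight ifT //.
by move: h; rewrite /attacks; lia.
Qed.

Section Block.
Variables (la : seq nat) (n : nat).
Hypothesis laP : is_partition la.
Local Notation V := (dg la).
Local Notation row := (@cell_row la).
Local Notation col := (@cell_col la).
Local Notation ht := (nth 0%N la).
Implicit Types (x y c u : V) (s : sfilling la n).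

(** [om] will be the indicator of a set of fillings times a monomial coefficient; both ignore signs
    and the order of the entries within a row. *)
Variables (av : 'I_n) (R : nat) (om : sfilling la n -> Kqt).
Hypothesis R0 : (0 < R)%N.
Hypothesis om_flip : forall u s, om (flip u s) = om s.
Hypothesis om_row : forall (p : V -> V) s, injective p -> (forall c, row (p c) = row c) ->
  om [ffun c => s (p c)] = om s.
Hypothesis om_ge : forall s c, om s != 0 -> (R <= (row c).+1)%N -> (av <= (s c).2)%N.
Hypothesis om_ne : forall s c, om s != 0 -> (R < row c)%N -> (s c).2 != av.

Definition block : {set V} := [set c | (row c == R) && (ht (col c) == R.+1)].

Let om_gt s c : om s != 0 -> (R < row c)%N -> (av < (s c).2)%N.
Proof.
move=> h rc; rewrite ltn_neqAle om_ge //; last by apply: leq_trans (ltnW rc) _.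
by rewrite andbT eq_sym; apply: om_ne.
Qed.

Lemma signed_weight_flip_block u s : u \in block -> (s u).2 = av -> om s != 0 ->
  signed_weight block (flip u s) = - signed_weight block s.
Proof.
move=> uB su os; have := uB; rewrite inE => /andP[/eqP ru /eqP hu].
apply: (signed_weight_flip laP ru su).
- by move=> y hy; apply: om_ge => //; lia.
- by move=> x rx; apply: om_gt => //; rewrite rx.
- move=> x rx cx; rewrite uB andbT inE rx eqxx /= => hx.
  have := nth_partition_mono laP (ltnW cx); have := row_lt x; rewrite rx hu; lia.
exact: balance_top.
Qed.

Lemma signed_weight_flip_tall u s : row u = R -> (R.+1 < ht (col u))%N ->
  (s u).2 = av -> om s != 0 ->
  (forall x, row x = R -> (col u < col x)%N -> (s x).2 != av) ->
  signed_weight set0 (flip u s) = - signed_weight set0 s.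
Proof.
move=> ru hu su os last_u; apply: (signed_weight_flip laP ru su).
- by move=> y hy; apply: om_ge => //; lia.
- by move=> x rx; apply: om_gt => //; rewrite rx.
- move=> x rx cx _; rewrite ltn_neqAle om_ge ?rx // andbT eq_sym.
  exact: last_u.
transitivity (\prod_y cell_weight u y); first by apply: eq_bigl => y; rewrite !inE.
rewrite balance_tall // ?ru //; congr (_ * _).
by apply: eq_bigl => x; rewrite !inE.
Qed.

Definition has_abs s c := (row c == R) && ((s c).2 == av).

(** With no [av] in the block, the rightmost one in row [R] has a cell above it. Flipping preserves
    absolute values, hence the choice of this cell, so it is an involution. *)
Lemma row_cancel_tall :
  \sum_(s | [exists c, has_abs s c] && ~~ [exists c in block, (s c).2 == av])
     om s * signed_weight set0 s = 0.
Proof.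
pose last_abs s c := has_abs s c && [forall d, has_abs s d ==> (col d <= col c)%N].
pose phi s := if [pick c | last_abs s c] is Some u then flip u s else s.
have hasE u s c : has_abs (flip u s) c = has_abs s c by rewrite /has_abs flip_abs.
have lastE u s : last_abs (flip u s) =1 last_abs s.
  by move=> c; rewrite /last_abs hasE; congr (_ && _); apply: eq_forallb => d; rewrite hasE.
have phiK : involutive phi.
  move=> s; rewrite {2}/phi; case: pickP => [u hu|h0]; last by rewrite /phi; case: pickP => // u; rewrite h0.
  rewrite /phi (eq_pick (lastE u s)); case: pickP => [u' hu'|/(_ u)]; last by rewrite hu.
  suff -> : u' = u by rewrite flipK.
  move: hu hu' => /andP[/andP[/eqP r1 e1] /forallP f1] /andP[/andP[/eqP r2 e2] /forallP f2].
  have := f1 u'; have := f2 u; rewrite /has_abs r1 r2 eqxx e1 e2 /= => h1 h2.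
  by apply: cell_inj; rewrite ?r1 ?r2 //; lia.
have phiP s : [exists c, has_abs s c] -> exists2 u, last_abs s u & phi s = flip u s.
  case/existsP => c0 hc0; case: (arg_maxnP (fun c => col c) hc0) => u hu mu.
  have lu : last_abs s u by rewrite /last_abs hu; apply/forallP => d; apply/implyP; apply: mu.
  rewrite /phi; case: pickP => [u' hu'|/(_ u)]; last by rewrite lu.
  by exists u'.
set Z := \sum_(s | _) _.
suff ZN : Z = - Z.
  apply: (mulfI (Kqt_natr_neq0 1)); rewrite mulr0 mulr_natl mulr2n {1}ZN addNr //.
rewrite {1}/Z (reindex_inj (inv_inj phiK)) /= -sumrN.
have absE s c : (phi s c).2 = (s c).2.
  by rewrite /phi; case: pickP => // u _; rewrite flip_abs.
apply: eq_big => [s|s].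
  congr (_ && ~~ _); first by apply: eq_existsb => c; rewrite /has_abs absE.
  by apply: eq_existsb => c; rewrite absE.
move=> /andP[h1 h2].
have h1' : [exists c, has_abs s c].
  by case/existsP: h1 => c hc; apply/existsP; exists c; rewrite /has_abs -absE.
have [u /andP[/andP[/eqP ru /eqP su] /forallP mu] ->] := phiP s h1'.
rewrite om_flip; have [->|os] := eqVneq (om s) 0; first by rewrite !mul0r oppr0.
rewrite signed_weight_flip_tall ?mulrN //.
  have hr := row_lt u; rewrite ru in hr.
  rewrite ltn_neqAle hr andbT; apply: contraNneq h2 => e.
  apply/existsP; exists u; rewrite inE ru eqxx -e eqxx /= absE su eqxx //.
move=> x rx cx; apply: contraTneq cx => sx; rewrite -leqNgt.
by have := mu x; rewrite /has_abs rx sx !eqxx.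
Qed.

(** * Two adjacent columns with top cells in the block *)

Section Columns.
Variable j : nat.
Hypothesis jsize : (j.+1 < size la)%N.
Hypothesis htj : ht j = R.+1.
Hypothesis htj1 : ht j.+1 = R.+1.
Local Notation in_pair := (in_pair (la := la) j).
Local Notation tau := (tau (la := la) j).
Local Notation swap_row := (swap_row (la := la) (n := n) j).

Definition outer_weight s : Kqt :=
  (\prod_c letter_sign (s c)) *
  \prod_x \prod_(y | ~~ ((x \in block) && (y \in block)) && ~~ (in_pair x && in_pair y))
     pair_factor s x y.

Lemma block_tau k c : (tau k c \in block) = (c \in block).
Proof.
rewrite !inE (row_tau jsize htj htj1) /tau; case: ifP => // _.
have [_ ->] := mirrorP jsize htj htj1 c; rewrite /swap_col.
have [->|_] := eqVneq (col c) j; first by rewrite htj htj1.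
by have [->|_] := eqVneq (col c) j.+1; rewrite ?htj ?htj1.
Qed.

(** No column lies between two adjacent ones, so a cell outside both stands in the same relation to
    either. *)
Lemma cell_weight_tau k x y : ~~ (in_pair x && in_pair y) ->
  cell_weight (tau k x) (tau k y) = cell_weight x y.
Proof.
have tauE c : row (tau k c) = row c /\ (col (tau k c) = col c \/ col (tau k c) = swap_col j (col c)).
  rewrite (row_tau jsize htj htj1); split=> //; rewrite /tau; case: ifP => _; [right|by left].
  by have [] := mirrorP jsize htj htj1 c.
have idE c : ~~ in_pair c -> tau k c = c by apply: (tau_id jsize htj htj1).
have main x' y' : row x' = row x -> row y' = row y ->
   (col x' = col x /\ ~~ in_pair x /\ in_pair y /\ (col y' = col y \/ col y' = swap_col j (col y))) \/
   (col y' = col y /\ ~~ in_pair y /\ in_pair x /\ (col x' = col x \/ col x' = swap_col j (col x))) ->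
   cell_weight x' y' = cell_weight x y.
  move=> rx ry H.
  have ax : attacks x' y' = attacks x y.
    by move: H; rewrite /attacks rx ry /in_pair /swap_col; do ?case: ifP; lia.
  have ab : above x' y' = above x y.
    by move: H; rewrite /above rx ry /in_pair /swap_col; do ?case: ifP; lia.
  have nab : above x y = false.
    by move: H; rewrite /above /in_pair; lia.
  by rewrite /cell_weight ax ab nab.
rewrite negb_and => h.
have [px|px] := boolP (in_pair x); have [py|py] := boolP (in_pair y).
- by move: h; rewrite px py.
- apply: main; rewrite ?(idE y py) //; [by have [] := tauE x | right].
  by have [_ hx] := tauE x.
- apply: main; rewrite ?(idE x px) //; [by have [] := tauE y | left].
  by have [_ hy] := tauE y.
by rewrite !idE.
Qed.

Lemma outer_weight_swap k s : outer_weight (swap_row k s) = outer_weight s.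
Proof.
have ti := inv_inj (tauK jsize htj htj1 k).
rewrite /outer_weight [in RHS](reindex_inj ti) /=; congr (_ * _).
  by apply: eq_bigr => c _; rewrite ffunE.
rewrite [in RHS](reindex_inj ti) /=; apply: eq_bigr => x _.
rewrite [in RHS](reindex_inj ti) /=; apply: eq_big => [y|y /andP[_ h]].
  by rewrite !block_tau !(in_pair_tau jsize htj htj1).
by rewrite !pair_factorE !ffunE cell_weight_tau.
Qed.

(** The interaction of the two top cells is among the omitted block pairs, so the transfers stop
    below row [R]. *)
Lemma signed_weight_transfer s :
  signed_weight block s = outer_weight s * \prod_(k < R) transfer j k s.
Proof.
rewrite /signed_weight /outer_weight -mulrA; congr (_ * _).
transitivity ((\prod_x \prod_(y | ~~ ((x \in block) && (y \in block)) && ~~ (in_pair x && in_pair y))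
     pair_factor s x y) *
   \prod_x \prod_y (if [&& in_pair x, in_pair y, (row y < R)%N &
       (row x == row y) || (row x == (row y).+1)] then pair_factor s x y else 1)).
  rewrite -big_split /=; apply: eq_bigr => x _.
  rewrite (bigID (fun y => in_pair x && in_pair y)) /= mulrC; congr (_ * _).
  rewrite big_mkcond; apply: eq_bigr => y _.
  case: ifP => [/andP[m /andP[px py]]|m]; case: ifP => //.
    rewrite px py /= => h; rewrite pair_factorE; case: ifP => // _.
    have hx : (row x <= R)%N.
      by have := row_lt x; move: px; rewrite /in_pair => /orP[] /eqP->; rewrite ?htj ?htj1 ltnS.
    have hy : (row y <= R)%N.
      by have := row_lt y; move: py; rewrite /in_pair => /orP[] /eqP->; rewrite ?htj ?htj1 ltnS.
    apply: cell_weight_trivial; last by move: h; rewrite /above; lia.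
    apply: contraNN m => at_; have [ex ey] : row x = R /\ row y = R.
      by move: h at_; rewrite /attacks; lia.
    rewrite !inE ex ey !eqxx /=.
    by move: px py; rewrite /in_pair => /orP[] /eqP-> /orP[] /eqP->; rewrite ?htj ?htj1 eqxx.
  move=> /and4P[px py ry h]; move: m; rewrite px py /= andbT => /negbFE /andP[_].
  by rewrite inE => /andP[/eqP e _]; move: ry; rewrite e ltnn.
congr (_ * _); rewrite /transfer.
transitivity (\prod_(k < R) \prod_x \prod_y
   (if [&& in_pair x, in_pair y, row y == k & (row x == k) || (row x == k.+1)]
    then pair_factor s x y else 1)).
  rewrite [RHS]exchange_big /=; apply: eq_bigr => x _.
  rewrite [RHS]exchange_big /=; apply: eq_bigr => y _.
  have [ry|ry] := ltnP (row y) R.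
    rewrite (bigD1 (Ordinal ry)) //= eqxx big1 ?mulr1 // => k.
    rewrite -val_eqE /= eq_sym => /negbTE ->; by rewrite !andbF.
  rewrite !andbF big1 // => k _; case: ifP => // /and4P[_ _ /eqP e _].
  by have := ltn_ord k; rewrite -e ltnNge ry.
apply: eq_bigr => k _; rewrite [RHS]big_mkcond; apply: eq_bigr => x _.
case: ifP => [/andP[px rx]|h].
  rewrite [RHS]big_mkcond; apply: eq_bigr => y _.
  by rewrite px rx andbT.
apply: big1 => y _; case: ifP => // /and4P[px _ _ rx].
by move: h; rewrite px rx.
Qed.

End Columns.

(** * The word of the entries in the block *)

Definition col_lo := count (fun h => R.+1 < h)%N la.
Definition col_hi := count (fun h => R < h)%N la.
Local Notation m := (col_hi - col_lo)%N.
Variable c0 : V.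
Definition cell_at i := odflt c0 [pick c | (row c == R) && (col c == i)].
Definition block_seq := [seq cell_at i | i <- iota col_lo m].
Definition block_word s := map s block_seq.

(** Heights weakly decrease, so the columns of height [R.+1] form this range of indices; the default
    [c0] is never returned there. *)
Lemma cell_atP i : (col_lo <= i < col_hi)%N ->
  [/\ row (cell_at i) = R, col (cell_at i) = i, ht i = R.+1 & (i < size la)%N].
Proof.
move=> /andP[lo hi].
have h1 : (R < ht i)%N by rewrite nth_partition_gt.
have h2 : (R.+1 < ht i)%N = false by rewrite nth_partition_gt // ltnNge lo.
have isz : (i < size la)%N by rewrite ltnNge; apply: contraTN h1 => /(nth_default 0%N) ->.
have [|c e1 e2] := @cell_exists la R i; first by rewrite /is_cell isz.
rewrite /cell_at; case: pickP => [d /andP[/eqP-> /eqP->]|/(_ c)]; last by rewrite e1 e2 !eqxx.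
by split=> //; lia.
Qed.

Let m_range i : i \in iota col_lo m -> (col_lo <= i < col_hi)%N.
Proof. by rewrite mem_iota; lia. Qed.

Lemma mem_block_seq c : (c \in block_seq) = (c \in block).
Proof.
apply/mapP/idP => [[i /m_range /cell_atP[r1 c1 h1 _] ->]|].
  by rewrite inE r1 c1 h1 !eqxx.
rewrite inE => /andP[/eqP rc /eqP hc].
have ci : (col_lo <= col c < col_hi)%N.
  by rewrite leqNgt -!nth_partition_gt // hc; lia.
exists (col c); first by rewrite mem_iota; lia.
by have [r1 c1 _ _] := cell_atP ci; apply: cell_inj; rewrite ?r1 ?c1.
Qed.

(** The block lies in one row: its only interactions are attacks of weight [tt], counted by
    coinversions. *)
Lemma signed_weight_block s :
  signed_weight set0 s = tt ^+ coinv (@superI n) (block_word s) * signed_weight block s.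
Proof.
rewrite /signed_weight mulrCA; congr (_ * _).
have pw : pairwise (fun b c => (row b == row c) && (col b < col c)%N) block_seq.
  rewrite pairwise_map; apply: (@sub_in_pairwise _ (mem (iota col_lo m)) ltn).
  - move=> a b /m_range /cell_atP[r1 c1 _ _] /m_range /cell_atP[r2 c2 _ _] /= ab.
    by rewrite r1 r2 c1 c2 eqxx.
  - by apply/allP.
  - by rewrite -sorted_pairwise ?iota_ltn_sorted //; apply: ltn_trans.
have bu : uniq block_seq.
  apply: pairwise_uniq pw => b; by rewrite ltnn andbF.
have pairE (F : V -> Kqt) : \prod_(x <- block_seq) F x = \prod_(x in block) F x.
  by rewrite (big_uniq _ bu) /=; apply: eq_bigl => x; rewrite mem_block_seq.
rewrite -prod_pair_factor_row // pairE.
under [X in _ = X * _]eq_bigr do rewrite pairE.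
rewrite [X in _ = X * _]big_mkcond -big_split /=; apply: eq_bigr => x _.
transitivity (\prod_y pair_factor s x y); first by apply: eq_bigl => y; rewrite !inE.
case: (x \in block) => /=; last by rewrite mul1r.
by rewrite (bigID (mem block)).
Qed.

Definition word_weight w := \sum_(s | block_word s == w) om s * signed_weight block s.

Lemma size_block_word s : size (block_word s) = m.
Proof. by rewrite !size_map size_iota. Qed.

(** The outer weight does not see the exchange of the two columns, and [row_exchange] in row [R]
    handles the transfers. Words of the wrong length have weight 0. *)
Lemma word_weight_exchange : exchangeable word_weight.
Proof.
move=> u x y v.
have [sz|sz] := eqVneq (size (u ++ x :: y :: v)) m; last first.
  have sz' : size (u ++ y :: x :: v) != m by move: sz; rewrite !size_cat.
  rewrite /word_weight [LHS]big_pred0 => [|s]; last first.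
    by apply: contraNF sz => /eqP <-; rewrite size_block_word.
  rewrite big_pred0 // => s.
  by apply: contraNF sz' => /eqP <-; rewrite size_block_word.
have [U eU] : {U | size u = U} by exists (size u).
have [W eW] : {W | size v = W} by exists (size v).
move: sz; rewrite size_cat /= eU eW => sz.
set j := (col_lo + U)%N.
have [r0 cj htj js] : [/\ row (cell_at j) = R, col (cell_at j) = j, ht j = R.+1 & (j < size la)%N].
  by apply: cell_atP; rewrite /j; lia.
have [r1 cj1 htj1 jsize] : [/\ row (cell_at j.+1) = R, col (cell_at j.+1) = j.+1,
    ht j.+1 = R.+1 & (j.+1 < size la)%N].
  by apply: cell_atP; rewrite /j; lia.
have iotaE : iota col_lo m = iota col_lo U ++ j :: j.+1 :: iota j.+2 W.
  by rewrite -sz iotaD.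
have swapE s k : (col_lo <= k < col_hi)%N ->
    swap_row (la := la) j R s (cell_at k) = s (cell_at (swap_col j k)).
  move=> hk; rewrite ffunE /tau; have [rk ck hh _] := cell_atP hk; rewrite rk eqxx; congr (s _).
  have [rm cm] := mirrorP jsize htj htj1 (cell_at k).
  have hk' : (col_lo <= swap_col j k < col_hi)%N.
    by rewrite /swap_col /j; do ?case: ifP; lia.
  have [rk' ck' _ _] := cell_atP hk'.
  by apply: cell_inj; rewrite ?rm ?cm ?rk ?ck ?rk' ?ck'.
have swap_word s : (block_word (swap_row (la := la) j R s) == u ++ x :: y :: v) =
                   (block_word s == u ++ y :: x :: v).
  have e1 : [seq swap_row (la := la) j R s (cell_at k) | k <- iota col_lo U] =
            [seq s (cell_at k) | k <- iota col_lo U].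
    apply/eq_in_map => k; rewrite mem_iota => hk; rewrite swapE; last by lia.
    by rewrite /swap_col /j !ifF //; lia.
  have e2 : [seq swap_row (la := la) j R s (cell_at k) | k <- iota j.+2 W] =
            [seq s (cell_at k) | k <- iota j.+2 W].
    apply/eq_in_map => k; rewrite mem_iota /j => hk; rewrite swapE; last by lia.
    by rewrite /swap_col /j !ifF //; lia.
  rewrite /block_word /block_seq -!map_comp iotaE !map_cat /=.
  rewrite !eqseq_cat ?size_map ?size_iota ?eU // -[map _ (iota col_lo _)]/[seq swap_row (la := la) j R s (cell_at k) | k <- iota col_lo U] e1.
  rewrite !eqseq_cons !swapE /=; try by rewrite /j; lia.
  rewrite -[map _ (iota j.+2 _)]/[seq swap_row (la := la) j R s (cell_at k) | k <- iota j.+2 W] e2.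
  rewrite /swap_col eqxx (_ : (j.+1 == j) = false) ?eqxx; last by lia.
  by congr (_ && _); rewrite andbCA.
have tw := signed_weight_transfer jsize htj htj1.
have omS k s : om (swap_row (la := la) j k s) = om s.
  apply: om_row; first exact: inv_inj (tauK jsize htj htj1 k).
  exact: row_tau jsize htj htj1 k.
pose Psi s := if block_word s == u ++ x :: y :: v then om s * outer_weight j s else 0.
have H := @row_exchange la n j R jsize htj htj1 R Psi (leqnn R).
rewrite /word_weight [LHS]big_mkcond [RHS]big_mkcond /=.
transitivity (\sum_s Psi s * \prod_(k < R) transfer j k s).
  by apply: eq_bigr => s _; rewrite /Psi; case: ifP; rewrite ?mul0r // tw mulrA.
rewrite H.
  apply: eq_bigr => s _; rewrite /Psi swap_word omS outer_weight_swap //.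
  by case: ifP; rewrite ?mul0r // tw mulrA.
move=> k s kR; rewrite /Psi omS outer_weight_swap //.
suff -> : block_word (swap_row (la := la) j k s) = block_word s by [].
apply/eq_in_map => c; rewrite mem_block_seq inE => /andP[/eqP rc _].
by rewrite ffunE /tau rc ifF //; lia.
Qed.

Lemma word_weight_flip (u v : seq (bool * 'I_n)) :
  word_weight (u ++ (true, av) :: v) = - word_weight (u ++ (false, av) :: v).
Proof.
have [sz|sz] := eqVneq (size (u ++ (false, av) :: v)) m; last first.
  have sz' : size (u ++ (true, av) :: v) != m by move: sz; rewrite !size_cat.
  rewrite /word_weight [LHS]big_pred0 => [|s]; last first.
    by apply: contraNF sz' => /eqP <-; rewrite size_block_word.
  rewrite big_pred0 ?oppr0 // => s.
  by apply: contraNF sz => /eqP <-; rewrite size_block_word.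
have [U eU] : {U | size u = U} by exists (size u).
have [W eW] : {W | size v = W} by exists (size v).
move: sz; rewrite size_cat /= eU eW => sz.
set j := (col_lo + U)%N; set b := cell_at j.
have hj : (col_lo <= j < col_hi)%N by rewrite /j; lia.
have iotaE : iota col_lo m = iota col_lo U ++ j :: iota j.+1 W.
  by rewrite -sz iotaD.
have bB : b \in block by rewrite -mem_block_seq; apply: map_f; rewrite mem_iota; lia.
have flE s k : (col_lo <= k < col_hi)%N -> k != j -> flip b s (cell_at k) = s (cell_at k).
  move=> hk kj; rewrite ffunE ifF //; apply: contraNF kj => /eqP e.
  by have [_ <- _ _] := cell_atP hk; rewrite e; have [_ -> _ _] := cell_atP hj.
have flip_word s : (block_word (flip b s) == u ++ (true, av) :: v) =
                   (block_word s == u ++ (false, av) :: v).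
  have e1 : [seq flip b s (cell_at k) | k <- iota col_lo U] =
            [seq s (cell_at k) | k <- iota col_lo U].
    by apply/eq_in_map => k; rewrite mem_iota => hk; rewrite flE //; lia.
  have e2 : [seq flip b s (cell_at k) | k <- iota j.+1 W] =
            [seq s (cell_at k) | k <- iota j.+1 W].
    by apply/eq_in_map => k; rewrite mem_iota => hk; rewrite flE //; lia.
  rewrite /block_word /block_seq -!map_comp iotaE !map_cat /=.
  rewrite !eqseq_cat ?size_map ?size_iota ?eU // -[map _ (iota col_lo _)]/[seq flip b s (cell_at k) | k <- iota col_lo U] e1.
  rewrite !eqseq_cons -[map _ (iota j.+1 _)]/[seq flip b s (cell_at k) | k <- iota j.+1 W] e2.
  congr (_ && (_ && _)); rewrite ffunE eqxx -/b.
  by case: (s b) => [[] i]; rewrite !xpair_eqE.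
rewrite /word_weight (reindex_inj (inv_inj (flipK b))) /= -sumrN.
apply: eq_big => [s|s]; first exact: flip_word.
rewrite flip_word => /eqP e; rewrite om_flip.
have [->|os] := eqVneq (om s) 0; first by rewrite !mul0r oppr0.
rewrite signed_weight_flip_block ?mulrN //.
have : nth (true, av) (block_word s) U = (false, av) by rewrite e nth_cat eU ltnn subnn.
rewrite (nth_map c0); last by rewrite size_map size_iota; lia.
rewrite (nth_map 0%N) ?size_iota ?nth_iota; try by lia.
by rewrite -/j -/b => ->.
Qed.

(** Grouping by block word leaves [sum_words_cancel] for the two letters of absolute value [av],
    extremal among the letters allowed in row [R]. *)
Lemma row_cancel_block :
  \sum_(s : sfilling la n | [exists c in block, (s c).2 == av]) om s * signed_weight set0 s = 0.
Proof.
pose a : bool * 'I_n := (false, av); pose A : bool * 'I_n := (true, av).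
pose os := [seq e : bool * 'I_n <- enum {: bool * 'I_n} | (av < e.2)%N].
have memls (e : bool * 'I_n) : (e \in [:: a, A & os]) = (av <= e.2)%N.
  rewrite !inE mem_filter mem_enum andbT [RHS]leq_eqVlt orbA; congr (_ || _).
  by case: e => [[] i]; rewrite !xpair_eqE /= ?orbF val_eqE eq_sym.
have uls : uniq [:: a, A & os].
  apply/and3P; split; rewrite ?inE ?mem_filter /= ?ltnn //; last exact: filter_uniq (enum_uniq _).
have extE (e : bool * 'I_n) : extremal a A e = (e.2 == av).
  by rewrite /extremal; case: e => [[] i]; rewrite !xpair_eqE /= ?orbF.
transitivity (\sum_s (if has (extremal a A) (block_word s)
   then tt ^+ coinv (@superI n) (block_word s) else 0) * (om s * signed_weight block s)).
  rewrite big_mkcond /=; apply: eq_bigr => s _.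
  have -> : has (extremal a A) (block_word s) = [exists c in block, (s c).2 == av].
    rewrite has_map; apply/hasP/existsP => [[c cB /= h]|[c /andP[cB h]]]; exists c.
    - by rewrite -mem_block_seq cB -extE.
    - by rewrite mem_block_seq.
    - by rewrite /= extE.
  by case: ifP; rewrite ?mul0r // signed_weight_block mulrCA.
rewrite (@sum_by_word _ _ _ [:: a, A & os] m block_word (fun w => if has (extremal a A) w
   then tt ^+ coinv (@superI n) w else 0) (fun s => om s * signed_weight block s)) //.
- rewrite -[RHS](@sum_words_cancel _ (@superI n) _ tt tt^-1 _ a A os _ _ _ _ m word_weight).
  + apply: eq_sum_words => w _ _; case: ifP => _; by rewrite ?mul0r.
  + by rewrite mulfV // tt_neq0.
  + by [].
  + move=> e; rewrite mem_filter => /andP[h _].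
    rewrite !superIE /=; case: e h => [[] i] /= h; split=> //; rewrite ?xpair_eqE /= -?val_eqE /=; lia.
  + by move=> e; rewrite memls superIE /= => h; lia.
  + by move=> e; rewrite memls superIE /= => h; rewrite h orbT.
  + exact: word_weight_exchange.
  + exact: word_weight_flip.
- exact: size_block_word.
move=> s; rewrite mulf_eq0 negb_or => /andP[os0 _] e /mapP[c].
rewrite mem_block_seq inE => /andP[/eqP rc _] ->; rewrite memls.
by apply: om_ge => //; rewrite rc.
Qed.

End Block.

(** * Restriction to Phi-trivial fillings *)

Section Trivial.
Variables (la : seq nat) (n : nat).
Hypothesis laP : is_partition la.
Local Notation V := (dg la).
Local Notation row := (@cell_row la).
Local Notation col := (@cell_col la).
Implicit Types (c : V) (s : sfilling la n).

Lemma signed_weightE s :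
  (-1) ^+ nneg s * qq ^+ (npos s + maj s) * tt ^+ quinv s = signed_weight set0 s.
Proof.
have -> : signed_weight set0 s =
    (\prod_c letter_sign (s c)) * pair_weight (@superI n) (@cell_weight1 la) s.
  congr (_ * _); apply: eq_bigr => x _; apply: eq_big => y; first by rewrite !inE.
  by [].
rewrite -weight_pair_weight exprD !mulrA; congr (_ * _ * _).
rewrite (bigID (fun c => (s c).1)) /= /nneg /npos -!prodr_const; congr (_ * _).
  by apply: eq_big => c; rewrite ?inE // /letter_sign => ->.
by apply: eq_big => c; rewrite ?inE // /letter_sign => /negbTE ->.
Qed.

Lemma row_cancel (av : 'I_n) R (om : sfilling la n -> Kqt) :
  (0 < R)%N -> (forall u s, om (flip u s) = om s) ->
  (forall (p : V -> V) s, injective p -> (forall c, row (p c) = row c) ->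
     om [ffun c => s (p c)] = om s) ->
  (forall s c, om s != 0 -> (R <= (row c).+1)%N -> (av <= (s c).2)%N) ->
  (forall s c, om s != 0 -> (R < row c)%N -> (s c).2 != av) ->
  \sum_(s | [exists c, has_abs av R s c]) om s * signed_weight set0 s = 0.
Proof.
move=> R0 omf omr omg omn.
rewrite (bigID (fun s => [exists c in block la R, (s c).2 == av])) /=.
rewrite (row_cancel_tall laP R0 omf omg omn) addr0.
rewrite (eq_bigl (fun s => [exists c in block la R, (s c).2 == av])); last first.
  move=> s; apply: andb_idl => /existsP[c /andP[]]; rewrite inE => /andP[rc _] sc.
  by apply/existsP; exists c; rewrite /has_abs rc.
have [b0|[c0 _]] := set_0Vmem (block la R); last first.
  exact: (row_cancel_block laP R0 omf omr omg omn c0).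
rewrite big_pred0 // => s; apply/existsP => -[c].
by rewrite b0 in_set0.
Qed.

(** Interpolates between no condition, at [a = 0], and Phi-triviality, once [a] reaches every row;
    rows and values are counted from 0. *)
Definition bounded_below a s := [forall c : V, (minn (row c) a <= (s c).2)%N].

Lemma truncation_step (m : 'X_{1..n}) a :
  \sum_(s | bounded_below a s) (xmon s)@_m * signed_weight set0 s =
  \sum_(s | bounded_below a.+1 s) (xmon s)@_m * signed_weight set0 s.
Proof.
have [na|an] := leqP n a.
  apply: eq_bigl => s; apply: eq_forallb => c; case: (s c) => _ [v hv] /=; move: (row c) => r; lia.
pose av := Ordinal an.
pose bad s c := (a < row c)%N && ((s c).2 == av).
rewrite (bigID (fun s => [exists c, bad s c])) /= addrC -[RHS]addr0; congr (_ + _).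
  apply: eq_bigl => s; rewrite negb_exists; apply/andP/forallP => [[/forallP h1 /forallP h2] c|h].
    by have := h1 c; have := h2 c; rewrite /bad -val_eqE /=; lia.
  by split; apply/forallP => c; have := h c; rewrite /bad -?val_eqE /=; lia.
pose H := foldr maxn 0%N la.
pose top s : 'I_H.+1 := inord (\max_(c | bad s c) row c).
have rowH c : (row c <= H)%N by apply: ltnW; apply: leq_trans (row_lt c) (ht_max _ _).
rewrite (partition_big top predT) //=; apply: big1 => R _.
(* Since [a < R], entries from row [R - 1] upwards are bounded below by [a], as the flips require.
   Taking one coefficient of [xmon s] makes [om] scalar. *)
pose om s := (bounded_below a s && (a < R)%N &&
   [forall c, (R < row c)%N ==> ((s c).2 != av)])%:R * (xmon s)@_m : Kqt.
have topE s : bounded_below a s && [exists c, bad s c] && (top s == R) =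
    [exists c, has_abs av R s c] && (bounded_below a s && (a < R)%N &&
   [forall c, (R < row c)%N ==> ((s c).2 != av)]).
  have tv : top s = \max_(c | bad s c) row c :> nat.
    by rewrite inordK // ltnS; apply/bigmax_leqP => c _.
  apply/idP/idP.
    move=> /andP[/andP[h1 /existsP[c0 hc0]] /eqP e].
    case: (arg_maxnP (fun c => row c) hc0) => c hc mc.
    have rc : row c = R.
      rewrite -e tv; apply/eqP; rewrite eqn_leq (leq_bigmax_cond _ hc) /=.
      by apply/bigmax_leqP.
    have /andP[ac vc] : bad s c by [].
    rewrite h1 -rc ac /=; apply/andP; split; first by apply/existsP; exists c; rewrite /has_abs eqxx.
    apply/forallP => c'; apply/implyP => lt; apply: contraTN lt => vc'.
    rewrite -leqNgt; have [ac'|] := ltnP a (row c'); first by apply: mc; apply/andP.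
    by move=> /leq_trans; apply; apply: ltnW.
  move=> /andP[/existsP[c /andP[/eqP rc vc]] /andP[/andP[h1 aR] /forallP h2]].
  have bc : bad s c by rewrite /bad rc aR.
  rewrite h1 -val_eqE /= tv eqn_leq; apply/andP; split; first by apply/existsP; exists c.
  apply/andP; split; last by rewrite -rc; apply: leq_bigmax_cond.
  apply/bigmax_leqP => c' /andP[_ vc']; rewrite leqNgt; apply/negP => lt.
  by have := h2 c'; rewrite lt vc'.
rewrite (eq_bigl _ _ topE).
have [aR|Ra] := ltnP a R; last first.
  by rewrite big_pred0 // => s; rewrite andbF /= andbF.
have R0 : (0 < R)%N by apply: leq_ltn_trans aR.
rewrite -[RHS](@row_cancel av R om).
- rewrite big_mkcondr; apply: eq_bigr => s _; rewrite /om aR.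
  by case: ifP => _; rewrite ?mul1r ?mul0r.
- exact: R0.
- move=> u s; rewrite /om; congr (_ * _); last first.
    by congr (mcoeff m _); apply: eq_bigr => c _; rewrite flip_abs.
  congr (1 *+ nat_of_bool (_ && _ && _)).
    by apply: eq_forallb => c; rewrite flip_abs.
  by apply: eq_forallb => c; rewrite flip_abs.
- move=> p s pinj prow; rewrite /om; congr (_ * _); last first.
    congr (mcoeff m _); rewrite [in RHS]/xmon (reindex_inj pinj) /=.
    by apply: eq_bigr => c _; rewrite ffunE.
  congr (1 *+ nat_of_bool (_ && _ && _)); apply/forallP/forallP => h c.
  + by have := h (invF pinj c); rewrite ffunE -prow f_invF.
  + by rewrite ffunE -prow; apply: h.
  + by have := h (invF pinj c); rewrite ffunE -prow f_invF.
  + by rewrite ffunE -prow; apply: h.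
- move=> s c; rewrite /om; case E : (_ && _); last by rewrite mul0r eqxx.
  move=> _ Rc; move: E => /andP[/andP[/forallP h _] _]; have := h c.
  by rewrite /=; lia.
move=> s c; rewrite /om; case E : (_ && _); last by rewrite mul0r eqxx.
move=> _ Rc; move: E => /andP[_ /forallP h]; have := h c.
by rewrite Rc.
Qed.

Lemma trivial_truncation (m : 'X_{1..n}) a :
  \sum_(s | bounded_below a s) (xmon s)@_m * signed_weight set0 s =
  \sum_(s : sfilling la n) (xmon s)@_m * signed_weight set0 s.
Proof.
elim: a => [|a IH]; last by rewrite -truncation_step.
by apply: eq_bigl => s; apply/forallP => c; rewrite minn0.
Qed.

Lemma superSum_all : superSum la n = \sum_(s : sfilling la n) signed_weight set0 s *: xmon s.
Proof.
apply/mpolyP => m; rewrite /superSum !raddf_sum /=.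
transitivity (\sum_(s | bounded_below (foldr maxn 0%N la) s) (xmon s)@_m * signed_weight set0 s).
  apply: eq_big => [s|s _]; last by rewrite mcoeffZ signed_weightE mulrC.
  apply: eq_forallb => c; rewrite (minn_idPl _) //.
  by apply: ltnW; apply: leq_trans (row_lt c) (ht_max _ _).
by rewrite trivial_truncation; apply: eq_bigr => s _; rewrite mcoeffZ mulrC.
Qed.

Lemma mpoly_pair_weight s :
  pair_weight (@superI n) (fun x y => (cell_weight1 x y)%:MP_[n]) s =
  (pair_weight (@superI n) (@cell_weight1 la) s)%:MP.
Proof.
rewrite /pair_weight rmorph_prod; apply: eq_bigr => x _; rewrite rmorph_prod.
apply: eq_bigr => y _; move: (cell_weight1 x y) => r.
by rewrite rmorphD rmorph1 rmorphMn.
Qed.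

Lemma superSum_word_sum : superSum la n =
  word_sum (@superI n) (fun x y : V => (cell_weight1 x y)%:MP_[n])
    (fun e => (letter_sign e)%:MP * 'X_(e.2)).
Proof.
rewrite superSum_all; apply: eq_bigr => s _; rewrite mpoly_pair_weight big_split /=.
rewrite -rmorph_prod /= mulrA -rmorphM /= mul_mpolyC; congr (_ *: _).
rewrite mulrC; congr (_ * _); apply: eq_bigr => x _; apply: eq_big => y //.
by rewrite !inE.
Qed.

Lemma Cla_word_sum : Cla la n =
  word_sum (@superI n) (fun x y : V => (cell_weight1 x y)%:MP_[n])
    (fun e => if e.1 then 0 else 'X_(e.2)).
Proof.
rewrite /Cla big_mkcond; apply: eq_bigr => s _; rewrite mpoly_pair_weight.
case: ifP => [/forallP h|/negbT].
  rewrite weight_pair_weight -mul_mpolyC; congr (_ * _); apply: eq_bigr => c _.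
  by rewrite (negbTE (h c)).
rewrite negb_forall => /existsP[c /negPn h].
by rewrite (bigD1 c) //= h mul0r mulr0.
Qed.

End Trivial.

Lemma plethysm (la : seq nat) : is_partition la ->
  exists P : {mpoly Kqt[sumn la]}, forall n : nat,
   Cla la n = comp_mpoly [tuple psum n i.+1 | i < sumn la] P /\
   superSum la n =
     comp_mpoly [tuple (qq ^+ i.+1 - 1) *: psum n i.+1 | i < sumn la] P.
Proof.
move=> laP; have VD : (#|{: dg la}| <= sumn la)%N by rewrite card_dg.
have [P PE] := superization (@reading_rank_inj la) (@cell_weight1P la) VD.
exists P => n; pose phi : {rmorphism Kqt -> {mpoly Kqt[n]}} := @mpolyC n Kqt.
split.
  rewrite Cla_word_sum.
  have := PE _ phi n (fun e => if e.1 then 0 else 'X_(e.2)); rewrite /superized => ->.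
  apply: eq_mmap => // i; rewrite tnth_mktuple /super_psum /= [X in _ - X]big1 ?subr0 //.
  by move=> k _; rewrite oppr0 expr0n.
rewrite superSum_word_sum //.
have := PE _ phi n (fun e => (letter_sign e)%:MP * 'X_(e.2)); rewrite /superized => ->.
(* The values [qq * x_k] and [- x_k] turn the super power sum into [(qq ^ i - 1) p_i]. *)
have E1 i : \sum_(k < n) (qq%:MP * 'X_k) ^+ i = qq ^+ i *: psum n i.
  rewrite /psum scaler_sumr; apply: eq_bigr => k _.
  by rewrite exprMn -rmorphXn /= mul_mpolyC.
have E2 i : \sum_(k < n) (- ((-1)%:MP * 'X_k)) ^+ i = psum n i.
  by apply: eq_bigr => k _; rewrite mpolyCN mpolyC1 mulN1r opprK.
apply: eq_mmap => // i; rewrite tnth_mktuple scalerBl scale1r.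
by rewrite -E1 -{1}E2.
Qed.

(** * Triangularity *)

Section PowerSumFamily.
Variables (D : nat) (P : {mpoly Kqt[D]}) (f : forall n, {mpoly Kqt[n]}) (c : nat -> Kqt).
Hypothesis fE : forall n, f n = comp_mpoly [tuple c i *: psum n i.+1 | i < D] P.

(** A polynomial in power sums sees only the power sums of what is substituted. Permuting variables
    and appending zeros preserve them, which gives symmetry and stability. *)
Lemma power_sum_family_morph n n' (h : 'I_n -> {mpoly Kqt[n']}) :
  (forall k, \sum_i h i ^+ k.+1 = psum n' k.+1) ->
  mmap (@mpolyC n' Kqt) h (f n) = f n'.
Proof.
move=> hp; rewrite !fE /comp_mpoly mmap_morph; apply: eq_mmap => [x|i] /=.
  by rewrite mmapC.
rewrite !tnth_mktuple mmapZ mul_mpolyC -hp /psum rmorph_sum; congr (_ *: _).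
by apply: eq_bigr => k _; rewrite rmorphXn /= mmapX mmap1U.
Qed.

Lemma power_sum_family_sym n : f n \is symmetric.
Proof.
apply/issymP => s; apply: power_sum_family_morph => k.
by rewrite /psum [RHS](reindex_inj (@perm_inj _ s)).
Qed.

Lemma power_sum_family_stable : stable_family f.
Proof.
move=> l k; apply: power_sum_family_morph => i.
rewrite big_split_ord /= [X in _ + X]big1 ?addr0.
  apply: eq_bigr => j _; rewrite tnth_mktuple.
  case: split_ordP => j' e; first by rewrite (lshift_inj e).
  by exfalso; move/eqP: e; rewrite eq_lrshift.
move=> j _; rewrite tnth_mktuple; case: split_ordP => j' e; last by rewrite expr0n.
by exfalso; move/eqP: e; rewrite eq_rlshift.
Qed.
End PowerSumFamily.

Lemma sumn_take_nth k (mu : seq nat) :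
  sumn (take k mu) = (\sum_(i < size mu | (i < k)%N) nth 0 mu i)%N.
Proof.
elim: mu k => [|x mu IH] [|k] /=; rewrite ?big_ord0 //.
  by rewrite big_pred0.
by rewrite IH big_mkcond [RHS]big_mkcond big_ord_recl.
Qed.

(** * Counting the cells of the first rows *)

Section Dominance.
Variable la : seq nat.
Hypothesis laP : is_partition la.

Lemma head_max j : (nth 0 la j <= head 0 la)%N.
Proof. by rewrite -nth0; apply: nth_partition_mono. Qed.

Lemma card_rows_below k :
  #|[set c : dg la | (cell_row c < k)%N]| = \sum_(r < k) count (fun h => r < h)%N la.
Proof.
elim: k => [|k IH]; first by rewrite big_ord0; apply: eq_card0 => c; rewrite inE.
rewrite big_ord_recr /= -IH.
have <- : #|[set c : dg la | (cell_row c == k) && predT (cell_col c)]| =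
    count (fun h => k < h)%N la.
  rewrite card_row -sum1_card -sum1_count (big_nth 0%N) big_mkord.
  by apply: eq_bigl => i; rewrite inE andbT.
rewrite -[RHS]cardUI [X in (_ + X)%N](_ : _ = 0%N) ?addn0; last first.
  by apply: eq_card0 => c; rewrite !inE andbT; lia.
by apply: eq_card => c; rewrite !inE andbT ltnS leq_eqVlt orbC.
Qed.

Lemma sumn_take_conj k :
  sumn (take k (conj_part la)) = #|[set c : dg la | (cell_row c < k)%N]|.
Proof.
transitivity #|[set c : dg la | (cell_row c < minn k (head 0 la))%N]|; last first.
  apply: eq_card => c; rewrite !inE ltn_min andb_idr // => _.
  exact: leq_trans (row_lt c) (head_max _).
rewrite card_rows_below /conj_part -map_take take_iota sumnE big_map.
by rewrite -[iota 0 _](congr1 (iota 0) (subn0 _)) big_mkord.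
Qed.

Lemma sumn_conj : sumn (conj_part la) = sumn la.
Proof.
rewrite -{1}(take_size (conj_part la)) sumn_take_conj -card_dg.
apply: eq_card => c; rewrite !inE size_map size_iota.
exact: leq_trans (row_lt c) (head_max _).
Qed.

Lemma superSum_support l (m : 'X_{1..l}) : (superSum la l)@_m != 0 ->
  exists2 s : sfilling la l, phi_trivial s & xmon s = 'X_[m].
Proof.
move=> nz; have [/existsP[s /andP[ts /eqP e]]|] :=
  boolP [exists s : sfilling la l, phi_trivial s && (xmon s == 'X_[m])]; first by exists s.
rewrite negb_exists => /forallP h; case/negP: nz; apply/eqP.
rewrite /superSum raddf_sum; apply: big1 => s ts; rewrite /= mcoeffZ.
have := h s; rewrite ts /= => ne.
pose w : {ffun dg la -> 'I_l} := [ffun c => (s c).2].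
have xE : xmon s = 'X_[content w].
  by rewrite -prod_content; apply: eq_bigr => c _; rewrite ffunE.
rewrite xE mcoeffX; case: eqP => [e|_]; last by rewrite mulr0.
by move: ne; rewrite xE e eqxx.
Qed.

Lemma mpolyX_inj l (m m' : 'X_{1..l}) : 'X_[m] = 'X_[m'] :> {mpoly Kqt[l]} -> m = m'.
Proof.
move=> /(congr1 (mcoeff m')); rewrite !mcoeffX eqxx; case: eqP => // _ /esym/eqP.
by rewrite oner_eq0.
Qed.

Lemma superSum_dominated mu :
  (superSum la (size mu))@_[multinom nth 0%N mu i | i < size mu] != 0 ->
  dominated mu (conj_part la).
Proof.
move=> /superSum_support[s /forallP st xs].
pose w : {ffun dg la -> 'I_(size mu)} := [ffun c => (s c).2].
have cE : content w = [multinom nth 0%N mu i | i < size mu].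
  apply: mpolyX_inj; rewrite -xs -prod_content; apply: eq_bigr => c _.
  by rewrite ffunE.
have tE k : sumn (take k mu) = #|[set c | (w c < k)%N]|.
  rewrite -sum1_card (partition_big w predT) //=.
  transitivity (\sum_(i < size mu | (i < k)%N) nth 0%N mu i)%N.
    exact: sumn_take_nth.
  rewrite big_mkcond; apply: eq_bigr => i _.
  case: ifP => ik.
    rewrite sum1_card; have := congr1 (fun m : 'X_{1..size mu} => m i) cE.
    rewrite mnmE contentE => <-; apply: eq_card => c; rewrite !inE.
    by apply/esym/andb_idl => /eqP e; rewrite inE e.
  by rewrite big_pred0 // => c; rewrite inE; apply: contraFF ik => /andP[h /eqP <-].
have le k : (sumn (take k mu) <= sumn (take k (conj_part la)))%N.
  rewrite tE sumn_take_conj; apply: subset_leq_card; apply/subsetP => c; rewrite !inE ffunE.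
  by apply: leq_ltn_trans; apply: st.
apply/andP; split; last by apply/allP.
rewrite -{1}(take_size mu) tE sumn_conj -card_dg; apply/eqP/eq_card => c.
by rewrite !inE ltn_ord.
Qed.

End Dominance.

(** A finite list containing all partitions of [d], which have at most [d] parts, each at most
    [d]. *)
Definition small_seqs d : seq (seq nat) :=
  [seq map (@nat_of_ord d.+1) (bseqval b) | b <- enum {: d.-bseq 'I_d.+1}].

Lemma mem_small_seqs d mu : is_partition mu -> sumn mu = d -> mu \in small_seqs d.
Proof.
move=> /andP[_ pos] sm.
have sz : (size mu <= d)%N.
  rewrite -sm; elim: mu pos {sm} => //= x l IH /andP[x0 /IH h].
  by rewrite -addn1 addnC leq_add.
have le x : x \in mu -> (x <= d)%N.
  rewrite -sm; elim: mu {sm pos sz} => //= y l IH; rewrite inE => /orP[/eqP->|/IH h].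
    exact: leq_addr.
  exact: leq_trans h (leq_addl _ _).
have szb : (size (map (@inord d) mu) <= d)%N by rewrite size_map.
apply/mapP; exists (Bseq szb); first by rewrite mem_enum.
rewrite /= -map_comp -[LHS]map_id; apply/eq_in_map => x /le h /=.
by rewrite inordK.
Qed.

(* Part 1: C_la[X(q-1)] = sum over Phi-trivial super fillings.  The plethysm
   is encoded by a polynomial P (in d = |la| variables) with
   C_la = P(p_1,...,p_d) and C_la[X(q-1)] = P((q-1)p_1,...,(q^d-1)p_d),
   in every finite number n of variables x_1..x_n.
   Part 2: that sum equals  sum_{mu <= la'} d_mu m_mu. *)
Theorem mainTheorem8 (la : seq nat) :
  is_partition la ->
  (exists P : {mpoly Kqt[sumn la]},
     forall n : nat,
       Cla la n = comp_mpoly [tuple psum n i.+1 | i < sumn la] P /\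
       superSum la n =
         comp_mpoly [tuple (qq ^+ i.+1 - 1) *: psum n i.+1 | i < sumn la] P)
  /\
  (exists (S : seq (seq nat)) (d : seq nat -> Kqt),
     all (fun mu => is_partition mu && dominated mu (conj_part la)) S /\
     forall n : nat,
       superSum la n = \sum_(mu <- S) d mu *: msym_mono n mu).
Proof.
move=> laP; have [P PE] := plethysm laP; split; first by exists P.
have fE n : superSum la n = comp_mpoly [tuple (qq ^+ i.+1 - 1) *: psum n i.+1 | i < sumn la] P.
  by have [] := PE n.
have fc := mcoeff_shape (power_sum_family_sym (c := fun i => qq ^+ i.+1 - 1) fE)
   (power_sum_family_stable (c := fun i => qq ^+ i.+1 - 1) fE).
(* [S] and the coefficients [shape_coef] do not depend on the number of variables. *)
pose S := undup [seq mu <- small_seqs (sumn la) | is_partition mu && dominated mu (conj_part la)].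
exists S, (shape_coef (superSum la)); split.
  by apply/allP => mu; rewrite mem_undup mem_filter => /andP[].
apply: msym_mono_expansion; [exact: undup_uniq | exact: fc |].
move=> n m; rewrite fc => nz; have dm := superSum_dominated laP nz.
rewrite mem_undup mem_filter mono_shape_partition dm /=.
apply: mem_small_seqs; first exact: mono_shape_partition.
by move: dm => /andP[/eqP -> _]; rewrite sumn_conj.
Qed.
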